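(* Let $\mathcal V:\mathcal M_p\to\mathbb R$ be continuous and assume $$\mathcal V(\mu)\le\alpha W_p(\mu,\varrho)^p+\beta,\qquad \mu\in\mathcal M_p,$$ for some measure $\varrho\in\mathcal M_p$ and $\alpha,\beta\in\mathbb R$. Then there is $\delta_0=\delta_0(p,\alpha)>0$, depending only on $p$ and $\alpha$, such that, provided $\delta>\delta_0$, the functional $\mathcal U$ is a viscosity solution of the Hamilton–Jacobi equation $$\delta\,\mathcal U+\frac1q\|\nabla\mathcal U\|^q_{L^q(\mu)}+\mathcal V(\mu)=0,\qquad\mu\in\mathcal M_p .$$
   Context: Fix $d\ge1$, $p\in(1,\infty)$, $\delta\in(0,\infty)$, and $q$ with $1/p+1/q=1$. $\mathcal M_p$ is the set $\mathcal P_p(\mathbb R^d)$ of Borel probability measures on $\mathbb R^d$ with finite $p$th moment, equipped with the $p$-Wasserstein metric $W_p(\mu,\nu)=\inf\{(\iint|x-y|^pd\pi)^{1/p}:\pi\in\Gamma(\mu,\nu)\}$, where $\Gamma(\mu,\nu)$ is the set of measures in $\mathcal P_p(\mathbb R^d\times\mathbb R^d)$ with first marginal $\mu$ and second marginal $\nu$. $\Gamma_0(\mu,\nu)\subset\Gamma(\mu,\nu)$ is the set of optimal couplings (those attaining the infimum). A path $\sigma:[0,\infty)\to\mathcal M_p$ is locally $p$-absolutely continuous if there is $m\in L^p_{loc}([0,\infty))$ with $W_p(\sigma(s),\sigma(t))\le\int_s^tm(\tau)d\tau$ for $0\le s\le t$; its metric derivative $\|\dot\sigma(t)\|=\lim_{h\to0}W_p(\sigma(t+h),\sigma(t))/|h|$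 exists for a.e. $t$. $AC_{p,\delta}(\mathcal M_p)$ is the set of such paths with $\int_0^\infty e^{-\delta t}\|\dot\sigma(t)\|^pdt<\infty$. The generalized value function is $$\mathcal U(\mu)=\inf\left\{\int_0^\infty e^{-\delta t}\left(\tfrac1p\|\dot\sigma(t)\|^p-\mathcal V(\sigma(t))\right)dt:\ \sigma\in AC_{p,\delta}(\mathcal M_p),\ \sigma(0)=\mu\right\}.$$ Cotangent space: $\mathrm{CoTan}_\mu\mathcal M_p$ is the closure of $\{\nabla\psi:\psi\in C_c^\infty(\mathbb R^d)\}$ in $L^q(\mu)$. Superdifferential: $\xi\in\mathrm{CoTan}_{\mu_0}\mathcal M_p$ belongs to $\nabla^+\mathcal U(\mu_0)$ if $\mathcal U(\mu)\le\mathcal U(\mu_0)+\inf_{\pi\in\Gamma_0(\mu_0,\mu)}\iint\xi(x)\cdot(y-x)d\pi(x,y)+o(W_p(\mu_0,\mu))$ as $\mu\to\mu_0$ in $\mathcal M_p$. Subdifferential: $\xi\in\mathrm{CoTan}_{\mu_0}\mathcal M_p$ belongs to $\nabla^-\mathcal U(\mu_0)$ if $\mathcal U(\mu)\ge\mathcal U(\mu_0)+\sup_{\pi\in\Gamma_0(\mu_0,\mu)}\iint\xi(x)\cdot(y-x)d\pi(x,y)+o(W_p(\mu_0,\mu))$ as $\mu\to\mu_0$. Viscosity solution: an upper semicontinuous $\mathcal U$ on $\mathcal M_p$ is a viscosity subsolution of the equation if $\delta\,\mathcal U(\mu_0)+\frac1q\|\xi\|^q_{L^q(\mu_0)}+\mathcal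 V(\mu_0)\le0$ for all $\mu_0\in\mathcal M_p$ and all $\xi\in\nabla^+\mathcal U(\mu_0)$; a lower semicontinuous $\mathcal U$ is a viscosity supersolution if $\delta\,\mathcal U(\mu_0)+\frac1q\|\xi\|^q_{L^q(\mu_0)}+\mathcal V(\mu_0)\ge0$ for all $\mu_0$ and all $\xi\in\nabla^-\mathcal U(\mu_0)$; a continuous (real-valued) $\mathcal U$ is a viscosity solution if it is both a sub- and a supersolution. *)

(* Defs.v *)
From HB Require Import structures.
From mathcomp Require Import all_boot all_order all_algebra.
From mathcomp Require Import all_classical all_reals all_analysis.

Set Implicit Arguments.
Unset Strict Implicit.
Unset Printing Implicit Defensive.

Import Order.TTheory GRing.Theory Num.Theory.
Import numFieldNormedType.Exports.

Local Open Scope classical_set_scope.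
Local Open Scope ring_scope.

Definition dot (R : realType) (d : nat) (x y : 'rV[R]_d) : R :=
  \sum_(i < d) x 0 i * y 0 i.

(* The norm `|x| that the library puts on row vectors is the sup norm. *)
Definition enorm (R : realType) (d : nat) (x : 'rV[R]_d) : R :=
  Num.sqrt (dot x x).

(* R^d with its Borel sigma-algebra *)
Definition Rd (R : realType) (d : nat) :=
  g_sigma_algebraType (@open 'rV[R]_d).

Section Wasserstein.
Context {R : realType} {d : nat}.
Implicit Types p q : R.

Record Mp p := MkMp {
  Mp_prob :> probability (Rd R d) R ;
  Mp_moment : (\int[Mp_prob]_x (enorm x `^ p)%:E < +oo)%E }.

(* The Euclidean norm on R^d x R^d = R^(2d) *)
Definition enorm2 (z : Rd R d * Rd R d) : R :=
  Num.sqrt (enorm z.1 ^+ 2 + enorm z.2 ^+ 2).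

Definition couplings p (mu nu : Mp p) :
    set (probability (Rd R d * Rd R d)%type R) :=
  [set pi | [/\ (\int[pi]_z (enorm2 z `^ p)%:E < +oo)%E,
                (forall A : set (Rd R d), measurable A ->
                   pi (fst @^-1` A) = mu A) &
                (forall A : set (Rd R d), measurable A ->
                   pi (snd @^-1` A) = nu A)]].

Definition transport_cost p (pi : probability (Rd R d * Rd R d)%type R)
    : \bar R :=
  ((\int[pi]_z (enorm ((z.1 : 'rV[R]_d) - z.2) `^ p)%:E) `^ p^-1)%E.

Definition Wp_ereal p (mu nu : Mp p) : \bar R :=
  ereal_inf (transport_cost p @` couplings mu nu).

(* No information is lost by fine: couplings exist (the product measure) and
   have finite cost. *)
Definition Wp p (mu nu : Mp p) : R := fine (Wp_ereal mu nu).

Definition opt_couplings p (mu nu : Mp p) :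
    set (probability (Rd R d * Rd R d)%type R) :=
  [set pi | couplings mu nu pi /\ transport_cost p pi = Wp_ereal mu nu].

Definition Mp_usc p (U : Mp p -> R) : Prop :=
  forall mu0 eps, 0 < eps -> exists2 eta, 0 < eta &
    forall mu, Wp mu0 mu < eta -> U mu < U mu0 + eps.

Definition Mp_lsc p (U : Mp p -> R) : Prop :=
  forall mu0 eps, 0 < eps -> exists2 eta, 0 < eta &
    forall mu, Wp mu0 mu < eta -> U mu0 - eps < U mu.

Definition Mp_continuous p (U : Mp p -> R) : Prop :=
  forall mu0 eps, 0 < eps -> exists2 eta, 0 < eta &
    forall mu, Wp mu0 mu < eta -> `|U mu - U mu0| < eps.

(* A path [0, oo) -> Mp is encoded by a function on R of which only the
   values at nonnegative times are used. *)

Definition Lploc p (m : R -> R) : Prop :=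
  measurable_fun (`[0, +oo[ : set R) m /\
  forall T, 0 < T ->
    (\int[lebesgue_measure]_(t in `[0%R, T]) (`|m t| `^ p)%:E < +oo)%E.

Definition ACloc p (sigma : R -> Mp p) : Prop :=
  exists2 m : R -> R, Lploc p m &
    forall s t, 0 <= s -> s <= t ->
      ((Wp (sigma s) (sigma t))%:E
         <= \int[lebesgue_measure]_(r in `[s, t]) (m r)%:E)%E.

Definition metric_derivative p (sigma : R -> Mp p) (t : R) : R :=
  lim (Wp (sigma (t + h)) (sigma t) / `|h|
       @[h --> within [set h | 0 <= t + h] 0^']).

Definition ACpdelta p (delta : R) (sigma : R -> Mp p) : Prop :=
  ACloc sigma /\
  (\int[lebesgue_measure]_(t in `[0%R, +oo[)
      (expR (- (delta * t)) * metric_derivative sigma t `^ p)%:E < +oo)%E.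

Definition action p (delta : R) (V : Mp p -> R) (sigma : R -> Mp p)
    : \bar R :=
  (\int[lebesgue_measure]_(t in `[0%R, +oo[)
      (expR (- (delta * t)) *
         (p^-1 * metric_derivative sigma t `^ p - V (sigma t)))%:E)%E.

Definition value_function p (delta : R) (V : Mp p -> R) (mu : Mp p)
    : \bar R :=
  ereal_inf (action delta V @`
               [set sigma | ACpdelta delta sigma /\ sigma 0 = mu]).

Definition ebasis (i : 'I_d) : 'rV[R]_d := delta_mx 0 i.

Definition grad (psi : 'rV[R]_d -> R) (x : 'rV[R]_d) : 'rV[R]_d :=
  \row_i 'D_(ebasis i) psi x.

Fixpoint partials (s : seq 'I_d) (psi : 'rV[R]_d -> R) : 'rV[R]_d -> R :=
  if s is i :: s' then fun x => 'D_(ebasis i) (partials s' psi) x else psi.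

(* The space C^oo_c(R^d): all iterated partial derivatives exist and are
   continuous. *)
Definition test_function (psi : 'rV[R]_d -> R) : Prop :=
  (forall s : seq 'I_d, continuous (partials s psi) /\
     forall i x, derivable (partials s psi) x (ebasis i)) /\
  compact (closure [set x | psi x != 0]).

Definition Lnorm_vec (mu : probability (Rd R d) R) q (xi : Rd R d -> Rd R d)
    : \bar R :=
  Lnorm mu q%:E (fun x => (enorm (xi x))%:E).

(* Elements of L^q(mu; R^d) are represented by functions; everything below
   is invariant under modification on mu-null sets. *)
Definition in_Lq (mu : probability (Rd R d) R) q (xi : Rd R d -> Rd R d)
    : Prop :=
  measurable_fun setT xi /\ (Lnorm_vec mu q xi < +oo)%E.

Definition CoTan (mu : probability (Rd R d) R) q : set (Rd R d -> Rd R d) :=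
  [set xi | in_Lq mu q xi /\
     forall eps : R, 0 < eps -> exists2 psi : 'rV[R]_d -> R, test_function psi &
       (Lnorm_vec mu q (fun x => (xi x : 'rV[R]_d) - grad psi x)%R
          < eps%:E)%E].

Definition pairing (xi : Rd R d -> Rd R d)
    (pi : probability (Rd R d * Rd R d)%type R) : \bar R :=
  (\int[pi]_z (dot (xi z.1) ((z.2 : 'rV[R]_d) - z.1))%:E)%E.

Definition superdifferential p q (U : Mp p -> R) (mu0 : Mp p)
    : set (Rd R d -> Rd R d) :=
  [set xi | CoTan mu0 q xi /\
     forall eps : R, 0 < eps -> exists2 eta : R, 0 < eta &
       forall mu : Mp p, Wp mu0 mu < eta ->
         ((U mu)%:E <= (U mu0)%:E
            + ereal_inf (pairing xi @` opt_couplings mu0 mu)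
            + (eps * Wp mu0 mu)%:E)%E].

Definition subdifferential p q (U : Mp p -> R) (mu0 : Mp p)
    : set (Rd R d -> Rd R d) :=
  [set xi | CoTan mu0 q xi /\
     forall eps : R, 0 < eps -> exists2 eta : R, 0 < eta &
       forall mu : Mp p, Wp mu0 mu < eta ->
         ((U mu)%:E >= (U mu0)%:E
            + ereal_sup (pairing xi @` opt_couplings mu0 mu)
            - (eps * Wp mu0 mu)%:E)%E].

(* The left-hand side of the equation, with xi in place of the gradient *)
Definition HJ p q (delta : R) (V U : Mp p -> R) (mu : Mp p)
    (xi : Rd R d -> Rd R d) : R :=
  delta * U mu + q^-1 * fine (Lnorm_vec mu q xi) `^ q + V mu.

Definition viscosity_subsolution p q (delta : R) (V U : Mp p -> R) : Prop :=
  Mp_usc U /\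
  forall mu0 xi, superdifferential q U mu0 xi -> HJ q delta V U mu0 xi <= 0.

Definition viscosity_supersolution p q (delta : R) (V U : Mp p -> R) : Prop :=
  Mp_lsc U /\
  forall mu0 xi, subdifferential q U mu0 xi -> 0 <= HJ q delta V U mu0 xi.

Definition viscosity_solution p q (delta : R) (V U : Mp p -> R) : Prop :=
  [/\ Mp_continuous U, viscosity_subsolution q delta V U &
      viscosity_supersolution q delta V U].

End Wasserstein.

Arguments Mp R d p : clear implicits.

(* Main.v *)
(* A path of speed [v] from [mu] has energy [\int e^(-delta t) (v^p / p - V)]. Since
   [W(mu, sigma t)^p] is controlled, with a constant that tends to [0] as [delta] grows, by
   [e^(delta t / 2) \int_0^t e^(-delta s / 2) v^p], the growth of [V] is absorbed by the kinetic
   term for large [delta]: the value is finite and almost minimizing paths have bounded kinetic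
   energy. Concatenation and time shift give dynamic programming.
   Subsolution: near [mu0] move along [id + t w] with [w = - |xi|^(q-2) xi]. This coupling need
   not be optimal, but for [xi] in the cotangent space the pairings with two couplings of the same
   marginals differ by [o(cost)], because [\int psi] depends on the marginals only. Optimal
   couplings exist because couplings have tight marginals: an ultrafilter limit of the values on
   rectangles is countably additive by inner regularity.
   Supersolution: along an almost minimizing path, [v^p / p >= a v - a^q / q] with
   [a = ||xi|| + eps], and the pairing is at least [- ||xi|| W]. *)
Require Import Defs.
From HB Require Import structures.
From mathcomp Require Import all_boot all_order all_algebra.
From mathcomp Require Import all_classical all_reals all_analysis.
From mathcomp Require Import measurable_realfun ring lra.

Set Implicit Arguments.
Unset Strict Implicit.
Unset Printing Implicit Defensive.

Import Order.TTheory GRing.Theory Num.Theory.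
Import numFieldNormedType.Exports.
Local Open Scope classical_set_scope.
Local Open Scope ring_scope.

(** * Euclidean norm and Borel sets *)

(** Two features of the definitions shape the proof. The metric derivative is a [lim]: it has a
    default value where no limit exists, its measurability is not given, and it would have to be
    recomputed after cutting and pasting paths. Dynamic programming is therefore run on pairs of a
    path and a measurable bound on its speed. Such pairs are stable under shift and concatenation,
    their energy is at least the action of the path, and the two agree for a measurable version of
    the metric derivative. Comparison of integrals off null sets, without measurability, links both
    sides. The threshold for [delta] comes from coercivity. Half of the rate, [delta / 2], pays for
    the growth of [Wp] along a path, the other half for integrating it in time. The potential may
    use up half of the kinetic term, [(2 * p)^-1] out of [p^-1]; what is left bounds the kinetic
    energy of almost minimizers. The triangle inequality for [Wp] is obtained without
    disintegration: couplings are glued up to cells of small diameter, and the diameter is then sent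
    to zero. *)

Section euclidean.
Context {R : realType} {d : nat}.
Implicit Types x y z : 'rV[R]_d.

Lemma dotC x y : dot x y = dot y x.
Proof. by apply: eq_bigr => i _; rewrite mulrC. Qed.

Lemma dotDl x y z : dot (x + y) z = dot x z + dot y z.
Proof. by rewrite /dot -big_split/=; apply: eq_bigr => i _; rewrite mxE mulrDl. Qed.

Lemma dotZl (a : R) x y : dot (a *: x) y = a * dot x y.
Proof. by rewrite /dot mulr_sumr; apply: eq_bigr => i _; rewrite mxE mulrA. Qed.

Lemma dotDr x y z : dot z (x + y) = dot z x + dot z y.
Proof. by rewrite !(dotC z) dotDl. Qed.

Lemma dotZr (a : R) x y : dot y (a *: x) = a * dot y x.
Proof. by rewrite !(dotC y) dotZl. Qed.

Lemma dotNl x y : dot (- x) y = - dot x y.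
Proof. by rewrite -scaleN1r dotZl mulN1r. Qed.

Lemma dotBl x y z : dot (x - y) z = dot x z - dot y z.
Proof. by rewrite dotDl dotNl. Qed.

Lemma dotxx_ge0 x : 0 <= dot x x.
Proof. by apply: sumr_ge0 => i _; rewrite -expr2 sqr_ge0. Qed.

Lemma enorm_ge0 x : 0 <= enorm x. Proof. exact: sqrtr_ge0. Qed.

Lemma sqr_enorm x : enorm x ^+ 2 = dot x x.
Proof. by rewrite sqr_sqrtr// dotxx_ge0. Qed.

Lemma enorm0 : enorm (0 : 'rV[R]_d) = 0.
Proof. by rewrite /enorm/dot big1 ?sqrtr0// => i _; rewrite mxE mul0r. Qed.

Lemma enormZ (a : R) x : enorm (a *: x) = `|a| * enorm x.
Proof. by rewrite /enorm dotZl dotZr mulrA -expr2 sqrtrM ?sqr_ge0// sqrtr_sqr. Qed.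

Lemma enormN x : enorm (- x) = enorm x.
Proof. by rewrite -scaleN1r enormZ normrN1 mul1r. Qed.

Lemma enormBC x y : enorm (x - y) = enorm (y - x).
Proof. by rewrite -enormN opprB. Qed.

Lemma coord_le_enorm x i : `|x 0 i| <= enorm x.
Proof.
rewrite -sqrtr_sqr; apply: ler_wsqrtr.
rewrite /dot (bigD1 i)//= -expr2 lerDl.
by apply: sumr_ge0 => j _; rewrite -expr2 sqr_ge0.
Qed.

Lemma enorm0_eq0 x : enorm x = 0 -> x = 0.
Proof.
move=> x0; apply/rowP => i; rewrite mxE; apply/eqP; rewrite -normr_le0.
by rewrite (le_trans (coord_le_enorm x i))// x0.
Qed.

(** Cauchy-Schwarz, by expanding the square of [enorm y *: x - enorm x *: y]. The degenerate cases
    are split off because the result is divided by [enorm x * enorm y]. *)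
Lemma dot_le_enorm x y : dot x y <= enorm x * enorm y.
Proof.
have [x0|x0] := eqVneq (enorm x) 0.
  rewrite (enorm0_eq0 x0) enorm0 mul0r.
  by rewrite /dot big1// => i _; rewrite mxE mul0r.
have [y0|y0] := eqVneq (enorm y) 0.
  rewrite (enorm0_eq0 y0) enorm0 mulr0.
  by rewrite /dot big1// => i _; rewrite mxE mulr0.
have xy0 : 0 < enorm x * enorm y.
  by rewrite mulr_gt0// lt_neqAle eq_sym enorm_ge0 ?x0 ?y0.
have := dotxx_ge0 (enorm y *: x - enorm x *: y).
rewrite dotBl !dotZl dotDr -scaleNr !dotZr dotDr !dotZr -!sqr_enorm (dotC y x) => h.
rewrite -(ler_pM2l xy0); nra.
Qed.

Lemma normr_dot_le x y : `|dot x y| <= enorm x * enorm y.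
Proof.
by rewrite ler_norml dot_le_enorm andbT lerNl -dotNl -(enormN x) dot_le_enorm.
Qed.

Lemma enormD x y : enorm (x + y) <= enorm x + enorm y.
Proof.
rewrite -(@ler_pXn2r _ 2)// ?nnegrE ?addr_ge0 ?enorm_ge0//.
rewrite sqr_enorm dotDl !dotDr (dotC y x) sqrrD -!sqr_enorm.
have := dot_le_enorm x y; lra.
Qed.

Lemma enormB_dist x y : `|enorm x - enorm y| <= enorm (x - y).
Proof.
rewrite ler_norml; apply/andP; split.
  have := enormD (y - x) x; rewrite subrK (enormBC y); lra.
have := enormD (x - y) y; rewrite subrK; lra.
Qed.

Lemma enorm_sum (s : seq 'I_d) (F : 'I_d -> 'rV[R]_d) :
  enorm (\sum_(i <- s) F i) <= \sum_(i <- s) enorm (F i).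
Proof.
elim: s => [|i s ih]; first by rewrite !big_nil enorm0.
by rewrite !big_cons (le_trans (enormD _ _))// lerD2l.
Qed.

Lemma enorm_le_sum_coord x : enorm x <= \sum_(i < d) `|x 0 i|.
Proof.
rewrite {1}(row_sum_delta x) (le_trans (enorm_sum _ _))//.
apply: ler_sum => i _; rewrite enormZ ler_piMr// /enorm /dot (bigD1 i)//= big1.
  by rewrite !mxE !eqxx mulr1 addr0 sqrtr1.
by move=> j ji; rewrite !mxE (negbTE ji) andbF mulr0.
Qed.

(** Passage from the sup-norm balls of the topology to the Euclidean norm. *)
Lemma enorm_lt_coord x (e : R) : 0 < e -> (forall i, `|x 0 i| < e) ->
  enorm x <= d%:R * e.
Proof.
move=> e0 xe; rewrite (le_trans (enorm_le_sum_coord x))//.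
rewrite (@le_trans _ _ (\sum_(i < d) e))//; first by apply: ler_sum => i _; exact/ltW.
by rewrite sumr_const card_ord mulr_natl.
Qed.

Lemma enorm_continuous : continuous (@enorm R d).
Proof.
move=> x; apply/(@cvgrPdist_lt _ _ _ (nbhs x) (nbhs_filter x)) => e e0.
(* [d.+1] in place of [d] keeps the radius positive when [d = 0]. *)
have e' : 0 < e / d.+1%:R by rewrite divr_gt0.
apply: filterS (nbhsx_ballx x _ e') => y yx.
rewrite (le_lt_trans (enormB_dist _ _))//.
rewrite (@le_lt_trans _ _ (d%:R * (e / d.+1%:R)))//.
  by apply: enorm_lt_coord => // i; rewrite !mxE; exact: (yx.2 ord0 i).
by rewrite mulrCA -[ltRHS]mulr1 ltr_pM2l// ltr_pdivrMr// mul1r ltr_nat.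
Qed.

(** An enumeration of the rational vectors by their codes; a number that codes no vector is sent to
    [0]. *)
Definition rat_seq (k : nat) : 'rV[R]_d :=
  if @unpickle 'rV[rat]_d k is Some v then map_mx ratr v else 0.

Lemma rat_seq_dense x (e : R) : 0 < e ->
  exists k, forall i, `|x 0 i - rat_seq k 0 i| < e.
Proof.
move=> e0; have H i : exists q : rat, `|x 0 i - ratr q| < e.
  have [|q] := @rat_in_itvoo R (x 0 i - e) (x 0 i + e); first lra.
  rewrite in_itv/= => /andP[q1 q2]; exists q; rewrite ltr_norml; lra.
have [q Hq] := fin_all_exists H.
exists (pickle (\row_i q i)) => i; rewrite /rat_seq pickleK !mxE; exact: Hq.
Qed.

Definition cube x (e : R) : set 'rV[R]_d :=
  [set y | forall i, `|x 0 i - y 0 i| < e].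

Lemma cubeE x e : 0 < e -> cube x e = ball x e.
Proof.
move=> e0; apply/seteqP; split => [y xy|y [_ xy] i]; last exact: xy.
by split => // i j; rewrite ord1; exact: xy.
Qed.

(** Second countability, in the form that reduces measurability of a map into [Rd] to its
    coordinates: the sigma-algebra is generated by all open sets, and each is a countable union of
    rational cubes. *)
Lemma open_bigcup_cube (O : set 'rV[R]_d) : open O ->
  O = \bigcup_(k in setT) \bigcup_(n in [set n | cube (rat_seq k) n.+1%:R^-1 `<=` O])
        cube (rat_seq k) n.+1%:R^-1.
Proof.
move=> oO; apply/seteqP; split; last by move=> x [k _] [n /= h] /h.
move=> x Ox; have /nbhs_ballP[e /= e0 eO] := open_nbhs_nbhs (conj oO Ox).
have [n ne] : exists n, n.+1%:R^-1 < e / 2.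
  have := near_infty_natSinv_lt (PosNum (divr_gt0 e0 (ltr0Sn R 1))).
  by by move=> [n _ /(_ n (leqnn n))] ?; exists n.
have n0 : 0 < n.+1%:R^-1 :> R by rewrite invr_gt0.
have [k xk] := rat_seq_dense x n0.
exists k => //; exists n => /= [y ky|i]; last by rewrite distrC; exact: xk.
apply: eO; rewrite -cubeE// => i.
rewrite (le_lt_trans (ler_distD (rat_seq k 0 i) _ _))//.
apply: (lt_trans (ltrD (xk i) (ky i))); move: (n.+1%:R^-1) ne => t; lra.
Qed.

End euclidean.

Section measurability.
Context {R : realType} {d : nat}.

Lemma open_measurable_Rd (O : set 'rV[R]_d) : open O -> measurable (O : set (Rd R d)).
Proof. by move=> oO; exact: sub_sigma_algebra. Qed.

Lemma closed_measurable_Rd (C : set 'rV[R]_d) : closed C -> measurable (C : set (Rd R d)).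
Proof.
move=> cC; rewrite -[C]setCK; apply: (@measurableC _ (Rd R d)).
by apply: open_measurable_Rd; exact: closed_openC.
Qed.

Lemma continuous_measurable_Rd (f : 'rV[R]_d -> R) : continuous f ->
  measurable_fun [set: Rd R d] f.
Proof.
move=> cf; apply: (measurability _ (RGenOInfty.measurableE R)).
move=> _ [_ [x ->] <-]; rewrite setTI.
apply: open_measurable_Rd; rewrite preimage_itvoy.
rewrite (_ : [set _ | _] = f @^-1` [set y | x < y])//.
by apply: open_comp => [y _|]; [exact: cf|exact: open_gt].
Qed.

Lemma measurable_coord (i : 'I_d) : measurable_fun [set: Rd R d] (fun x : Rd R d => x 0 i).
Proof. by apply: continuous_measurable_Rd; exact: coord_continuous. Qed.

Lemma measurable_enorm : measurable_fun [set: Rd R d] (fun x : Rd R d => enorm x).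
Proof. by apply: continuous_measurable_Rd; exact: enorm_continuous. Qed.

Lemma measurable_fun_Rd d' (T : measurableType d') (f : T -> Rd R d) :
  (forall i, measurable_fun setT (fun t => f t 0 i)) -> measurable_fun setT f.
Proof.
move=> mf; apply: (@measurability _ _ T (Rd R d) _ _ (@open 'rV[R]_d) erefl).
move=> _ [U oU <-]; rewrite setTI (open_bigcup_cube oU) preimage_bigcup.
apply: bigcup_measurable => k _; rewrite preimage_bigcup.
apply: bigcup_measurable => n _.
rewrite (_ : _ @^-1` _ = \bigcap_(i in [set: 'I_d])
   ((fun t => f t 0 i) @^-1` ball (rat_seq k 0 i : R) n.+1%:R^-1)); last first.
  by apply/seteqP; split => [t h i _|t h i]; [exact: h|exact: (h i I)].
apply: fin_bigcap_measurable => // i _.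
rewrite -[X in measurable X]setTI; apply: mf => //.
by apply: open_measurable; apply: ball_open; rewrite invr_gt0.
Qed.

Section pointwise.
Context d' (T : measurableType d').
Implicit Types f g : T -> Rd R d.

Let coordT f i : measurable_fun setT f -> measurable_fun setT (fun t => f t 0 i).
Proof. by move=> mf; exact: (measurableT_comp (measurable_coord i) mf). Qed.

Lemma measurable_fun_RdD f g : measurable_fun setT f -> measurable_fun setT g ->
  measurable_fun setT (fun t => (f t : 'rV[R]_d) + g t : Rd R d).
Proof.
move=> mf mg; apply: measurable_fun_Rd => i.
under eq_fun do rewrite mxE.
by apply: measurable_funD; exact: coordT.
Qed.

Lemma measurable_fun_RdZ (a : T -> R) f : measurable_fun setT a -> measurable_fun setT f ->
  measurable_fun setT (fun t => a t *: (f t : 'rV[R]_d) : Rd R d).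
Proof.
move=> ma mf; apply: measurable_fun_Rd => i.
under eq_fun do rewrite mxE.
by apply: measurable_funM => //; exact: coordT.
Qed.

Lemma measurable_fun_RdB f g : measurable_fun setT f -> measurable_fun setT g ->
  measurable_fun setT (fun t => (f t : 'rV[R]_d) - g t : Rd R d).
Proof.
move=> mf mg; apply: measurable_fun_RdD => //.
under eq_fun do rewrite -scaleN1r.
exact: measurable_fun_RdZ.
Qed.

Lemma measurable_fun_enorm f : measurable_fun setT f ->
  measurable_fun setT (fun t => enorm (f t)).
Proof. by move=> mf; exact: (measurableT_comp measurable_enorm mf). Qed.

Lemma measurable_fun_dot f g : measurable_fun setT f -> measurable_fun setT g ->
  measurable_fun setT (fun t => dot (f t) (g t)).
Proof.
move=> mf mg; apply: measurable_sum => i.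
by apply: measurable_funM; exact: coordT.
Qed.

End pointwise.

Lemma measurable_fun_dist :
  measurable_fun [set: Rd R d * Rd R d] (fun z => enorm ((z.1 : 'rV[R]_d) - z.2)).
Proof. by apply: measurable_fun_enorm; exact: measurable_fun_RdB. Qed.

End measurability.

(** Continuity from above along [A] minus the first [N] sets. It replaces a countable union by a
    finite one, which is what keeps unions of closed or compact sets closed or compact. *)
Lemma measure_bigcup_approx d (T : measurableType d) (R : realType)
    (P : {finite_measure set T -> \bar R}) (A : set T) (C : (set T)^nat) (e : \bar R) :
  measurable A -> (forall n, measurable (C n)) ->
  (P (A `\` \bigcup_n C n) < e)%E ->
  exists N, (P (A `\` \big[setU/set0]_(n < N) C n) < e)%E.
Proof.
move=> mA mC Pe; apply: contrapT => /forallNP h.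
pose F N := A `\` \big[setU/set0]_(n < N) C n.
have mF N : measurable (F N).
  by apply: measurableD => //; exact: bigsetU_measurable.
have FE : \bigcap_n F n = A `\` \bigcup_n C n.
  apply/seteqP; split => [x Fx|x [Ax Cx] N _].
    split; first by have [] := Fx 0%N I.
    by move=> [n _ Cn]; have [_] := Fx n.+1 I; apply; rewrite big_ord_recr/=; right.
  by split => //; rewrite -bigcup_mkord => -[i _ Ci]; apply: Cx; exists i.
have cF : P (F n) @[n --> \oo] --> P (A `\` \bigcup_n C n).
  rewrite -FE; apply: nonincreasing_cvg_mu => //.
  - by rewrite ltey_eq fin_num_measure.
  - exact: bigcap_measurable.
  - move=> m n mn; apply/subsetPset; apply: setDS.
    exact: subset_bigsetU.
have : (e <= limn (P \o F))%E.
  by apply: lime_ge; [exact: (cvgP _ cF)|apply: nearW => n; rewrite leNgt; exact/negP/h].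
by rewrite (cvg_lim _ cF)// leNgt Pe.
Qed.

(** * Regularity of finite Borel measures *)

Section regularity.
Context {R : realType} {d : nat} (P : {finite_measure set (Rd R d) -> \bar R}).

Let sandwiched (A : set 'rV[R]_d) := forall e : R, 0 < e -> exists C U : set 'rV[R]_d,
  [/\ closed C, open U, C `<=` A, A `<=` U & (P (U `\` C) < e%:E)%E].

Let mD (U C : set 'rV[R]_d) : open U -> closed C -> measurable (U `\` C : set (Rd R d)).
Proof.
by move=> oU cC; apply: measurableD; [exact: open_measurable_Rd|exact: closed_measurable_Rd].
Qed.

Let sandwiched_open (U : set 'rV[R]_d) : open U -> sandwiched U.
Proof.
move=> oU e e0.
(* The points that stay at distance at least [n.+1%:R^-1] from the complement of [U]. *)
pose C n := ~` \bigcup_(y in ~` U) ball y (n.+1%:R^-1 : R).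
have oC n : open (\bigcup_(y in ~` U) ball y (n.+1%:R^-1 : R)).
  by apply: bigcup_open => y _; apply: ball_open; rewrite invr_gt0.
have cC n : closed (C n) by exact: open_closedC.
have CU n : C n `<=` U.
  move=> x Cx; apply: contrapT => Ux; apply: Cx; exists x => //.
  by apply: ballxx; rewrite invr_gt0.
have UC : U `<=` \bigcup_n C n.
  move=> x Ux; have /nbhs_ballP[r /= r0 rU] := open_nbhs_nbhs (conj oU Ux).
  have [n _ /(_ n (leqnn n)) nr] := near_infty_natSinv_lt (PosNum r0).
  exists n => // -[y Uy yx]; apply: Uy; apply: rU.
  by apply: ball_sym; apply: le_ball yx; exact/ltW.
have [|||N PN] := @measure_bigcup_approx _ (Rd R d) _ P U C e%:E.
- exact: open_measurable_Rd.
- by move=> n; exact: closed_measurable_Rd.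
- by rewrite (_ : U `\` _ = set0) ?measure0 ?lte_fin//; rewrite setD_eq0.
exists (\big[setU/set0]_(n < N) C n), U; split => //.
  by apply: closed_bigsetU => n _; exact: cC.
by rewrite -bigcup_mkord; exact: bigcup_sub.
Qed.

(** The sets squeezed between a closed and an open set form a sigma-algebra: complements exchange
    the two, and a countable union of closed sets is cut off at a finite stage. It contains the open
    sets, hence all Borel sets. *)
Lemma measurable_sandwiched (A : set 'rV[R]_d) : measurable (A : set (Rd R d)) ->
  forall e : R, 0 < e -> exists C U : set 'rV[R]_d,
  [/\ closed C, open U, C `<=` A, A `<=` U & (P (U `\` C) < e%:E)%E].
Proof.
suff H : (<<s @open 'rV[R]_d>> : set (set 'rV[R]_d)) `<=` sandwiched by exact: H.
apply: smallest_sub => //; split.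
- by apply: sandwiched_open; exact: open0.
- move=> {}A sA e e0; have [C [U [cC oU CA AU PUC]]] := sA e e0.
  exists (~` U), (~` C); split => //.
  + exact: open_closedC.
  + exact: closed_openC.
  + by rewrite setTD; exact: subsetC.
  + by rewrite setTD; exact: subsetC.
  + by rewrite setDE setCK setIC -setDE.
- move=> F sF e e0.
  (* These errors add up to [e / 2]; the other half leaves the strict inequality that the cut-off
     needs. *)
  have e'0 n : 0 < e / 2 / (2 ^ n.+1)%:R by rewrite !divr_gt0// ltr0n expn_gt0.
  have /choice[CU HCU] : forall n, exists CU : set 'rV[R]_d * set 'rV[R]_d,
      [/\ closed CU.1, open CU.2, CU.1 `<=` F n, F n `<=` CU.2 &
          (P (CU.2 `\` CU.1) < (e / 2 / (2 ^ n.+1)%:R)%:E)%E].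
    by move=> n; have [C [U ?]] := sF n _ (e'0 n); exists (C, U).
  pose U := \bigcup_n (CU n).2.
  have oU : open U by apply: bigcup_open => n _; have [] := HCU n.
  have mC n : measurable ((CU n).1 : set (Rd R d)).
    by apply: closed_measurable_Rd; have [] := HCU n.
  have [|||N PN] := @measure_bigcup_approx _ (Rd R d) _ P U (fun n => (CU n).1) e%:E.
  + exact: open_measurable_Rd.
  + exact: mC.
  + rewrite (@le_lt_trans _ _ (e / 2)%:E)//;
    last by rewrite lte_fin ltr_pdivrMr// ltr_pMr// ltr1n.
    rewrite (@le_trans _ _ (\sum_(0 <= n <oo) P ((CU n).2 `\` (CU n).1))%E)//.
      apply: measure_sigma_subadditive.
      * by move=> n; have [? ? _ _ _] := HCU n; exact: mD.
      * apply: measurableD; first exact: open_measurable_Rd.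
        exact: bigcup_measurable.
      * move=> x [[n _ Ux] nC]; exists n => //; split => // Cx; apply: nC; by exists n.
    have := @epsilon_trick R (fun=> 0%E) (e / 2) xpredT (fun=> lexx _) ltac:(by rewrite
      divr_ge0// ltW).
    rewrite [X in (_ <= X + _)%E]eseries0// add0e; apply: le_trans;
      apply: lee_nneseries => // n _.
    by rewrite add0e; have [_ _ _ _ /ltW] := HCU n.
  exists (\big[setU/set0]_(n < N) (CU n).1), U; split => //.
  + by apply: closed_bigsetU => n _; have [] := HCU n.
  + rewrite -(bigcup_mkord N (fun n => (CU n).1)); apply: bigcup_sub => n _ x Cx; exists n => //.
    by have [_ _ + _ _] := HCU n; apply.
  + by apply: subset_bigcup => n _; have [] := HCU n.
Qed.

(** A closed set is exhausted by its compact intersections with the cubes [B n], so the closed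
    approximation from inside turns into a compact one. *)
Lemma inner_regular (A : set 'rV[R]_d) : measurable (A : set (Rd R d)) ->
  forall e : R, 0 < e -> exists K : set 'rV[R]_d,
  [/\ compact K, K `<=` A & (P (A `\` K) < e%:E)%E].
Proof.
move=> mA e e0; have e20 : 0 < e / 2 by rewrite divr_gt0.
have [C [U [cC oU CA AU PUC]]] := measurable_sandwiched mA e20.
pose B n := [set v : 'rV[R]_d | forall i, v ord0 i \in `[(- n%:R : R), n%:R]].
have kB n : compact (B n).
  rewrite /B; apply: (@rV_compact _ _ (fun=> `[(- n%:R : R), n%:R]%classic)) => _.
  exact: segment_compact.
have cB n : closed (B n) by apply: compact_closed => //; exact: norm_hausdorff.
have CB : C `<=` \bigcup_n (C `&` B n).
  move=> x Cx; exists (Num.trunc (enorm x)).+1 => //; split => // i.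
  rewrite in_itv/= -ler_norml (le_trans (coord_le_enorm _ _))// ltW//.
  by rewrite truncnS_gt.
have mCB n : measurable (C `&` B n : set (Rd R d)).
  by apply: measurableI; exact: closed_measurable_Rd.
have [|||N PN] := @measure_bigcup_approx _ (Rd R d) _ P C (fun n => C `&` B n) (e / 2)%:E.
- exact: closed_measurable_Rd.
- exact: mCB.
- by rewrite (_ : C `\` _ = set0) ?measure0 ?lte_fin//; rewrite setD_eq0.
have kK : compact (\big[setU/set0]_(n < N) (C `&` B n)).
  by apply: bigsetU_compact => n _; rewrite setIC; apply: compact_closedI.
exists (\big[setU/set0]_(n < N) (C `&` B n)); split => //.
  by rewrite -(bigcup_mkord N (fun n => C `&` B n)); apply: bigcup_sub => n _ x [/CA].
rewrite (splitr e) EFinD; apply: le_lt_trans (lteD PUC PN).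
rewrite (le_trans _ (measureU2 _ _ _))//; last 2 first.
- exact: mD.
- by apply: measurableD; [exact: closed_measurable_Rd|exact: bigsetU_measurable].
apply: le_measure; rewrite ?inE.
- by apply: measurableD => //; exact: bigsetU_measurable.
- by apply: measurableU; [exact: mD|apply: measurableD;
  [exact: closed_measurable_Rd|exact: bigsetU_measurable]].
- move=> x [Ax nK]; have [Cx|nC] := pselect (C x); first by right.
  by left; split => //; exact: AU.
Qed.

End regularity.

Lemma powR_predM (R : realType) (x r : R) : 0 <= x -> 1 < r -> x `^ r = x * x `^ (r - 1).
Proof.
move=> x0 r1; have [->|xn] := eqVneq x 0.
  by rewrite mul0r powR0// gt_eqF// (lt_trans _ r1).
by rewrite -{2}(powRr1 x0) -powRD ?xn ?implybT// addrC subrK.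
Qed.

(** * The Wasserstein metric *)

Section density.
Context d (T : measurableType d) (R : realType) (M : {measure set T -> \bar R}).
Local Open Scope ereal_scope.

(** The proofs are parameters so that the measure and probability structures declared below can be
    attached to the term itself. *)
Definition density (g : T -> \bar R) (mg : measurable_fun setT g) (g0 : forall x, 0 <= g x)
  (g1 : \int[M]_x g x = 1) (A : set T) := \int[M]_(x in A) g x.

Variables (g : T -> \bar R) (mg : measurable_fun setT g) (g0 : forall x, 0 <= g x)
  (g1 : \int[M]_x g x = 1).

Let density0 : density mg g0 g1 set0 = 0. Proof. exact: integral_set0. Qed.
Let density_ge0 A : 0 <= density mg g0 g1 A. Proof. exact: integral_ge0. Qed.
Let density_sigma_additive : semi_sigma_additive (density mg g0 g1).
Proof. exact: semi_sigma_additive_nng_induced. Qed.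

HB.instance Definition _ := isMeasure.Build _ _ _ (density mg g0 g1)
  density0 density_ge0 density_sigma_additive.

Let density_setT : density mg g0 g1 setT = 1. Proof. exact: g1. Qed.

HB.instance Definition _ := Measure_isProbability.Build _ _ _ (density mg g0 g1) density_setT.

Definition density_probability : probability T R := density mg g0 g1.

End density.

Section law.
Context d d' (T : measurableType d) (T' : measurableType d') (R : realType).
Implicit Types (P : probability T R) (X : T -> T').

Definition law P X (mX : measurable_fun setT X) : probability T' R :=
  distribution P (mfun_Sub (mem_set mX : X \in mfun)).

Lemma lawE P X (mX : measurable_fun setT X) A : law P mX A = P (X @^-1` A).
Proof. by []. Qed.

Lemma ge0_integral_law P X (mX : measurable_fun setT X) (f : T' -> \bar R) :
  measurable_fun setT f -> (forall y, (0 <= f y)%E) ->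
  (\int[law P mX]_y f y = \int[P]_x f (X x))%E.
Proof. by move=> mf f0; rewrite ge0_integral_distribution. Qed.

(** The assumption has the form of the marginal conditions in [couplings], so the rule applies
    directly to the projections of a coupling. *)
Lemma ge0_integral_of_law P (Q : probability T' R) X : measurable_fun setT X ->
  (forall A, measurable A -> P (X @^-1` A) = Q A) ->
  forall f : T' -> \bar R, measurable_fun setT f -> (forall y, (0 <= f y)%E) ->
  (\int[P]_x f (X x) = \int[Q]_y f y)%E.
Proof.
move=> mX PQ f mf f0; rewrite -(ge0_integral_law P mX)//.
by apply: eq_measure_integral => A mA _; exact: PQ.
Qed.

Lemma Lnorm_of_law P (Q : probability T' R) X : measurable_fun setT X ->
  (forall A, measurable A -> P (X @^-1` A) = Q A) ->
  forall (p : R) (f : T' -> R), measurable_fun setT f ->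
  (Lnorm P p%:E (fun x => (f (X x))%:E) = Lnorm Q p%:E (EFin \o f)).
Proof.
move=> mX PQ p f mf; rewrite unlock; congr (_ `^ _)%E.
rewrite -(ge0_integral_of_law mX PQ (f := fun y => (`|(f y)%:E| `^ p)%E))//.
- apply: (measurableT_comp (measurable_poweR p)).
  by apply: measurableT_comp => //; exact/measurable_EFinP.
- by move=> y; rewrite poweR_ge0.
Qed.

End law.

Section Lnorm_facts.
Context d (T : measurableType d) (R : realType) (P : probability T R).
Local Open Scope ereal_scope.

Lemma Lnorm_EFin (r : R) (f : T -> R) : (forall x, 0 <= f x)%R ->
  Lnorm P r%:E (EFin \o f) = (\int[P]_x (f x `^ r)%:E) `^ r^-1.
Proof.
move=> f0; rewrite unlock /=; congr (_ `^ _).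
apply: eq_integral => x _.
by rewrite /= ger0_norm.
Qed.

Lemma Lnorm_lty (r : R) (f : T -> R) : (0 < r)%R -> (forall x, 0 <= f x)%R ->
  (\int[P]_x (f x `^ r)%:E < +oo) = (Lnorm P r%:E (EFin \o f) < +oo).
Proof.
move=> r0 f0; rewrite Lnorm_EFin//; apply/idP/idP => [h|]; first exact: poweR_lty.
apply: contraTT; rewrite -!leNgt !leye_eq => /eqP ->.
by rewrite poweRyr// invr_eq0 gt_eqF.
Qed.

Lemma ae_le_Lnorm (r : R) (f g : T -> R) : (0 < r)%R ->
  measurable_fun setT f -> measurable_fun setT g ->
  (forall x, 0 <= f x)%R -> (forall x, 0 <= g x)%R ->
  {ae P, forall x, f x <= g x}%R ->
  Lnorm P r%:E (EFin \o f) <= Lnorm P r%:E (EFin \o g).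
Proof.
move=> r0 mf mg f0 g0 fg; rewrite (Lnorm_EFin _ f0) (Lnorm_EFin _ g0).
apply: gt0_ler_poweR; first by rewrite invr_ge0 ltW.
- by rewrite in_itv/= leey andbT integral_ge0// => x _; rewrite lee_fin powR_ge0.
- by rewrite in_itv/= leey andbT integral_ge0// => x _; rewrite lee_fin powR_ge0.
- apply: ae_ge0_le_integral => //.
  + by move=> x _; rewrite lee_fin powR_ge0.
  + by apply/measurable_EFinP; exact: (measurableT_comp (measurable_powR r)).
  + by move=> x _; rewrite lee_fin powR_ge0.
  + by apply/measurable_EFinP; exact: (measurableT_comp (measurable_powR r)).
  + apply: filterS fg => x fgx _; rewrite lee_fin.
    by apply: ge0_ler_powR; rewrite ?nnegrE// ltW.
Qed.

Lemma le_Lnorm (r : R) (f g : T -> R) : (0 < r)%R ->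
  measurable_fun setT f -> measurable_fun setT g ->
  (forall x, 0 <= f x)%R -> (forall x, f x <= g x)%R ->
  Lnorm P r%:E (EFin \o f) <= Lnorm P r%:E (EFin \o g).
Proof.
move=> r0 mf mg f0 fg; apply: ae_le_Lnorm => //; last exact: aeW.
by move=> x; rewrite (le_trans (f0 x)).
Qed.

Lemma Lnorm_cst_prob (r c : R) : (0 < r)%R -> (0 <= c)%R ->
  Lnorm P r%:E (EFin \o cst c) = c%:E.
Proof.
move=> r0 c0; rewrite Lnorm_EFin//.
have -> : \int[P]_x (cst c x `^ r)%:E = (c `^ r)%:E.
  by rewrite (integral_cst P measurableT (c `^ r)%:E) [X in _ * X](probability_setT P) mule1.
by rewrite poweR_EFin -powRrM mulfV ?gt_eqF// powRr1.
Qed.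

End Lnorm_facts.

(** * Couplings and the triangle inequality *)

Section couplings.
Context {R : realType} {d : nat} (p : R) (hp : 1 < p).
Local Notation Tm := (Rd R d * Rd R d)%type.
Implicit Types (mu nu : Mp R d p) (pi : probability Tm R).

Let p0 : 0 < p. Proof. exact: lt_trans hp. Qed.

Lemma transport_costE pi : transport_cost p pi =
  Lnorm pi p%:E (fun z => (enorm ((z.1 : 'rV[R]_d) - z.2))%:E).
Proof. by rewrite (Lnorm_EFin pi p (fun _ => enorm_ge0 _)). Qed.

Lemma Mp_Lnorm mu : (Lnorm mu p%:E (EFin \o (@enorm R d)) < +oo)%E.
Proof. by rewrite -Lnorm_lty//; [exact: Mp_moment|move=> ?; exact: enorm_ge0]. Qed.

Lemma measurable_enorm2 : measurable_fun [set: Tm] (@enorm2 R d).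
Proof.
have ms : measurable_fun setT (@Num.sqrt R).
  by apply: continuous_measurable_fun; exact: sqrt_continuous.
apply: (measurableT_comp ms).
by apply: measurable_funD; apply: measurable_funX; apply: measurable_fun_enorm.
Qed.

Lemma enorm2_le z : enorm2 z <= enorm (z : Tm).1 + enorm z.2.
Proof.
rewrite /enorm2 -[leRHS]ger0_norm ?addr_ge0 ?enorm_ge0// -sqrtr_sqr.
apply: ler_wsqrtr; rewrite sqrrD -addrA lerD2l lerDr mulrn_wge0//.
by rewrite mulr_ge0 ?enorm_ge0.
Qed.

Section joint.
Context d' (T : measurableType d') (P : probability T R) (X Y : T -> Rd R d).
Hypotheses (mX : measurable_fun setT X) (mY : measurable_fun setT Y).

(** Couplings are produced as joint laws of two random vectors; the moment bound on the pair follows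
    from those of the marginals by Minkowski's inequality. Integrals are transported for nonnegative
    functions, which covers costs at once and signed pairings through their positive and negative
    parts. *)
Lemma joint_law_coupling mu nu :
  (forall A : set (Rd R d), measurable A -> P (X @^-1` A) = mu A) ->
  (forall A : set (Rd R d), measurable A -> P (Y @^-1` A) = nu A) ->
  exists2 pi, couplings mu nu pi &
    forall f : Tm -> \bar R, measurable_fun setT f -> (forall z, (0 <= f z)%E) ->
      (\int[pi]_z f z = \int[P]_t f (X t, Y t))%E.
Proof.
move=> Xmu Ynu.
have mXY : measurable_fun setT (fun t => (X t, Y t) : Tm) by exact: measurable_fun_pair.
exists (law P mXY); last by move=> f mf f0; rewrite ge0_integral_law.
split; last 2 first.
- by move=> A mA; rewrite lawE -Xmu.
- by move=> A mA; rewrite lawE -Ynu.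
have H1 : (Lnorm P p%:E (fun t => (enorm (X t))%:E) < +oo)%E.
  by rewrite (Lnorm_of_law mX Xmu p measurable_enorm); exact: Mp_Lnorm.
have H2 : (Lnorm P p%:E (fun t => (enorm (Y t))%:E) < +oo)%E.
  by rewrite (Lnorm_of_law mY Ynu p measurable_enorm); exact: Mp_Lnorm.
rewrite ge0_integral_law; last 2 first.
- by apply/measurable_EFinP; apply: (measurableT_comp (measurable_powR p));
  exact: measurable_enorm2.
- by move=> z; rewrite lee_fin powR_ge0.
rewrite (Lnorm_lty P (f := fun t => enorm2 (X t, Y t)))//; last by move=> ?; exact: sqrtr_ge0.
have mx := measurable_fun_enorm mX; have my := measurable_fun_enorm mY.
apply: le_lt_trans (lte_add_pinfty H1 H2).
apply: le_trans (minkowski_EFin P mx my (ltW hp)).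
apply: le_Lnorm => //.
- exact: (measurableT_comp measurable_enorm2).
- exact: measurable_funD.
- by move=> ?; exact: sqrtr_ge0.
- by move=> t /=; rewrite (enorm2_le (X t, Y t)).
Qed.

Lemma Wp_ereal_le_Lnorm mu nu :
  (forall A : set (Rd R d), measurable A -> P (X @^-1` A) = mu A) ->
  (forall A : set (Rd R d), measurable A -> P (Y @^-1` A) = nu A) ->
  (Wp_ereal mu nu <= Lnorm P p%:E (fun t => (enorm ((X t : 'rV[R]_d) - Y t))%:E))%E.
Proof.
move=> Xmu Ynu; have [pi cpi piE] := joint_law_coupling Xmu Ynu.
apply: ge_ereal_inf; exists (transport_cost p pi); first by exists pi.
have mc : measurable_fun setT
    (fun z : Tm => (`|(enorm ((z.1 : 'rV[R]_d) - z.2))%:E| `^ p)%E).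
  apply: (measurableT_comp (measurable_poweR p)); apply: measurableT_comp => //.
  by apply/measurable_EFinP; exact: measurable_fun_dist.
by rewrite transport_costE unlock /= (piE _ mc (fun _ => poweR_ge0 _ _)).
Qed.

End joint.

Lemma Wp_ereal_ge0 mu nu : (0 <= Wp_ereal mu nu)%E.
Proof. by apply: le_ereal_inf_tmp => _ [pi _ <-]; exact: poweR_ge0. Qed.

Lemma Wp_ge0 mu nu : 0 <= Wp mu nu. Proof. exact/fine_ge0/Wp_ereal_ge0. Qed.

Section coupling.
Variables (mu nu : Mp R d p) (pi : probability Tm R).
Hypothesis cpi : couplings mu nu pi.

Let mfst : forall A : set (Rd R d), measurable A -> pi (fst @^-1` A) = mu A.
Proof. by case: cpi. Qed.

Let msnd : forall A : set (Rd R d), measurable A -> pi (snd @^-1` A) = nu A.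
Proof. by case: cpi. Qed.

Lemma Lnorm_fst (r : R) (f : Rd R d -> R) : measurable_fun setT f ->
  Lnorm pi r%:E (fun z => (f z.1)%:E) = Lnorm mu r%:E (EFin \o f).
Proof. exact: (Lnorm_of_law measurable_fst mfst). Qed.

Lemma Lnorm_snd (r : R) (f : Rd R d -> R) : measurable_fun setT f ->
  Lnorm pi r%:E (fun z => (f z.2)%:E) = Lnorm nu r%:E (EFin \o f).
Proof. exact: (Lnorm_of_law measurable_snd msnd). Qed.

Lemma transport_cost_lty : (transport_cost p pi < +oo)%E.
Proof.
have m1 : measurable_fun [set: Tm] (fun z => enorm z.1) by exact: measurable_fun_enorm.
have m2 : measurable_fun [set: Tm] (fun z => enorm z.2) by exact: measurable_fun_enorm.
have := lte_add_pinfty (Mp_Lnorm mu) (Mp_Lnorm nu).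
rewrite -(Lnorm_fst p measurable_enorm) -(Lnorm_snd p measurable_enorm).
apply: le_lt_trans; apply: le_trans (minkowski_EFin pi m1 m2 (ltW hp)).
rewrite transport_costE; apply: le_Lnorm => //.
- exact: measurable_fun_dist.
- exact: measurable_funD.
- by move=> ?; exact: enorm_ge0.
- by move=> z; rewrite /= -(enormN z.2) enormD.
Qed.

Lemma transport_cost_fin : transport_cost p pi \is a fin_num.
Proof. by rewrite ge0_fin_numE ?transport_cost_lty// poweR_ge0. Qed.

End coupling.

Lemma couplings_nonempty mu nu : couplings mu nu !=set0.
Proof.
have [||pi cpi _] := @joint_law_coupling _ _ (mu \x nu)%E fst snd measurable_fst measurable_snd
  mu nu.
- move=> A mA; rewrite (_ : fst @^-1` A = A `*` setT); last first.
    by apply/seteqP; split => // z [].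
  by rewrite /= product_measure1E// [X in (_ * X)%E](probability_setT (Mp_prob nu)) mule1.
- move=> A mA; rewrite (_ : snd @^-1` A = setT `*` A); last first.
    by apply/seteqP; split => // z [].
  by rewrite /= product_measure1E// [X in (X * _)%E](probability_setT (Mp_prob mu)) mul1e.
by exists pi.
Qed.

Lemma Wp_ereal_le mu nu pi : couplings mu nu pi -> (Wp_ereal mu nu <= transport_cost p pi)%E.
Proof. by move=> cpi; apply: ereal_inf_lbound; exists pi. Qed.

Lemma Wp_ereal_fin mu nu : Wp_ereal mu nu \is a fin_num.
Proof.
have [pi cpi] := couplings_nonempty mu nu.
rewrite ge0_fin_numE ?Wp_ereal_ge0// (le_lt_trans (Wp_ereal_le cpi))//.
exact: transport_cost_lty cpi.
Qed.

Lemma WpE mu nu : (Wp mu nu)%:E = Wp_ereal mu nu.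
Proof. by rewrite fineK// Wp_ereal_fin. Qed.

Lemma Wp_le_Lnorm d' (T : measurableType d') (P : probability T R) (X Y : T -> Rd R d) mu nu :
  measurable_fun setT X -> measurable_fun setT Y ->
  (forall A : set (Rd R d), measurable A -> P (X @^-1` A) = mu A) ->
  (forall A : set (Rd R d), measurable A -> P (Y @^-1` A) = nu A) ->
  ((Wp mu nu)%:E <= Lnorm P p%:E (fun t => (enorm ((X t : 'rV[R]_d) - Y t))%:E))%E.
Proof. by move=> mX mY Xmu Ynu; rewrite WpE; exact: Wp_ereal_le_Lnorm. Qed.

Lemma Wp_approx mu nu (e : R) : 0 < e ->
  exists2 pi, couplings mu nu pi & (transport_cost p pi < (Wp mu nu + e)%:E)%E.
Proof.
move=> e0; have [_ [pi cpi <-]] := lb_ereal_inf_adherent e0 (Wp_ereal_fin mu nu).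
by rewrite EFinD WpE => h; exists pi.
Qed.

Lemma Wpxx mu : Wp mu mu = 0.
Proof.
apply/eqP; rewrite eq_le Wp_ge0 andbT -lee_fin.
apply: le_trans (@Wp_le_Lnorm _ _ mu id id mu mu _ _ _ _) _ => //.
under eq_Lnorm do rewrite subrr enorm0.
by rewrite Lnorm0// eqe gt_eqF.
Qed.

Lemma WpC_le mu nu : Wp mu nu <= Wp nu mu.
Proof.
apply/ler_addgt0Pr => e e0; rewrite -lee_fin.
have [pi [_ c1 c2] /ltW] := Wp_approx nu mu e0; apply: le_trans.
rewrite transport_costE; under eq_Lnorm do rewrite enormBC.
exact: (Wp_le_Lnorm measurable_snd measurable_fst).
Qed.

Lemma WpC mu nu : Wp mu nu = Wp nu mu.
Proof. by apply/eqP; rewrite eq_le !WpC_le. Qed.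

(** The cell of a point is the index of the first rational cube that contains it, so each cell lies
    in a single cube. *)
Lemma countable_partition (e : R) : 0 < e -> exists2 f : Rd R d -> nat,
  measurable_fun setT f & forall x y, f x = f y -> enorm ((x : 'rV[R]_d) - y) <= e.
Proof.
move=> e0; pose r := e / 2 / d.+1%:R.
have r0 : 0 < r by rewrite !divr_gt0.
have ex (x : Rd R d) : exists k, `[< cube (rat_seq k) r x >].
  have [k xk] := rat_seq_dense x r0; exists k; apply/asboolP => i.
  by rewrite distrC; exact: xk.
pose f x := ex_minn (ex x).
have fP k : f @^-1` [set k] = cube (rat_seq k) r `\` \big[setU/set0]_(j < k) cube (rat_seq j) r.
  rewrite -(bigcup_mkord k (fun j => cube (rat_seq j) r)).
  apply/seteqP; split => [x <-|x [xk nxk]]; rewrite /= /f; case: ex_minnP => m /asboolP xm mmin.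
    split => // -[j /= jm xj]; have /mmin : `[< cube (rat_seq j) r x >] by exact/asboolP.
    by rewrite leqNgt jm.
  apply/eqP; rewrite eqn_leq mmin ?andTb; last exact/asboolP.
  by rewrite leqNgt; apply/negP => mk; apply: nxk; exists m.
exists f.
- move=> _ Y _; rewrite setTI.
  rewrite (_ : f @^-1` Y = \bigcup_(k in Y) f @^-1` [set k]); last first.
    by apply/seteqP; split => [x Yx|x [k Yk /= ->]//]; exists (f x).
  apply: bigcup_measurable => k _; rewrite fP.
  have mc j : measurable (cube (rat_seq j) r : set (Rd R d)).
    by apply: open_measurable_Rd; rewrite cubeE//; exact: ball_open.
  by apply: measurableD => //; apply: bigsetU_measurable.
- move=> x y fxy.
  have H z i : `|rat_seq (f z) 0 i - z 0 i| < r.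
    by have : (f @^-1` [set f z]) z by []; rewrite fP => -[+ _]; exact.
  apply: (@le_trans _ _ (d%:R * (e / d.+1%:R))).
    apply: enorm_lt_coord; first by rewrite divr_gt0.
    move=> i; rewrite !mxE -(subrKA (rat_seq (f x) 0 i)).
    rewrite (le_lt_trans (ler_normD _ _))//.
    rewrite (_ : e / d.+1%:R = r + r); last by rewrite /r -mulrDl -splitr.
    by apply: ltrD; [rewrite distrC; exact: H|rewrite fxy; exact: H].
  by rewrite mulrCA ler_piMr ?(ltW e0)// ler_pdivrMr// mul1r ler_nat.
Qed.

Section gluing.
Variables (mu1 mu2 mu3 : Mp R d p) (pi1 pi2 : probability Tm R).
Hypotheses (c1 : couplings mu1 mu2 pi1) (c2 : couplings mu2 mu3 pi2).
Variables (f : Rd R d -> nat) (mf : measurable_fun setT f).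

Let h (n : nat) : R := fine (mu2 (f @^-1` [set n])).

Let mfn n : measurable (f @^-1` [set n] : set (Rd R d)).
Proof. by rewrite -[X in measurable X]setTI; exact: mf. Qed.

Let hE n : (h n)%:E = mu2 (f @^-1` [set n]).
Proof. by rewrite /h fineK// fin_num_measure. Qed.

Let h0 n : 0 <= h n. Proof. by rewrite -lee_fin hE. Qed.

(* The density, with respect to pi1 (x) pi2, of the measure that couples the second
   marginal of pi1 with the first marginal of pi2 by independence within each cell of f. *)
Let g (z : Tm * Tm) : \bar R :=
  ((\1_(f @^-1` [set f z.1.2]) z.2.1)%:E * ((h (f z.1.2))^-1)%:E)%E.

Let g0 z : (0 <= g z)%E.
Proof. by rewrite /g -EFinM lee_fin mulr_ge0// invr_ge0. Qed.

Let mg : measurable_fun setT g.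
Proof.
have mf1 : measurable_fun setT (fun z : Tm * Tm => f z.1.2).
  apply: (measurableT_comp mf); apply: (measurableT_comp measurable_snd); exact: measurable_fst.
have mf2 : measurable_fun setT (fun z : Tm * Tm => f z.2.1).
  apply: (measurableT_comp mf); apply: (measurableT_comp measurable_fst); exact: measurable_snd.
apply: emeasurable_funM; last first.
  apply/measurable_EFinP; apply: (measurableT_comp (f := fun n : nat => (h n)^-1)) => //.
apply/measurable_EFinP.
rewrite (_ : (fun z => _) = \1_[set z : Tm * Tm | f z.2.1 = f z.1.2])//.
apply: measurable_indic.
rewrite (_ : mkset _ = \bigcup_n (((fun z : Tm * Tm => f z.1.2) @^-1` [set n]) `&`
   ((fun z : Tm * Tm => f z.2.1) @^-1` [set n]))); last first.
  by apply/seteqP; split => [z /= zz|z [n _ /= [-> ->]]//]; exists (f z.1.2).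
apply: bigcup_measurable => n _; apply: measurableI.
  by rewrite -[X in measurable X]setTI; exact: mf1.
by rewrite -[X in measurable X]setTI; exact: mf2.
Qed.

Let c1snd (A : set (Rd R d)) : measurable A -> pi1 (snd @^-1` A) = mu2 A.
Proof. by case: c1 => _ _; exact. Qed.

Let c2fst (A : set (Rd R d)) : measurable A -> pi2 (fst @^-1` A) = mu2 A.
Proof. by case: c2 => _ + _; exact. Qed.

(** Cells of mass zero, where the inverse in [g] takes its default value [0], are charged by neither
    coupling. *)
Let ae_h (pi : probability Tm R) (X : Tm -> Rd R d) : measurable_fun setT X ->
  (forall A, measurable A -> pi (X @^-1` A) = mu2 A) ->
  {ae pi, forall z, h (f (X z)) != 0}.
Proof.
move=> mX piX.
have : {ae pi, forall z, forall n, h n = 0 -> f (X z) <> n}.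
  apply/ae_foralln => n; have [hn|hn] := eqVneq (h n) 0; last first.
    by apply: aeW => z hn'; rewrite hn' eqxx in hn.
  exists (X @^-1` (f @^-1` [set n])); split.
  - by rewrite -[X in measurable X]setTI; exact: mX.
  - by apply: (etrans (piX _ (mfn n))); rewrite -hE hn.
  - by move=> z /= hz; apply: contrapT => ne; apply: hz.
by apply: filterS => z hz; apply/negP => /eqP /hz.
Qed.

(** Sharing a cell is a symmetric relation; this lets the second marginal be computed like the
    first. *)
Let gC z w : g (z, w) = ((\1_(f @^-1` [set f w.1]) z.2)%:E * ((h (f w.1))^-1)%:E)%E.
Proof.
rewrite /g/= !indicE.
have [e|ne] := eqVneq (f w.1) (f z.2); last first.
  rewrite !memNset ?mul0e//=; [by move/eqP; rewrite eq_sym (negbTE ne)|].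
  by move/eqP; rewrite (negbTE ne).
by rewrite -e !mem_set.
Qed.

Let int1 z : h (f z.2) != 0 -> (\int[pi2]_w g (z, w) = 1)%E.
Proof.
move=> hz; rewrite /g/= ge0_integralZr//; last first.
- by rewrite lee_fin invr_ge0.
- apply/measurable_EFinP; exact: (measurableT_comp (measurable_indic (mfn _))).
rewrite (ge0_integral_of_law measurable_fst c2fst (f := fun x =>
  (\1_(f @^-1` [set f z.2]) x)%:E)).
- transitivity ((h (f z.2))%:E * ((h (f z.2))^-1)%:E)%E; last by rewrite -EFinM mulfV.
  by congr (_ * _)%E; rewrite integral_indic// setIT; exact/esym/hE.
- by apply/measurable_EFinP; exact: measurable_indic.
- by move=> y; rewrite lee_fin.
Qed.

Let int2 w : h (f w.1) != 0 -> (\int[pi1]_z g (z, w) = 1)%E.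
Proof.
move=> hw; under eq_integral do rewrite gC.
rewrite ge0_integralZr//; last first.
- by rewrite lee_fin invr_ge0.
- apply/measurable_EFinP; exact: (measurableT_comp (measurable_indic (mfn _))).
rewrite (ge0_integral_of_law measurable_snd c1snd (f := fun x =>
  (\1_(f @^-1` [set f w.1]) x)%:E)).
- transitivity ((h (f w.1))%:E * ((h (f w.1))^-1)%:E)%E; last by rewrite -EFinM mulfV.
  by congr (_ * _)%E; rewrite integral_indic// setIT; exact/esym/hE.
- by apply/measurable_EFinP; exact: measurable_indic.
- by move=> y; rewrite lee_fin.
Qed.

Let marginal1 (S : set Tm) : measurable S ->
  (\int[pi1 \x pi2]_(z in fst @^-1` S) g z = pi1 S)%E.
Proof.
move=> mS; rewrite integral_mkcond.
have mS' : measurable (fst @^-1` S : set (Tm * Tm)).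
  by rewrite -[X in measurable X]setTI; exact: measurable_fst.
rewrite fubini_tonelli1; last 2 first.
- by apply/measurable_restrict => //; rewrite setTI; exact: measurable_funTS.
- by move=> z; rewrite /patch; case: ifP.
rewrite -[in RHS](setIT S) -integral_indic//.
apply: ae_eq_integral => //.
- apply: measurable_fun_fubini_tonelli_F => //.
  + by apply/measurable_restrict => //; rewrite setTI; exact: measurable_funTS.
  + by move=> z; rewrite /patch; case: ifP.
- exact/measurable_EFinP/measurable_indic.
apply: filterS (ae_h measurable_snd c1snd) => z hz _.
rewrite /fubini_F/= indicE; have [Sz|Sz] := boolP (z \in S).
  rewrite -[RHS](int1 hz); apply: eq_integral => w _.
  by rewrite patchT// inE/=; move: Sz; rewrite inE.
apply: integral0_eq => w _.
by rewrite patchN//; apply: contra Sz; rewrite !inE.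
Qed.

Let marginal2 (S : set Tm) : measurable S ->
  (\int[pi1 \x pi2]_(z in snd @^-1` S) g z = pi2 S)%E.
Proof.
move=> mS; rewrite integral_mkcond.
have mS' : measurable (snd @^-1` S : set (Tm * Tm)).
  by rewrite -[X in measurable X]setTI; exact: measurable_snd.
rewrite fubini_tonelli1; last 2 first.
- by apply/measurable_restrict => //; rewrite setTI; exact: measurable_funTS.
- by move=> z; rewrite /patch; case: ifP.
rewrite fubini_tonelli; last 2 first.
- by apply/measurable_restrict => //; rewrite setTI; exact: measurable_funTS.
- by move=> z; rewrite /patch; case: ifP.
rewrite -[in RHS](setIT S) -integral_indic//.
apply: ae_eq_integral => //.
- apply: measurable_fun_fubini_tonelli_G => //.
  + by apply/measurable_restrict => //; rewrite setTI; exact: measurable_funTS.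
  + by move=> z; rewrite /patch; case: ifP.
- exact/measurable_EFinP/measurable_indic.
apply: filterS (ae_h measurable_fst c2fst) => z hz _.
rewrite /fubini_G/= indicE; have [Sz|Sz] := boolP (z \in S).
  rewrite -[RHS](int2 hz); apply: eq_integral => w _.
  by rewrite patchT// inE/=; move: Sz; rewrite inE.
apply: integral0_eq => w _.
by rewrite patchN//; apply: contra Sz; rewrite !inE.
Qed.

(** A substitute for gluing by disintegration: both couplings are marginals of [G], and the two
    copies of the middle variable agree up to their cell. *)
Lemma discrete_gluing : exists G : probability (Tm * Tm)%type R,
  [/\ forall S : set Tm, measurable S -> G (fst @^-1` S) = pi1 S,
     forall S : set Tm, measurable S -> G (snd @^-1` S) = pi2 S &
     {ae G, forall z, f z.1.2 = f z.2.1}].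
Proof.
have g1 : (\int[pi1 \x pi2]_z g z = 1)%E.
  by rewrite -(probability_setT pi1) -marginal1.
exists (density_probability mg g0 g1); split.
- exact: marginal1.
- exact: marginal2.
- exists [set z | f z.1.2 <> f z.2.1]; split => //.
  + rewrite (_ : mkset _ = ~` \bigcup_n (((fun z : Tm * Tm => f z.1.2) @^-1` [set n]) `&`
     ((fun z : Tm * Tm => f z.2.1) @^-1` [set n]))); last first.
      apply/seteqP; split => [z /= zz [n _ /= [zn zn']]|z /= nz zz].
        by apply: zz; rewrite zn zn'.
      by apply: nz; exists (f z.1.2).
    apply: measurableC; apply: bigcup_measurable => n _; apply: measurableI.
      rewrite -[X in measurable X]setTI; apply: (measurableT_comp mf) => //.
      by apply: (measurableT_comp measurable_snd); exact: measurable_fst.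
    rewrite -[X in measurable X]setTI; apply: (measurableT_comp mf) => //.
    by apply: (measurableT_comp measurable_fst); exact: measurable_snd.
  + apply: integral0_eq => z /= zz; rewrite /g indicE memNset ?mul0e// => /= e.
    by apply: zz; rewrite e.
Qed.

End gluing.

(** Along the glued measure the displacement splits in three. The middle part joins the two copies
    of the middle variable, stays inside a cell and costs at most [e / 3]; the other two thirds of
    [e] pay for couplings that are only nearly optimal. *)
Lemma Wp_triangle mu1 mu2 mu3 : Wp mu1 mu3 <= Wp mu1 mu2 + Wp mu2 mu3.
Proof.
apply/ler_addgt0Pr => e e0; have e3 : 0 < e / 3 by rewrite divr_gt0.
have [pi1 c1 pi1W] := Wp_approx mu1 mu2 e3.
have [pi2 c2 pi2W] := Wp_approx mu2 mu3 e3.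
have [f mf fe] := countable_partition e3.
have [G [G1 G2 Gf]] := discrete_gluing c1 c2 mf.
have mX : measurable_fun [set: Tm * Tm] (fun z => z.1.1).
  by apply: (measurableT_comp measurable_fst); exact: measurable_fst.
have mY : measurable_fun [set: Tm * Tm] (fun z => z.1.2).
  by apply: (measurableT_comp measurable_snd); exact: measurable_fst.
have mY' : measurable_fun [set: Tm * Tm] (fun z => z.2.1).
  by apply: (measurableT_comp measurable_fst); exact: measurable_snd.
have mZ : measurable_fun [set: Tm * Tm] (fun z => z.2.2).
  by apply: (measurableT_comp measurable_snd); exact: measurable_snd.
have m1 := measurable_fun_enorm (measurable_fun_RdB mX mY).
have m2 := measurable_fun_enorm (measurable_fun_RdB mY mY').
have m3 := measurable_fun_enorm (measurable_fun_RdB mY' mZ).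
rewrite -lee_fin; apply: (@le_trans _ _
    (Lnorm G p%:E (fun z => (enorm ((z.1.1 : 'rV[R]_d) - z.2.2))%:E))).
  apply: Wp_le_Lnorm => // A mA.
    have mA' : measurable (fst @^-1` A : set Tm).
      by rewrite -[X in measurable X]setTI; exact: measurable_fst.
    by have [_ H _] := c1; rewrite -(H _ mA) -(G1 _ mA').
  have mA' : measurable (snd @^-1` A : set Tm).
    by rewrite -[X in measurable X]setTI; exact: measurable_snd.
  by have [_ _ H] := c2; rewrite -(H _ mA) -(G2 _ mA').
apply: (@le_trans _ _ (Lnorm G p%:E (fun z => (enorm ((z.1.1 : 'rV[R]_d) - z.1.2) +
   (enorm ((z.1.2 : 'rV[R]_d) - z.2.1) + enorm ((z.2.1 : 'rV[R]_d) - z.2.2)))%:E))).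
  apply: le_Lnorm => //.
  - exact: (measurable_fun_enorm (measurable_fun_RdB mX mZ)).
  - by apply: measurable_funD => //; exact: measurable_funD.
  - by move=> ?; exact: enorm_ge0.
  - move=> z; rewrite (le_trans _ (lerD (lexx _) (enormD _ _)))//.
    by rewrite (le_trans _ (enormD _ _))// addrA subrKA subrKA.
apply: le_trans (minkowski_EFin G m1 (measurable_funD m2 m3) (ltW hp)) _.
apply: le_trans (leeD (lexx _) (minkowski_EFin G m2 m3 (ltW hp))) _.
rewrite (Lnorm_of_law measurable_fst G1 p measurable_fun_dist).
rewrite (Lnorm_of_law measurable_snd G2 p measurable_fun_dist).
rewrite -!transport_costE.
have K2 : (Lnorm G p%:E (EFin \o (fun z => enorm ((z.1.2 : 'rV[R]_d) - z.2.1))) <= (e / 3)%:E)%E.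
  rewrite -(@Lnorm_cst_prob _ _ _ G p (e / 3))// ?(ltW e3)//.
  apply: ae_le_Lnorm => //.
  - by move=> ?; exact: enorm_ge0.
  - by move=> z /=; exact: ltW.
  - by move: Gf; apply: filterS => z; exact: fe.
apply: le_trans (leeD (ltW pi1W) (leeD K2 (ltW pi2W))) _.
rewrite -!EFinD lee_fin; lra.
Qed.

End couplings.

(** * Existence of optimal couplings *)

(** Opaque, so that the semiring of rectangles has a display distinct from that of the product
    sigma-algebra on the same type. *)
Definition rectangles_display : measure_display -> measure_display -> measure_display.
Proof. by []. Qed.

Section rectangles.
Context d1 d2 (T1 : measurableType d1) (T2 : measurableType d2).

Definition rectangle : set (set (T1 * T2)) :=
  [set A `*` B | A in measurable & B in measurable].

Let rectangle0 : rectangle set0.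
Proof. by exists set0 => //; exists set0 => //; rewrite set0X. Qed.

Let rectangleI : setI_closed rectangle.
Proof.
move=> _ _ [A mA [B mB <-]] [A' mA' [B' mB' <-]].
exists (A `&` A'); first exact: measurableI.
exists (B `&` B'); first exact: measurableI.
by apply/seteqP; split => -[x y] /=; tauto.
Qed.

Let rectangleD : semi_setD_closed rectangle.
Proof.
move=> _ _ [A mA [B mB <-]] [C mC [D mD <-]].
exists [set (A `\` C) `*` B; (A `&` C) `*` (B `\` D)]; split.
- exact: finite_set2.
- move=> _ [->|->].
    by exists (A `\` C); [exact: measurableD|exists B].
  by exists (A `&` C); [exact: measurableI|exists (B `\` D) => //; exact: measurableD].
- rewrite bigcup_setU !bigcup_set1; apply/seteqP; split => -[x y] /=.
    by move=> [[Ax By] CD]; have [Cx|Cx] := pselect (C x); tauto.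
  tauto.
- by move=> _ _ [->|->] [->|->]// [[x y] /= []]; tauto.
Qed.

Let prod_type : semiRingOfSetsType _ := (T1 * T2)%type.
Let prod_class := SemiRingOfSets.class prod_type.

(* The product type, with the semiring of rectangles in place of the product sigma-algebra. *)
Definition rectangles : semiRingOfSetsType (rectangles_display d1 d2) :=
  @SemiRingOfSets.Pack _ (T1 * T2)%type (SemiRingOfSets.Class
    (SemiRingOfSets.classical_sets_isPointed_mixin prod_class)
    (SemiRingOfSets.choice_hasChoice_mixin prod_class)
    (SemiRingOfSets.eqtype_hasDecEq_mixin prod_class)
    (isSemiRingOfSets.Build (rectangles_display d1 d2) (T1 * T2)%type
       rectangle0 rectangleI rectangleD)).

End rectangles.

Section rectangle_extension.
Context d1 d2 (T1 : measurableType d1) (T2 : measurableType d2) (R : realType).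
Local Notation T := (T1 * T2)%type.

Definition finitely_additive (a : set T -> R) := forall S S' : set T,
  measurable S -> measurable S' -> S `&` S' = set0 -> a (S `|` S') = a S + a S'.

Definition rectangle_sigma_subadditive (a : set T -> R) :=
  forall (A : set T) (F : nat -> set T), (forall n, rectangle (F n)) -> rectangle A ->
  A `<=` \bigcup_n F n -> ((a A)%:E <= \sum_(0 <= n <oo) (a (F n))%:E)%E.

Section finitely_additive.
Variables (a : set T -> R) (a0 : forall S, 0 <= a S) (aD : finitely_additive a).

Lemma fadd_set0 : a set0 = 0.
Proof.
have := aD measurable0 measurable0 (set0I _); rewrite setU0; lra.
Qed.

Lemma fadd_le S S' : measurable S -> measurable S' -> S `<=` S' -> a S <= a S'.
Proof.
move=> mS mS' SS'; rewrite -(setDUK SS') aD ?lerDl//; first exact: measurableD.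
by rewrite setDE setICA setICr setI0.
Qed.

Lemma fadd_D S S' : measurable S -> measurable S' -> a (S `|` S') = a S + a S' - a (S `&` S').
Proof.
move=> mS mS'.
have -> : a S' = a (S' `\` S) + a (S `&` S').
  rewrite -aD; [|exact: measurableD|exact: measurableI|].
    congr a; apply/seteqP; split => x /=; have [] := pselect (S x); tauto.
  by apply/seteqP; split => x //= [[_ nS] [/nS]].
have -> : S `|` S' = S `|` (S' `\` S).
  by apply/seteqP; split => x /=; have [] := pselect (S x); tauto.
rewrite aD; [lra|exact: mS|exact: measurableD|].
by apply/seteqP; split => x //= [Sx [_ /(_ Sx)]].
Qed.

Lemma fadd_subadd S S' : measurable S -> measurable S' -> a (S `|` S') <= a S + a S'.
Proof. by move=> mS mS'; rewrite fadd_D// lerBlDr lerDl. Qed.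

Lemma fadd_bigsetU (I : Type) (r : seq I) (F : I -> set T) : (forall i, measurable (F i)) ->
  a (\big[setU/set0]_(i <- r) F i) <= \sum_(i <- r) a (F i).
Proof.
move=> mF; elim: r => [|i r ih]; first by rewrite !big_nil fadd_set0.
rewrite !big_cons (le_trans (fadd_subadd _ _))//; last by rewrite lerD2l.
exact: bigsetU_measurable.
Qed.

Lemma fadd_bigsetU_trivIset (F : nat -> set T) n : (forall i, measurable (F i)) ->
  trivIset setT F -> a (\big[setU/set0]_(i < n) F i) = \sum_(i < n) a (F i).
Proof.
move=> mF tF; elim: n => [|n ih]; first by rewrite !big_ord0 fadd_set0.
rewrite !big_ord_recr/= aD ?ih//; first exact: bigsetU_measurable.
rewrite -bigcup_mkord; apply/seteqP; split => x //= [[i /= lti Fi] Fn].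
have /tF : F i `&` F n !=set0 by exists x.
by move=> /(_ I I) ni; rewrite ni ltnn in lti.
Qed.

End finitely_additive.

(** Only the values of [a] on rectangles are retained. An ultrafilter limit is finitely additive on
    the whole product sigma-algebra but may fail to be countably additive there; on rectangles it is
    a premeasure, and Caratheodory's extension of it may differ from [a] elsewhere. *)
Definition rectangle_content (a : set T -> R) (a0 : forall S, 0 <= a S)
  (aD : finitely_additive a) (ssa : rectangle_sigma_subadditive a)
  (S : set (rectangles T1 T2)) : \bar R := (a S)%:E.

Section content.
Variables (a : set T -> R) (a0 : forall S, 0 <= a S).
Variables (aD : finitely_additive a) (ssa : rectangle_sigma_subadditive a).
Local Notation content := (rectangle_content a0 aD ssa).

Lemma measurable_rectangle S : @rectangle _ _ T1 T2 S -> measurable (S : set T).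
Proof. by move=> [A mA [B mB <-]]; exact: measurableX. Qed.

Let content_ge0 S : (0 <= content S)%E. Proof. by rewrite lee_fin. Qed.

Let content_semi_additive : measure_function.semi_additive content.
Proof.
move=> F n mF tF _; rewrite /rectangle_content fadd_bigsetU_trivIset ?sumEFin//.
by move=> i; exact: (measurable_rectangle (mF i)).
Qed.

HB.instance Definition _ := isContent.Build _ (rectangles T1 T2) R content
  content_ge0 content_semi_additive.

HB.instance Definition _ := Content_SigmaSubAdditive_isMeasure.Build _ _ (rectangles T1 T2)
  content ssa.

Definition rectangle_extension (S : set T) : \bar R := measure_extension content S.

Let ext_measurable (S : set T) : measurable S ->
  measurable (S : set (g_sigma_algebraType (@rectangle _ _ T1 T2))).
Proof. by rewrite measurable_prod_measurableType. Qed.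

Let ext0 : rectangle_extension set0 = 0%E.
Proof. exact: (measure0 (measure_extension content)). Qed.

Let ext_ge0 S : (0 <= rectangle_extension S)%E.
Proof. exact: (measure_ge0 (measure_extension content)). Qed.

Let ext_sigma_additive : semi_sigma_additive rectangle_extension.
Proof.
move=> F mF tF mUF.
apply: (@measure_semi_sigma_additive _ _ _ (measure_extension content)) => //.
- by move=> i; exact: ext_measurable.
- exact: ext_measurable.
Qed.

HB.instance Definition _ := isMeasure.Build _ _ _ rectangle_extension
  ext0 ext_ge0 ext_sigma_additive.

Lemma rectangle_extensionE A B : measurable A -> measurable B ->
  rectangle_extension (A `*` B) = (a (A `*` B))%:E.
Proof.
move=> mA mB; apply: (measurable_mu_extE content).
by exists A => //; exists B.
Qed.

Hypothesis a1 : a setT = 1.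

Lemma rectangle_extension_probability : exists pi : probability T R,
  forall A B, measurable A -> measurable B -> pi (A `*` B) = (a (A `*` B))%:E.
Proof.
have extT : rectangle_extension setT = 1%E.
  by rewrite -setXTT rectangle_extensionE// setXTT a1.
pose m := Measure_isProbability.Build _ _ _ rectangle_extension extT.
pose pi : probability T R := HB.pack rectangle_extension m.
by exists pi => A B mA mB; exact: rectangle_extensionE.
Qed.

End content.
End rectangle_extension.

(** * Limits of probability measures along an ultrafilter *)

Section ultralimit.
Context d (T : measurableType d) (R : realType) (P : nat -> probability T R).
Variables (U : set_system nat) (UU : UltraFilter U).

(** Compactness of [[0, 1]] gives a cluster point, and a cluster point of an ultrafilter is a
    limit. *)
Lemma ultralimit_bounded (f : nat -> R) : (forall n, 0 <= f n <= 1) ->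
  exists2 l : R, 0 <= l & f n @[n --> U] --> l.
Proof.
move=> f01; have FU : ProperFilter U by exact: ultra_proper.
have [|l [/= + cl]] := @segment_compact R 0 1 (f @ U) _ _.
  apply: (@filterS _ U _ setT) => [n _|]; last exact: filterT.
  by rewrite /= in_itv/=.
rewrite in_itv/= => /andP[l0 _]; exists l => // V lV.
have [//|UV] := in_ultra_setVsetC (f @^-1` V) UU.
by have [y [/= ny Vy]] := cl (~` V) V UV lV.
Qed.

(** One ultrafilter yields limits on all measurable sets simultaneously, with no extraction of
    subsequences. *)
Lemma ultralimit : exists a : set T -> R, (forall S, 0 <= a S) /\
  forall S, measurable S -> fine (P n S) @[n --> U] --> a S.
Proof.
have H S : exists l : R, 0 <= l /\ (measurable S -> fine (P n S) @[n --> U] --> l).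
  have [mS|nS] := pselect (measurable S); last by exists 0.
  have [n|l l0 cl] := @ultralimit_bounded (fun n => fine (P n S)); last by exists l.
  by rewrite fine_ge0//= -lee_fin fineK ?fin_num_measure// probability_le1.
have [a Ha] := choice H; exists a; split => S; by have [] := Ha S.
Qed.

Variables (a : set T -> R) (aP : forall S, measurable S -> fine (P n S) @[n --> U] --> a S).

Lemma ultralimit_finitely_additive S S' : measurable S -> measurable S' ->
  S `&` S' = set0 -> a (S `|` S') = a S + a S'.
Proof.
move=> mS mS' SS'; have FU : ProperFilter U by exact: ultra_proper.
apply: (@cvg_unique _ _ (fine (P n (S `|` S')) @[n --> U])).
- exact: norm_hausdorff.
- by apply: aP; exact: measurableU.
- rewrite (_ : (fun n => _) = (fun n => fine (P n S) + fine (P n S'))).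
    by apply: cvgD; exact: aP.
  by apply/funext => n; rewrite measureU// fineD// fin_num_measure.
Qed.

Lemma ultralimit_cst S c : measurable S -> (forall n, P n S = c%:E) -> a S = c.
Proof.
move=> mS Pc; have FU : ProperFilter U by exact: ultra_proper.
apply: (@cvg_unique _ _ (fine (P n S) @[n --> U])).
- exact: norm_hausdorff.
- exact: aP.
- rewrite (_ : (fun n => _) = (fun=> c)); first exact: cvg_cst.
  by apply/funext => n; rewrite Pc.
Qed.

End ultralimit.

Section Rd2.
Context {R : realType} {d : nat}.
Local Notation Tm := (Rd R d * Rd R d)%type.
Implicit Types (mu nu : probability (Rd R d) R).

Section sigma_subadditive.
Variables (mu nu : probability (Rd R d) R) (a : set Tm -> R).
Hypotheses (a0 : forall S, 0 <= a S) (aD : finitely_additive a).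
Hypothesis a_fst : forall A : set (Rd R d), measurable A -> (a (A `*` setT))%:E = mu A.
Hypothesis a_snd : forall B : set (Rd R d), measurable B -> (a (setT `*` B))%:E = nu B.

(** A point of the first rectangle that is not in the second has its first coordinate in [A] minus
    [A'] or its second in [B] minus [B'], and [a] of these strips is known from the marginals. *)
Let a_diff A A' B B' : measurable (A : set (Rd R d)) -> measurable (A' : set (Rd R d)) ->
  measurable (B : set (Rd R d)) -> measurable (B' : set (Rd R d)) ->
  ((a (A `*` B))%:E <= (a (A' `*` B'))%:E + mu (A `\` A') + nu (B `\` B'))%E.
Proof.
move=> mA mA' mB mB'.
have mAA := measurableD mA mA'; have mBB := measurableD mB mB'.
rewrite -a_fst// -a_snd// -!EFinD lee_fin.
have mR1 : measurable ((A `\` A') `*` setT : set Tm) by exact: measurableX.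
have mR2 : measurable (setT `*` (B `\` B') : set Tm) by exact: measurableX.
have mR3 : measurable (A' `*` B' : set Tm) by exact: measurableX.
have mR4 : measurable (A `*` B : set Tm) by exact: measurableX.
have mR5 := measurableU _ _ mR3 mR1.
have mR6 := measurableU _ _ mR5 mR2.
apply: (le_trans (fadd_le a0 aD mR4 mR6 _)).
  move=> -[x y] [/= Ax By]; have [A'x|A'x] := pselect (A' x); last by left; right.
  by have [B'y|B'y] := pselect (B' y); [left; left|right].
apply: (le_trans (fadd_subadd a0 aD mR5 mR2)); rewrite lerD2r.
exact: fadd_subadd.
Qed.

(** The compactness argument for premeasures, run on the marginals: these are genuine measures, so
    regularity gives a compact rectangle inside the given one and open rectangles around the [F n].
    Finitely many of the latter cover the former, and finite subadditivity of [a] concludes. *)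
Lemma rectangle_sigma_subadditive_of_marginals : rectangle_sigma_subadditive a.
Proof.
move=> _ F mF [A mA [B mB <-]] AF; apply/lee_addgt0Pr => e e0.
(* The budget: [e / 4] for each side of the compact rectangle, and [e / 4 / 2^(n+1)] for each side
   of the [n]-th open one, which sums to [e / 2]. *)
have e4 : 0 < e / 4 by rewrite divr_gt0.
have en n : 0 < e / 4 / (2 ^ n.+1)%:R by rewrite divr_gt0// ltr0n expn_gt0.
have [K [kK KA muK]] := inner_regular mu mA e4.
have [L [kL LB nuL]] := inner_regular nu mB e4.
have /choice[G HG] : forall n, exists G : set 'rV[R]_d * set 'rV[R]_d,
    [/\ open G.1, open G.2, F n `<=` G.1 `*` G.2 &
     ((a (G.1 `*` G.2))%:E <= (a (F n))%:E + (e / 2 / (2 ^ n.+1)%:R)%:E)%E].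
  move=> n; have [A' mA' [B' mB' <-]] := mF n.
  have [C [V [cC oV CA AV muV]]] := measurable_sandwiched mu mA' (en n).
  have [D [W [cD oW DB BW nuW]]] := measurable_sandwiched nu mB' (en n).
  exists (V, W); split => //=.
    by move=> -[x y] [/= /AV ? /BW].
  have mV := open_measurable_Rd oV; have mW := open_measurable_Rd oW.
  apply: (le_trans (a_diff mV mA' mW mB')); rewrite -addeA leeD2l//.
  rewrite (_ : e / 2 / _ = e / 4 / (2 ^ n.+1)%:R + e / 4 / (2 ^ n.+1)%:R); last first.
    by rewrite -mulrDl; congr (_ / _); lra.
  rewrite EFinD; apply: leeD; apply: ltW.
    apply: le_lt_trans muV; apply: le_measure; rewrite ?inE.
    - exact: measurableD.
    - by apply: measurableD => //; exact: closed_measurable_Rd.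
    - by move=> x [Vx A'x]; split => // /CA.
  apply: le_lt_trans nuW; apply: le_measure; rewrite ?inE.
  - exact: measurableD.
  - by apply: measurableD => //; exact: closed_measurable_Rd.
  - by move=> x [Vx A'x]; split => // /DB.
have mK : measurable (K : set (Rd R d)).
  by apply: closed_measurable_Rd; apply: compact_closed => //; exact: norm_hausdorff.
have mL : measurable (L : set (Rd R d)).
  by apply: closed_measurable_Rd; apply: compact_closed => //; exact: norm_hausdorff.
have mG n : measurable ((G n).1 `*` (G n).2 : set Tm).
  by have [ho1 ho2 _ _] := HG n; apply: measurableX; exact: open_measurable_Rd.
pose TT : ptopologicalType := (('rV[R]_d * 'rV[R]_d)%type : normedModType R).
have kKL : @compact TT (K `*` L) := compact_setX kK kL.
rewrite compact_cover in kKL.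
have [||D _ KD] := kKL nat setT (fun n => (G n).1 `*` (G n).2).
- move=> n _; have [ho1 ho2 _ _] := HG n;
  rewrite (_ : _ `*` _ = (fst @^-1` (G n).1) `&` (snd @^-1` (G n).2)); last first.
    by apply/seteqP; split => -[x y] /=; tauto.
  apply: openI; apply: open_comp => // z _; [exact: cvg_fst|exact: cvg_snd].
- move=> [x y] [/= Kx Ly]; have [|n _ Fn] := AF (x, y); first by split; [exact: KA|exact: LB].
  by exists n => //; have [_ _ + _] := HG n; apply.
pose N := (\max_(i <- finmap.enum_fset D) i).+1.
have KN : K `*` L `<=` \big[setU/set0]_(i < N) ((G i).1 `*` (G i).2).
  rewrite -(bigcup_mkord N (fun i => (G i).1 `*` (G i).2)) => z /KD [i /= iD Gz].
  by exists i => //=; rewrite ltnS; apply: leq_bigmax_seq.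
apply: (le_trans (a_diff mA mK mB mL)).
apply: (@le_trans _ _ (\sum_(0 <= n <oo) (a (F n))%:E + (e / 2)%:E + (e / 4)%:E + (e /
  4)%:E)%E); last first.
  by rewrite -!addeA leeD2l// -!EFinD lee_fin; lra.
apply: leeD; last exact: ltW.
apply: leeD; last exact: ltW.
have aF n : (0 <= (a (F n))%:E)%E by rewrite lee_fin.
apply: (@le_trans _ _ (\sum_(0 <= n <oo) ((a (F n))%:E + (e / 2 / (2 ^ n.+1)%:R)%:E))%E);
  last first.
  by apply: epsilon_trick => //; lra.
apply: (@le_trans _ _ (\sum_(i < N) (a ((G i).1 `*` (G i).2))%:E)%E).
  rewrite sumEFin lee_fin; apply: (le_trans (fadd_le a0 aD _ _ KN)).
  - exact: measurableX.
  - exact: bigsetU_measurable.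
  - exact: (fadd_bigsetU a0 aD (index_enum 'I_N) (F := fun i : 'I_N => (G i).1 `*` (G i).2)).
apply: (@le_trans _ _ (\sum_(i < N) ((a (F i))%:E + (e / 2 / (2 ^ i.+1)%:R)%:E))%E).
  by apply: lee_sum => i _; have [_ _ _] := HG i.
rewrite -(big_mkord xpredT (fun i => (a (F i))%:E + (e / 2 / (2 ^ i.+1)%:R)%:E)%E).
apply: nneseries_lim_ge => n _ _.
by rewrite adde_ge0// lee_fin divr_ge0// divr_ge0// ltW.
Qed.

End sigma_subadditive.

(** Triples [(k, l, n)] code two rational cubes of the same size; a code whose rectangle is not
    inside [O] contributes the empty set. *)
Lemma open_prod_bigcup (O : set ('rV[R]_d * 'rV[R]_d)) : open O ->
  exists A B : nat -> set 'rV[R]_d,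
  [/\ forall n, open (A n), forall n, open (B n) & O = \bigcup_n (A n `*` B n)].
Proof.
move=> hO.
pose Q (i : nat * nat * nat) : set 'rV[R]_d * set 'rV[R]_d :=
  (cube (rat_seq i.1.1) i.2.+1%:R^-1, cube (rat_seq i.1.2) i.2.+1%:R^-1).
pose S n : set 'rV[R]_d * set 'rV[R]_d :=
  if @unpickle (nat * nat * nat)%type n is Some i then
    if `[< (Q i).1 `*` (Q i).2 `<=` O >] then Q i else (set0, set0)
  else (set0, set0).
have n0 n : 0 < n.+1%:R^-1 :> R by rewrite invr_gt0.
have oQ i : open (Q i).1 /\ open (Q i).2.
  by rewrite /Q/= !cubeE//; split; exact: ball_open.
have oS n : open (S n).1 /\ open (S n).2.
  rewrite /S; case: unpickle => [i|]; last by split; exact: open0.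
  by case: ifP => // _; split; exact: open0.
exists (fun n => (S n).1), (fun n => (S n).2); split => [n|n|].
- by have [] := oS n.
- by have [] := oS n.
apply/seteqP; split => [[x y] Oxy|[x y] [n _]]; last first.
  rewrite /S; case: unpickle => [i|]; last by case.
  by case: ifPn => [/asboolP|_ []//]; exact.
have /nbhs_ballP[e /= e0 eO] := open_nbhs_nbhs (conj hO Oxy).
have [n ne] : exists n, n.+1%:R^-1 < e / 2.
  have := near_infty_natSinv_lt (PosNum (divr_gt0 e0 (ltr0Sn R 1))).
  by move=> [n _ /(_ n (leqnn n))] ?; exists n.
have [k xk] := rat_seq_dense x (n0 n).
have [l yl] := rat_seq_dense y (n0 n).
have H (z w : 'rV[R]_d) m : (forall i, `|z 0 i - rat_seq m 0 i| < n.+1%:R^-1) ->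
    cube (rat_seq m) n.+1%:R^-1 w -> ball z e w.
  move=> zm mw; rewrite -cubeE// => i.
  rewrite (le_lt_trans (ler_distD (rat_seq m 0 i) _ _))//.
  by apply: (lt_trans (ltrD (zm i) (mw i))); move: (n.+1%:R^-1) ne => t; lra.
exists (pickle (k, l, n)) => //; rewrite /S pickleK ifT.
  by split => i /=; rewrite distrC; [exact: xk|exact: yl].
apply/asboolP => -[x' y'] [/= xx' yy']; apply: eO; split; exact: H.
Qed.

(** A lower sum for the layer-cake formula: [S] adds [1 / N] for each level [k.+1 / N] below [y], so
    it misses [y], cut off at [K / N], by at most one step. *)
Lemma min_le_layers (N : nat) (y : R) K : (0 < N)%N -> 0 <= y ->
  let S := \sum_(k < K) (if k.+1%:R / N%:R < y then N%:R^-1 else 0) in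
  S <= y /\ Num.min y (K%:R / N%:R) <= S + N%:R^-1.
Proof.
move=> N0 y0; have N0' : 0 < N%:R^-1 :> R by rewrite invr_gt0 ltr0n.
pose S K : R := \sum_(k < K) (if k.+1%:R / N%:R < y then N%:R^-1 else 0).
suff [H1 [H2 H3]] : S K <= y /\ S K <= K%:R / N%:R /\ (S K = K%:R / N%:R \/ y - N%:R^-1 <= S K).
  split => //; rewrite -/(S K) ge_min; case: H3 => h; apply/orP; [right|left]; last lra.
  by rewrite h lerDl ltW.
elim: K => [|K [IH1 [IH2 IH3]]].
  by rewrite /S big_ord0 mul0r lexx; split => //; split => //; left.
rewrite /S big_ord_recr/= -/(S K).
have KN : K.+1%:R / N%:R = K%:R / N%:R + N%:R^-1 :> R by rewrite -natr1 mulrDl mul1r.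
rewrite KN; case: ltP => yK; (split; [|split]); [lra|lra| |lra|lra| ].
- by case: IH3 => h; [left; lra|right; lra].
- by right; case: IH3 => h; lra.
Qed.

Section lsc.
Variables (P : nat -> probability Tm R) (U : set_system nat) (UU : UltraFilter U).
Variables (a : set Tm -> R) (pi : probability Tm R).
Hypotheses (a0 : forall S, 0 <= a S)
  (aP : forall S, measurable S -> fine (P n S) @[n --> U] --> a S)
  (piE : forall A B : set (Rd R d), measurable A -> measurable B ->
     pi (A `*` B) = (a (A `*` B))%:E).

Let aD : finitely_additive a.
Proof. by move=> S S' mS mS' SS'; exact: (ultralimit_finitely_additive UU aP). Qed.

Let rect (A B : nat -> set (Rd R d)) i : set Tm := A i `*` B i.

(** Inclusion-exclusion on finite unions of rectangles. The extra intersection with [Q] times [Q']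
    makes the induction work: the overlap of the union with the next rectangle is again of this
    form. *)
Let pi_bigsetU (A B : nat -> set (Rd R d)) n (Q Q' : set (Rd R d)) :
  (forall i, measurable (A i)) -> (forall i, measurable (B i)) ->
  measurable Q -> measurable Q' ->
  pi ((\big[setU/set0]_(i < n) rect A B i) `&` (Q `*` Q')) =
  (a ((\big[setU/set0]_(i < n) rect A B i) `&` (Q `*` Q')))%:E.
Proof.
move=> mA mB; elim: n Q Q' => [|n ih] Q Q' mQ mQ'.
  by rewrite big_ord0 set0I measure0 (fadd_set0 aD).
have mU : measurable (\big[setU/set0]_(i < n) rect A B i).
  by apply: bigsetU_measurable => i _; exact: measurableX.
have mQQ : measurable (Q `*` Q' : set Tm) by exact: measurableX.
have mR : measurable (rect A B n) by exact: measurableX.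
rewrite big_ord_recr/= setIUl (fadd_D aD); [|exact: measurableI|exact: measurableI].
have RE : rect A B n `&` (Q `*` Q') = (A n `&` Q) `*` (B n `&` Q').
  by apply/seteqP; split => -[x y] /=; rewrite /rect/=; tauto.
have IE : (\big[setU/set0]_(i < n) rect A B i) `&` (Q `*` Q') `&` (rect A B n `&` (Q `*` Q')) =
    (\big[setU/set0]_(i < n) rect A B i) `&` ((A n `&` Q) `*` (B n `&` Q')).
  by rewrite -RE; apply/seteqP; split => z /=; tauto.
have mAQ := measurableI _ _ (mA n) mQ; have mBQ := measurableI _ _ (mB n) mQ'.
have m1 : measurable ((\big[setU/set0]_(i < n) rect A B i) `&` (Q `*` Q')) by exact: measurableI.
have m2 : measurable ((A n `&` Q) `*` (B n `&` Q') : set Tm) by exact: measurableX.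
rewrite IE RE; have -> := measureUfinr m1 m2; last by rewrite ltey_eq fin_num_measure.
have -> : (\big[setU/set0]_(i < n) rect A B i) `&` (Q `*` Q') `&` ((A n `&` Q) `*` (B n `&` Q')) =
    (\big[setU/set0]_(i < n) rect A B i) `&` ((A n `&` Q) `*` (B n `&` Q')).
  by rewrite -[in LHS]RE; exact: IE.
by rewrite EFinB EFinD -ih// -ih// -piE.
Qed.

(** One half of the portmanteau theorem: an open set is an increasing limit of finite unions of
    rectangles, along which [pi] is continuous while [a] is merely monotone. *)
Lemma ultralimit_open (O : set ('rV[R]_d * 'rV[R]_d)) : open O -> measurable (O : set Tm) ->
  (pi O <= (a O)%:E)%E.
Proof.
move=> hO mO; have [A [B [hA hB OE]]] := open_prod_bigcup hO.
have mA n : measurable (A n : set (Rd R d)) by exact: open_measurable_Rd.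
have mB n : measurable (B n : set (Rd R d)) by exact: open_measurable_Rd.
pose F n := \big[setU/set0]_(i < n) rect A B i.
have mF n : measurable (F n) by apply: bigsetU_measurable => i _; exact: measurableX.
have FO : \bigcup_n F n = O.
  rewrite OE; apply/seteqP; split => z [n _].
    by rewrite /F -(bigcup_mkord n (rect A B)) => -[i _ ?]; exists i.
  by move=> ?; exists n.+1 => //; rewrite /F big_ord_recr/=; right.
have cF : pi (F n) @[n --> \oo] --> pi O.
  rewrite -FO; apply: nondecreasing_cvg_mu => //.
    by rewrite FO.
  by move=> m n mn; apply/subsetPset; exact: subset_bigsetU.
rewrite -(cvg_lim _ cF)//; apply: lime_le; first exact: (cvgP _ cF).
apply: nearW => n; have := @pi_bigsetU A B n setT setT mA mB measurableT measurableT.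
rewrite setXTT !setIT => ->; rewrite lee_fin; apply: (fadd_le a0 aD (mF n) mO).
by rewrite -FO => z ?; exists n.
Qed.

(** Lower semicontinuity of the cost. The level sets of [c] are open, so the layer sums for [pi] are
    at most those for [a], which are limits of sums below the integrals of [c]. Truncating at [M]
    leaves finitely many layers, and monotone convergence removes the truncation. *)
Lemma ultralimit_integral_le (c : 'rV[R]_d * 'rV[R]_d -> R) (L : R) :
  (forall r, open [set z | r < c z]) -> measurable_fun [set: Tm] c -> (forall z, 0 <= c z) ->
  (\forall n \near U, \int[P n]_z (c z)%:E <= L%:E)%E ->
  (\int[pi]_z (c z)%:E <= L%:E)%E.
Proof.
move=> oc mc c0 cL; have FU : ProperFilter U by exact: ultra_proper.
have moc (r : R) : measurable ([set z | r < c z] : set Tm).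
  rewrite (_ : mkset _ = c @^-1` `]r, +oo[%classic).
    by rewrite -[X in measurable X]setTI; exact: mc.
  by apply/seteqP; split => z /=; rewrite in_itv/= andbT.
pose s (N K : nat) (z : Tm) : R :=
  \sum_(k < K) (if k.+1%:R / N%:R < c z then N%:R^-1 else 0).
have sE N K z : (s N K z)%:E =
    (\sum_(k < K) (N%:R^-1)%:E * (\1_[set z | (k.+1%:R / N%:R < c z)%R] z)%:E)%E.
  rewrite /s -sumEFin; apply: eq_bigr => k _; rewrite indicE.
  case: ifPn => h; first by rewrite mem_set ?mule1.
  by rewrite memNset ?mule0//=; apply/negP.
have int_s (Q : probability Tm R) N K : (\int[Q]_z (s N K z)%:E =
    \sum_(k < K) (N%:R^-1)%:E * Q [set z | (k.+1%:R / N%:R < c z)%R])%E.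
  under eq_integral do rewrite sE.
  rewrite ge0_integral_sum//; last first.
    by move=> k; apply/measurable_EFinP; apply: measurable_funM.
  apply: eq_bigr => k _; rewrite ge0_integralZl//; last first.
    by apply/measurable_EFinP; exact: measurable_indic.
  by rewrite integral_indic// setIT.
have ms N K : measurable_fun setT (fun z => (s N K z)%:E).
  under eq_fun do rewrite sE.
  by apply: emeasurable_sum => k; apply/measurable_EFinP; apply: measurable_funM.
have s0 N K z : 0 <= s N K z.
  by apply: sumr_ge0 => k _; case: ifP => // _; rewrite invr_ge0.
have aL N K : (0 < N)%N -> \sum_(k < K) N%:R^-1 * a [set z | k.+1%:R / N%:R < c z] <= L.
  move=> N0.
  have cv : (\sum_(k < K) N%:R^-1 * fine (P n [set z | k.+1%:R / N%:R < c z])) @[n --> U] -->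
      \sum_(k < K) N%:R^-1 * a [set z | k.+1%:R / N%:R < c z].
    elim: K => [|K ih].
      by rewrite big_ord0; under eq_fun do rewrite big_ord0; exact: cvg_cst.
    rewrite big_ord_recr/=; under eq_fun do rewrite big_ord_recr/=.
    by apply: cvgD => //; apply: cvgM; [exact: cvg_cst|exact: aP].
  rewrite -(cvg_lim _ cv)//; apply: limr_le; first exact: (cvgP _ cv).
  near=> n; rewrite -lee_fin; apply: (@le_trans _ _ (\int[P n]_z (c z)%:E)%E); last by near: n.
  apply: (@le_trans _ _ (\int[P n]_z (s N K z)%:E)%E).
    rewrite int_s -sumEFin; apply: lee_sum => k _; rewrite EFinM fineK//.
    by rewrite fin_num_measure.
  apply: ge0_le_integral => //.
  - by move=> z _; rewrite lee_fin.
  - exact/measurable_EFinP.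
  - by move=> z _; rewrite lee_fin; have [] := @min_le_layers N (c z) K N0 (c0 z).
have mmin (M : nat) : measurable_fun setT (fun z : Tm => (Num.min (c z) M%:R)%:E).
  by apply/measurable_EFinP; apply: measurable_minr.
have min0 (M : nat) z : 0 <= Num.min (c z) M%:R by rewrite le_min c0/=.
have minL (M : nat) : (\int[pi]_z (Num.min (c z) M%:R)%:E <= L%:E)%E.
  apply/lee_addgt0Pr => e e0.
  have [N Ne] : exists N, N.+1%:R^-1 < e.
    have [N _ /(_ N (leqnn N))] := near_infty_natSinv_lt (PosNum e0).
    by move=> ?; exists N.
  apply: (@le_trans _ _ (\int[pi]_z ((s N.+1 (M * N.+1)%N z)%:E + (e%:E : \bar R)))%E).
    apply: ge0_le_integral => //.
    - by move=> z _; rewrite lee_fin.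
    - exact: emeasurable_funD.
    move=> z _; rewrite -EFinD lee_fin.
    have [//|_] := @min_le_layers N.+1 (c z) (M * N.+1) _ (c0 z).
    rewrite natrM -mulrA mulfV// mulr1 => h; apply: (le_trans h).
    by rewrite lerD2l ltW.
  rewrite ge0_integralD//; last 2 first.
  - by move=> z _; rewrite lee_fin.
  - by move=> z _; rewrite lee_fin ltW.
  rewrite (integral_cst pi measurableT e%:E) [X in (_ * X)%E](probability_setT pi) mule1.
  rewrite leeD2r// int_s; apply: le_trans (_ : (\sum_(k < M * N.+1) N.+1%:R^-1 *
    a [set z | (k.+1%:R / N.+1%:R < c z)%R])%:E <= _)%E; last by rewrite lee_fin aL.
  rewrite -sumEFin; apply: lee_sum => k _; rewrite EFinM.
  by apply: lee_wpmul2l; [rewrite lee_fin invr_ge0|exact: ultralimit_open].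
have cvm : (\int[pi]_z (Num.min (c z) M%:R)%:E)%E @[M --> \oo] --> (\int[pi]_z (c z)%:E)%E.
  have -> : (\int[pi]_z (c z)%:E = \int[pi]_z (limn (fun M : nat => (Num.min (c z) M%:R)%:E)))%E.
    apply: eq_integral => z _; apply/esym/cvg_lim => //.
    apply: cvg_near_cst; exists (Num.trunc (c z)).+1 => // M /= cM.
    by rewrite min_l// ltW// (lt_le_trans (truncnS_gt _))// ler_nat.
  apply: cvg_monotone_convergence => //.
  - by move=> M z _; rewrite lee_fin.
  - move=> z _ M M' MM'; rewrite lee_fin le_min ge_min lexx/= ge_min.
    by rewrite ler_nat MM' orbT.
rewrite -(cvg_lim _ cvm)//; apply: lime_le; first exact: (cvgP _ cvm).
exact: nearW.
Unshelve. all: by end_near. Qed.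

End lsc.

Section optimal.
Variables (p : R) (hp : 1 < p).

Let p0 : 0 < p. Proof. exact: lt_trans hp. Qed.

Lemma open_dist_powR (r : R) :
  open [set z : 'rV[R]_d * 'rV[R]_d | r < enorm (z.1 - z.2) `^ p].
Proof.
have [r0|r0] := ltP r 0.
  rewrite (_ : mkset _ = setT); first exact: openT.
  by apply/seteqP; split => // z _ /=; rewrite (lt_le_trans r0)// powR_ge0.
rewrite (_ : mkset _ = (fun z : 'rV[R]_d * 'rV[R]_d => enorm (z.1 - z.2)) @^-1`
    [set y | r `^ p^-1 < y]).
  apply: open_comp => [z _|]; last exact: open_gt.
  apply: (@continuous_comp _ _ _ (fun z : 'rV[R]_d * 'rV[R]_d => z.1 - z.2)).
    by apply: cvgB; [exact: cvg_fst|exact: cvg_snd].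
  exact: enorm_continuous.
apply/seteqP; split => z /= h.
  have e0 := enorm_ge0 (z.1 - z.2).
  rewrite -(powRr1 e0) -(mulfV (lt0r_neq0 p0)) powRrM.
  by apply: gt0_ltr_powR => //; rewrite ?invr_gt0// nnegrE// powR_ge0.
rewrite -[ltLHS](powRr1 r0) -(mulVf (lt0r_neq0 p0)) powRrM.
by apply: gt0_ltr_powR => //; rewrite nnegrE ?powR_ge0// enorm_ge0.
Qed.

Theorem opt_couplings_nonempty (mu nu : Mp R d p) : opt_couplings mu nu !=set0.
Proof.
have W0 := Wp_ge0 mu nu.
have /choice[P HP] : forall n : nat, exists pi : probability Tm R, couplings mu nu pi /\
    (transport_cost p pi < (Wp mu nu + n.+1%:R^-1)%:E)%E.
  move=> n; have n0 : 0 < n.+1%:R^-1 :> R by rewrite invr_gt0.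
  by have [pi c1 c2] := Wp_approx hp mu nu n0; exists pi.
(* An ultrafilter that contains every tail of the sequence, on which the costs are close to
   [Wp mu nu]. *)
have [U [UU Uoo]] := @ultraFilterLemma nat \oo _.
have [a [a0 aP]] := ultralimit P UU.
have aD : finitely_additive a.
  by move=> S S' mS mS' SS'; exact: (ultralimit_finitely_additive UU aP).
have P1 n (A : set (Rd R d)) : measurable A -> P n (A `*` setT) = mu A.
  move=> mA; have [[_ <- // _] _] := HP n; congr (P n _).
  by apply/seteqP; split => // z [].
have P2 n (B : set (Rd R d)) : measurable B -> P n (setT `*` B) = nu B.
  move=> mB; have [[_ _ <- //] _] := HP n; congr (P n _).
  by apply/seteqP; split => // z [].
have a1 (A : set (Rd R d)) : measurable A -> (a (A `*` setT))%:E = mu A.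
  move=> mA; rewrite (@ultralimit_cst _ _ _ P U UU a aP (A `*` setT) (fine (mu A))).
  - by rewrite fineK// fin_num_measure.
  - exact: measurableX.
  - by move=> n; rewrite P1// fineK// fin_num_measure.
have a2 (B : set (Rd R d)) : measurable B -> (a (setT `*` B))%:E = nu B.
  move=> mB; rewrite (@ultralimit_cst _ _ _ P U UU a aP (setT `*` B) (fine (nu B))).
  - by rewrite fineK// fin_num_measure.
  - exact: measurableX.
  - by move=> n; rewrite P2// fineK// fin_num_measure.
have aT : a setT = 1.
  apply: EFin_inj; rewrite -setXTT a1//; exact: probability_setT.
have [pi piE] := rectangle_extension_probability a0 aD
   (rectangle_sigma_subadditive_of_marginals a0 aD a1 a2) aT.
(* [pi] has the right marginals; the joint law of its projections comes with the moment condition of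
   [couplings] and has the same nonnegative integrals. *)
have [||pi' cpi piE'] := @joint_law_coupling _ _ p hp _ _ pi fst snd measurable_fst
  measurable_snd mu nu.
- move=> A mA; rewrite -a1// -piE//; congr (pi _).
  by apply/seteqP; split => // z [].
- move=> A mA; rewrite -a2// -piE//; congr (pi _).
  by apply/seteqP; split => // z [].
exists pi'; split => //; apply/eqP; rewrite eq_le Wp_ereal_le// andbT -(WpE hp).
have mc : measurable_fun [set: Tm] (fun z => enorm ((z.1 : 'rV[R]_d) - z.2) `^ p).
  by apply: (measurableT_comp (measurable_powR p)); exact: measurable_fun_dist.
apply/lee_addgt0Pr => e e0; rewrite -EFinD.
have We0 : 0 <= Wp mu nu + e by rewrite addr_ge0// ltW.
have : (\int[pi']_z (enorm ((z.1 : 'rV[R]_d) - z.2) `^ p)%:E <= ((Wp mu nu + e) `^ p)%:E)%E.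
  rewrite piE'//; last 2 first.
  - exact/measurable_EFinP.
  - by move=> z; rewrite lee_fin powR_ge0.
  apply: (@ultralimit_integral_le P U UU a pi a0 aP piE
     (fun z => enorm (z.1 - z.2) `^ p) _ open_dist_powR mc).
  - by move=> z; exact: powR_ge0.
  - apply: Uoo; have := near_infty_natSinv_lt (PosNum e0); apply: filterS => n /= ne.
    have [_ /ltW Pn] := HP n.
    have {}Pn : (transport_cost p (P n) <= (Wp mu nu + e)%:E)%E.
      by apply: (le_trans Pn); rewrite lee_fin lerD2l ltW.
    have : (transport_cost p (P n) `^ p <= (Wp mu nu + e)%:E `^ p)%E.
      apply: gt0_ler_poweR Pn; rewrite ?in_itv/= ?leey ?andbT ?poweR_ge0//.
      exact: ltW.
    rewrite /transport_cost -poweRrM mulVf ?gt_eqF// poweRe1//.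
    by apply: integral_ge0 => z _; rewrite lee_fin powR_ge0.
move=> h; rewrite /transport_cost.
have : ((\int[pi']_z (enorm ((z.1 : 'rV[R]_d) - z.2) `^ p)%:E) `^ p^-1 <= ((Wp mu nu + e) `^
  p)%:E `^ p^-1)%E.
  apply: gt0_ler_poweR h.
  - by rewrite invr_ge0 ltW.
  - by rewrite in_itv/= leey andbT integral_ge0// => z _; rewrite lee_fin powR_ge0.
  - by rewrite in_itv/= leey andbT lee_fin powR_ge0.
by rewrite poweR_EFin -powRrM mulfV ?gt_eqF// powRr1.
Qed.

End optimal.
End Rd2.

(** * Metric derivatives *)

Section cumulated_integral.
Context {R : realType}.
Local Notation leb := (@lebesgue_measure R).
Implicit Types (f : R -> R) (s t x : R).

Definition cumul f x : R := \int[leb]_(r in `]-oo, x]) f r.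

Section integrable.
Variables (f : R -> R) (If : leb.-integrable setT (EFin \o f)).

Lemma integrable_sub D : measurable D -> leb.-integrable D (EFin \o f).
Proof. by move=> mD; exact: (integrableS measurableT). Qed.

Lemma cumul_itv_oc s t : s <= t ->
  (\int[leb]_(x in `]s, t]) (f x)%:E = (cumul f t - cumul f s)%:E)%E.
Proof.
move=> st; rewrite /cumul (@Rintegral_itvB _ _ _ (BRight t))//.
- by rewrite fineK//; apply: integrable_fin_num => //; exact: integrable_sub.
- exact: integrable_sub.
Qed.

Lemma cumul_itv s t : s <= t ->
  (\int[leb]_(x in `[s, t]) (f x)%:E = (cumul f t - cumul f s)%:E)%E.
Proof.
move=> st; rewrite -(cumul_itv_oc st) integral_itv_obnd_cbnd//.
by apply/measurable_EFinP; have /measurable_int/measurable_EFinP := integrable_sub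
  (measurable_itv `]s, t]).
Qed.

Lemma ae_cumul_derive : {ae leb, forall x,
  h^-1 * (cumul f (x + h) - cumul f x) @[h --> 0^'] --> f x}.
Proof.
have i1 y : leb.-integrable `]-oo, y] (EFin \o f) by exact: integrable_sub.
have i2 : locally_integrable setT f by apply: open_integrable_locally => //; exact: openT.
have [N [mN N0 FN]] := @FTC1Ny R f i1 i2; exists N; split => //.
apply: subset_trans FN; apply: subsetC => x /= [dF Ff].
have Fx : lim (h^-1 *: (cumul f (h + x) - cumul f x) @[h --> 0^']) = f x by exact: Ff.
have cF : cvg (h^-1 *: (cumul f (h + x) - cumul f x) @[h --> 0^']).
  move: dF; rewrite /derivable (_ : (fun h => _) = (fun h =>
    h^-1 *: (cumul f (h + x) - cumul f x)))//.
  by apply/funext => h /=; congr (_ *: (cumul f (_ + x) - _)); exact: mulr1.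
by rewrite -Fx; under eq_fun do rewrite (addrC x).
Qed.

End integrable.
End cumulated_integral.

Section absolutely_continuous.
Context {R : realType}.
Local Notation leb := (@lebesgue_measure R).

(** The Stieltjes measure is an infimum over countable covers by half-open intervals, so a
    comparison of increments passes to every set. *)
Lemma lebesgue_stieltjes_le (F G : cumulative R R) :
  (forall s t, s <= t -> F t - F s <= G t - G s) ->
  forall A, (lebesgue_stieltjes_measure F A <= lebesgue_stieltjes_measure G A)%E.
Proof.
move=> FG A; apply: le_ereal_inf_tmp => _ [C cC <-].
apply: (@le_trans _ _ (\sum_(0 <= k <oo) wlength F (C k))%E).
  by apply: ereal_inf_lbound; exists C.
apply: lee_nneseries => [k _ _|k _]; first exact: wlength_ge0.
have /ocitvP[->|[[a b] /= ab ->]] : ocitv (C k) by exact: (cover_measurable cC k).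
  by rewrite !wlength0.
have ab' := ltW ab.
by rewrite !(wlength_itv_bnd _ _ _ ab') lee_fin FG.
Qed.

Lemma lebesgue_stieltjes_itv (F : cumulative R R) a b : a <= b ->
  lebesgue_stieltjes_measure F `]a, b] = (F b - F a)%:E.
Proof.
move=> ab; rewrite -(wlength_itv_bnd F false false ab)//.
rewrite /lebesgue_stieltjes_measure /measure_extension measurable_mu_extE//.
exact: is_ocitv.
Qed.

Lemma lebesgue_stieltjes_cumul (m : R -> R) (G : cumulative R R) :
  leb.-integrable setT (EFin \o m) -> (forall x, 0 <= m x) ->
  (forall x, G x = cumul m x) ->
  forall A, measurable A -> lebesgue_stieltjes_measure G A = (\int[leb]_(x in A) (m x)%:E)%E.
Proof.
move=> Im m0 GE.
have mm : measurable_fun setT (EFin \o m) by case/integrableP: Im.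
have m0' x : (0 <= (EFin \o m) x)%E by rewrite lee_fin.
pose k (A : set (measurableTypeR R)) := (\int[leb]_(x in A) (EFin \o m) x)%E.
have k0 : k set0 = 0%E by exact: integral_set0.
have kge0 A : (0 <= k A)%E by exact: integral_ge0.
have ks : semi_sigma_additive k by exact: semi_sigma_additive_nng_induced.
pose kM := isMeasure.Build _ (measurableTypeR R) R k k0 kge0 ks.
pose kk : {measure set (measurableTypeR R) -> \bar R} := HB.pack k kM.
move=> A mA; apply: (@lebesgue_stieltjes_measure_unique R G kk) =>
  // X /ocitvP[->|[[a b] /= ab ->]].
  by rewrite measure0; exact/esym/integral_set0.
by rewrite lebesgue_stieltjes_itv ?ltW// !GE -cumul_itv_oc ?ltW.
Qed.

(** Radon-Nikodym for absolutely continuous functions. Adding [cumul m] makes [phi] nondecreasing,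
    so that it has a Stieltjes measure; its increments are at most twice those of [cumul m], which
    gives absolute continuity. In the end [m] is subtracted from the density. *)
Lemma ac_density (m phi : R -> R) : leb.-integrable setT (EFin \o m) -> (forall x, 0 <= m x) ->
  (forall s t, s <= t -> `|phi t - phi s| <= cumul m t - cumul m s) ->
  exists g : R -> R, leb.-integrable setT (EFin \o g) /\
    forall s t, s <= t -> phi t - phi s = cumul g t - cumul g s.
Proof.
move=> Im m0 phim.
pose m2 x := 2 * m x.
have Im2 : leb.-integrable setT (EFin \o m2).
  by rewrite (_ : EFin \o m2 = fun x => (2%:E * (m x)%:E)%E)//; exact: integrableZl.
have m20 x : 0 <= m2 x by rewrite mulr_ge0.
have cm2 s t : s <= t -> cumul m2 t - cumul m2 s = 2 * (cumul m t - cumul m s).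
  move=> st; apply: EFin_inj; rewrite -cumul_itv_oc//.
  under eq_integral do rewrite EFinM.
  by rewrite integralZl// ?cumul_itv_oc//; exact: integrable_sub.
pose F x := phi x + cumul m x.
have ndm s t : s <= t -> cumul m s <= cumul m t.
  by move=> st; rewrite -subr_ge0 -lee_fin -cumul_itv_oc//; apply: integral_ge0 => x _;
    rewrite lee_fin.
have FG s t : s <= t -> F t - F s <= cumul m2 t - cumul m2 s.
  move=> st; rewrite cm2// /F; have := phim _ _ st; rewrite ler_norml => /andP[]; lra.
have ndF : nondecreasing F.
  move=> s t st; have := phim _ _ st; rewrite /F ler_norml => /andP[]; lra.
have ndG : nondecreasing (cumul m2).
  by move=> s t st; rewrite -subr_ge0 cm2// mulr_ge0// subr_ge0 ndm.
have rcG : right_continuous (cumul m2).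
  move=> x; apply/cvgrPdist_lt => e e0.
  have [d [d0 H]] := integral_normr_continuous Im2 e0.
  near=> y; have xy : x <= y by near: y; exact: nbhs_right_ge.
  rewrite distrC ger0_norm ?subr_ge0; last exact: ndG.
  have lxy : (leb (`]x, y]%classic : set R) < d%:E)%E.
    rewrite lebesgue_measure_itv/=; case: ifPn => _; last by rewrite lte_fin.
    rewrite -EFinB lte_fin ltrBlDr addrC; near: y; apply: nbhs_right_lt.
    by rewrite ltrDl.
  have := H _ (measurable_itv `]x, y]) lxy.
  apply: le_lt_trans; rewrite -lee_fin -cumul_itv_oc//.
  rewrite /Rintegral fineK; last first.
    apply: integrable_fin_num => //; apply: (integrableS measurableT) => //.
    exact: integrable_norm.
  by under [leRHS]eq_integral do rewrite ger0_norm//.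
have rcF : right_continuous F.
  move=> x; apply/cvgrPdist_lt => e e0.
  have := rcG x; move/cvgrPdist_lt => /(_ e e0) H.
  near=> y; have xy : x <= y by near: y; exact: nbhs_right_ge.
  have : `|cumul m2 x - cumul m2 y| < e by near: y; exact: H.
  have Fxy : 0 <= F y - F x by rewrite subr_ge0; exact: ndF.
  have Gxy : 0 <= cumul m2 y - cumul m2 x by rewrite subr_ge0; exact: ndG.
  rewrite (distrC (F x)) (distrC (cumul m2 x)) (ger0_norm Fxy) (ger0_norm Gxy).
  by apply: le_lt_trans; exact: FG.
pose FM := isCumulative.Build R _ R F ndF rcF.
pose F' : cumulative R R := HB.pack F FM.
pose GM := isCumulative.Build R _ R (cumul m2) ndG rcG.
pose G' : cumulative R R := HB.pack (cumul m2) GM.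
pose nu := lebesgue_stieltjes_measure F'.
have nuG A : measurable A -> (nu A <= \int[leb]_(x in A) (m2 x)%:E)%E.
  move=> mA; rewrite -(@lebesgue_stieltjes_cumul m2 G')//.
  exact: lebesgue_stieltjes_le.
have nufin : fin_num_fun nu.
  move=> A mA; rewrite ge0_fin_numE//; apply: (le_lt_trans (nuG _ mA)).
  have : leb.-integrable A (EFin \o m2) by exact: integrable_sub.
  move=> /integrableP[_]; apply: le_lt_trans.
  by under [leRHS]eq_integral do rewrite gee0_abs ?lee_fin//.
pose nuM := @Measure_isFinite.Build _ (measurableTypeR R) R nu nufin.
pose nu' : {finite_measure set (measurableTypeR R) -> \bar R} := HB.pack nu nuM.
have nuleb : nu' `<< leb.
  move=> A A0 B mB BA; apply/eqP; rewrite eq_le measure_ge0 andbT.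
  apply: (le_trans (nuG _ mB)); rewrite null_set_integral//.
    by apply: measurable_funTS; case/integrableP: Im2.
  exact: A0.
have [g [g0 gfin Ig nug]] := radon_nikodym_sigma_finite nuleb.
pose g' x := fine (g x) - m x.
have Ig1 : leb.-integrable setT (EFin \o (fine \o g)).
  by rewrite (_ : EFin \o _ = g)//; apply/funext => x /=; rewrite fineK.
exists g'; split.
  rewrite (_ : EFin \o g' = fun x => ((EFin \o (fine \o g)) x - (EFin \o m) x)%E)//.
  exact: integrableB.
move=> s t st; apply: EFin_inj; rewrite -cumul_itv_oc//; last first.
  rewrite (_ : EFin \o g' = fun x => ((EFin \o (fine \o g)) x - (EFin \o m) x)%E)//.
  exact: integrableB.
under eq_integral do rewrite EFinB.
rewrite integralB//; [|exact: integrable_sub|exact: integrable_sub].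
under eq_integral do rewrite fineK//.
rewrite (cumul_itv_oc Im st).
have := nug `]s, t]%classic (measurable_itv _).
rewrite [LHS](lebesgue_stieltjes_itv F' st)/= => <-.
by rewrite -EFinB /F; congr EFin; lra.
Unshelve. all: by end_near. Qed.

(* The speed of a curve w.r.t. a pseudo-distance [w] on the parameters: it is the supremum over
   rational r of the absolute derivatives of [w ^~ r], each of which is a Lebesgue density. *)
Section metric_speed.
Variables (m : R -> R) (w : R -> R -> R).
Hypotheses (Im : leb.-integrable setT (EFin \o m)) (m0 : forall x, 0 <= m x).
Hypotheses (wC : forall s t, w s t = w t s)
  (wD : forall r s t, w s t <= w s r + w r t)
  (wm : forall s t, s <= t -> w s t <= cumul m t - cumul m s).

Let r_ (n : nat) : R := if @unpickle rat n is Some q then ratr q else 0.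

Let wr n s t : s <= t -> `|w t (r_ n) - w s (r_ n)| <= w s t.
Proof.
move=> st; rewrite ler_norml; apply/andP; split.
  have := wD t s (r_ n); lra.
have := wD s t (r_ n); rewrite (wC t s); lra.
Qed.

Lemma measurable_EFin_integrable (f : R -> R) : leb.-integrable setT (EFin \o f) ->
  measurable_fun setT f.
Proof. by case/integrableP => /measurable_EFinP. Qed.

Lemma metric_speed : exists v : R -> R, [/\ measurable_fun setT v,
   forall x, 0 <= v x <= m x, leb.-integrable setT (EFin \o v),
   forall s t, s <= t -> w s t <= cumul v t - cumul v s &
   {ae leb, forall t, w (t + h) t / `|h| @[h --> 0^'] --> v t}].
Proof.
have /choice[g Hg] : forall n, exists g : R -> R, leb.-integrable setT (EFin \o g) /\
    forall s t, s <= t -> w t (r_ n) - w s (r_ n) = cumul g t - cumul g s.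
  move=> n; apply: (@ac_density m (fun t => w t (r_ n))) => // s t st.
  exact: (le_trans (wr n st) (wm st)).
have Ig n : leb.-integrable setT (EFin \o g n) by have [] := Hg n.
have mg n : measurable_fun setT (g n) by apply: measurable_EFin_integrable.
have mm := measurable_EFin_integrable Im.
(* Values above [m] are replaced by [0], so that the supremum [v] is bounded by [m] at every point;
   almost everywhere this changes nothing, by [gm]. *)
pose k n t := if `|g n t| <= m t then `|g n t| else 0.
have mk n : measurable_fun setT (k n).
  apply: measurable_fun_ifT => //.
    by apply: measurable_fun_ler => //; exact: measurableT_comp.
  exact: measurableT_comp.
have k0 n t : 0 <= k n t by rewrite /k; case: ifP.
have km n t : k n t <= m t by rewrite /k; case: ifP.
pose v t := sups (k ^~ t) 0.
have ub t : has_ubound (range (k ^~ t)) by exists (m t) => _ [n _ <-].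
have ss t : has_sup [set k n t | n in [set n | (0 <= n)%N]].
  by split; [exists (k 0%N t); exists 0%N|exists (m t) => _ [n _ <-]].
have kv n t : k n t <= v t by apply: ub_le_sup; [by case: (ss t)|exists n].
have vm t : v t <= m t.
  by apply: sup_le_ub => [|_ [n _ <-]//]; case: (ss t).
have v0 t : 0 <= v t by apply: le_trans (kv 0%N t).
have mv : measurable_fun setT v by apply: measurable_fun_sups.
have Iv : leb.-integrable setT (EFin \o v).
  apply: (le_integrable measurableT _ _ Im); first exact/measurable_EFinP.
  by move=> t _ /=; rewrite lee_fin !ger0_norm.
have aeg : {ae leb, forall t n,
  h^-1 * (cumul (g n) (t + h) - cumul (g n) t) @[h --> 0^'] --> g n t}.
  by apply/ae_foralln => n; exact: ae_cumul_derive.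
have wabs t h n : `|cumul (g n) (t + h) - cumul (g n) t| = `|w (t + h) (r_ n) - w t (r_ n)|.
  have [h0|h0] := leP 0 h.
    by have [_ ->] := Hg n; rewrite ?lerDl.
  rewrite distrC [RHS]distrC; have [_ H] := Hg n; rewrite H//.
  by rewrite gerDl ltW.
have wle t h n : `|w (t + h) (r_ n) - w t (r_ n)| <= w (t + h) t.
  have [h0|h0] := leP 0 h.
    by rewrite (wC _ t); apply: wr; rewrite lerDl.
  by rewrite distrC; apply: wr; rewrite gerDl ltW.
have cumle (f : R -> R) t h : leb.-integrable setT (EFin \o f) ->
    (forall s t, s <= t -> w s t <= cumul f t - cumul f s) ->
    w (t + h) t <= `|cumul f (t + h) - cumul f t|.
  move=> If wf; have [h0|h0] := leP 0 h.
    by rewrite (wC _ t) (le_trans (wf t (t + h) _))// ?lerDl// ler_norm.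
  have th : t + h <= t by rewrite gerDl ltW.
  by rewrite distrC (le_trans (wf _ _ th))// ler_norm.
have cvq (f : R -> R) t l : h^-1 * (f (t + h) - f t) @[h --> 0^'] --> l ->
    `|f (t + h) - f t| / `|h| @[h --> 0^'] --> `|l|.
  move=> fl; rewrite (_ : (fun h => _) = (fun h => `|h^-1 * (f (t + h) - f t)|)).
    exact: cvg_norm fl.
  by apply/funext => h; rewrite normrM normfV mulrC.
have lims t : (forall n, h^-1 * (cumul (g n) (t + h) - cumul (g n) t) @[h --> 0^'] --> g n t) ->
    forall n, `|cumul (g n) (t + h) - cumul (g n) t| / `|h| @[h --> 0^'] --> `|g n t|.
  by move=> H n; exact: cvq.
have FF : Filter (nbhs (almost_everywhere leb)) by exact: ae_filter_ringOfSetsType.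
have gm : {ae leb, forall t n, `|g n t| <= m t}.
  apply: filterS2 aeg (ae_cumul_derive Im) => t gt mt n.
  have h1 := lims _ gt n.
  have h2 : `|cumul m (t + h) - cumul m t| / `|h| @[h --> 0^'] --> m t.
    by rewrite -(ger0_norm (m0 t)); exact: cvq.
  apply: ler_cvg_to h1 h2 _; apply: nearW => h.
  rewrite ler_wpM2r ?invr_ge0// wabs; apply: (le_trans (wle _ _ _)).
  exact: cumle.
have kg : {ae leb, forall t n, k n t = `|g n t|}.
  by apply: filterS gm => t H n; rewrite /k H.
have wv s t : s <= t -> w s t <= cumul v t - cumul v s.
  move=> st; apply/ler_addgt0Pr => e e0.
  have [d [d0 H]] := integral_normr_continuous Im (divr_gt0 e0 (ltr0Sn R 1)).
  (* For a rational time just after [s] the distance [w s (r_ n)] is small, and the triangle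
     inequality through [r_ n] compares [w s t] with the increment of the distance to [r_ n]. *)
  have [q] := rat_in_itvoo (ltr_pwDr d0 (lexx s)); rewrite in_itv/= => /andP[sq qd].
  pose n := pickle q; have rn : r_ n = ratr q by rewrite /r_ pickleK.
  have wsq : w s (r_ n) <= e / 2.
    rewrite rn; apply: (le_trans (wm (ltW sq))); rewrite -lee_fin -cumul_itv_oc//;
      last exact: ltW.
    have lsq : (leb (`]s, ratr q]%classic : set R) < d%:E)%E.
      rewrite lebesgue_measure_itv/= lte_fin sq -EFinB lte_fin; move: qd; lra.
    have /ltW := H _ (measurable_itv `]s, ratr q]) lsq; rewrite -lee_fin; apply: le_trans.
    rewrite /Rintegral fineK; last first.
      apply: integrable_fin_num => //; apply: (integrableS measurableT) => //.
      exact: integrable_norm.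
    by under [leRHS]eq_integral do rewrite ger0_norm//.
  have h1 : w s t <= `|w t (r_ n) - w s (r_ n)| + 2 * w s (r_ n).
    have := wD (r_ n) s t; rewrite (wC (r_ n) t).
    have := ler_norm (w t (r_ n) - w s (r_ n)); lra.
  have h2 : `|w t (r_ n) - w s (r_ n)| <= cumul v t - cumul v s.
    have [_ ->//] := Hg n; rewrite -lee_fin -[X in (_ <= X)%E]cumul_itv_oc//.
    rewrite -abse_EFin -cumul_itv_oc//.
    apply: (le_trans (le_abse_integral _ _ _)) => //.
      by apply/measurable_EFinP; apply: measurable_funTS; exact: mg.
    apply: ae_ge0_le_integral => //.
    - by apply: measurableT_comp => //; apply/measurable_EFinP; apply: measurable_funTS;
      exact: mg.
    - by move=> x _; rewrite lee_fin.
    - by apply/measurable_EFinP; apply: measurable_funTS; exact: mv.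
    - by apply: filterS kg => x kx _; rewrite /= lee_fin -kx.
  lra.
exists v; split => //; first by move=> x; rewrite v0 vm.
(* The quotient is squeezed: above by that of [cumul v], which tends to [v t], and below by that of
   the distance to one [r_ n] whose derivative nearly attains the supremum [v t]. *)
apply: filterS3 aeg kg (ae_cumul_derive Iv) => t gt kt vt.
apply/cvgrPdist_le => e e0.
have h2 : `|cumul v (t + h) - cumul v t| / `|h| @[h --> 0^'] --> v t.
  by rewrite -(ger0_norm (v0 t)); exact: cvq.
have e20 : 0 < e / 2 by rewrite divr_gt0.
have [_ [n _ <-] vn] := sup_adherent e20 (ss t).
have h1 := lims _ gt n.
move/cvgrPdist_le : h1 => /(_ _ e20) h1; move/cvgrPdist_le : h2 => /(_ _ e20) h2.
near=> h.
have H1 : `| `|g n t| - `|cumul (g n) (t + h) - cumul (g n) t| / `|h| | <= e / 2.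
  by near: h; exact: h1.
have H2 : `|v t - `|cumul v (t + h) - cumul v t| / `|h| | <= e / 2.
  by near: h; exact: h2.
have H3 : w (t + h) t / `|h| <= `|cumul v (t + h) - cumul v t| / `|h|.
  by rewrite ler_wpM2r ?invr_ge0//; exact: cumle.
have H4 : `|cumul (g n) (t + h) - cumul (g n) t| / `|h| <= w (t + h) t / `|h|.
  by rewrite ler_wpM2r ?invr_ge0// wabs; exact: wle.
have vn' : v t - e / 2 < `|g n t| by rewrite -kt.
move: H1 H2; rewrite !ler_norml => /andP[_ H1] /andP[H2 _].
by apply/andP; split; lra.
Unshelve. all: by end_near. Qed.

End metric_speed.
End absolutely_continuous.

(** * Integrals of functions not known to be measurable *)

Section null_sets.
Context d (T : measurableType d) (R : realType) (mu : {measure set T -> \bar R}).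
Local Open Scope ereal_scope.
Import HBNNSimple.

(** The integral of a nonnegative function is a supremum over the simple functions below it, and a
    simple function below [f] is below [g] once it is set to zero on [N]. This argument is open to
    integrands built from [metric_derivative]. *)
Lemma ge0_le_integral_null (f g : T -> \bar R) (N : set T) : measurable N -> mu N = 0 ->
  (forall x, 0 <= f x) -> (forall x, 0 <= g x) -> (forall x, ~ N x -> f x <= g x) ->
  \int[mu]_x f x <= \int[mu]_x g x.
Proof.
move=> mN N0 f0 g0 fg; rewrite !ge0_integralTE//.
apply: ge_ereal_sup => _ [h hf <-].
pose h' := mul_nnsfun h (indic_nnsfun R (measurableC mN)).
apply: le_ereal_sup_tmp; exists (sintegral mu h').
  exists h' => // x; have -> : h' x = (h x * \1_(~` N) x)%R by [].
  rewrite indicE; have [Nx|Nx] := pselect (N x).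
    by rewrite memNset ?mulr0//; exact.
  by rewrite mem_set ?mulr1//=; exact: le_trans (hf x) (fg x Nx).
rewrite -!integralT_nnsfun le_eqVlt; apply/orP; left; apply/eqP.
apply: ae_eq_integral => //.
- by apply/measurable_EFinP; exact: measurable_funP.
- by apply/measurable_EFinP; exact: (measurable_funP h').
- exists N; split => // x /= H; apply: contrapT => Nx; apply: H => _.
  change ((h x)%:E = (h x * \1_(~` N) x)%:E)%R.
  by rewrite indicE mem_set ?mulr1.
Qed.

Lemma ge0_le_integral_of_le (D : set T) (f g : T -> \bar R) : (forall x, D x -> 0 <= f x) ->
  (forall x, D x -> f x <= g x) -> \int[mu]_(x in D) f x <= \int[mu]_(x in D) g x.
Proof.
move=> f0 fg; rewrite integral_mkcond [leRHS]integral_mkcond.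
apply: (@ge0_le_integral_null _ _ set0) => // [x|x|x _]; rewrite !patchE;
  case: ifPn => // /set_mem Dx.
- exact: f0.
- by rewrite (le_trans (f0 _ Dx))// fg.
- exact: fg.
Qed.

Lemma eq_integral_null (D : set T) (f g : T -> \bar R) :
  {ae mu, forall x, D x -> f x = g x} -> \int[mu]_(x in D) f x = \int[mu]_(x in D) g x.
Proof.
move=> [N [mN N0 fgN]].
have fg x : ~ N x -> D x -> f x = g x.
  by move=> Nx; have /contrapT : ~ ~ (D x -> f x = g x) by move=> H; apply: Nx; exact: fgN.
have fg' x : ~ N x -> (f \_ D) x = (g \_ D) x.
  by move=> /fg Nx; rewrite /patch; case: ifPn => // /set_mem /Nx.
rewrite integral_mkcond [RHS]integral_mkcond integralE [RHS]integralE.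
congr (_ - _); apply/eqP; rewrite eq_le; apply/andP; split;
  apply: (@ge0_le_integral_null _ _ N) => // x Nx; by rewrite ?funeposE ?funenegE fg'.
Qed.

End null_sets.

(** * The speed of a path on the half-line *)

Section path_speed.
Context {R : realType} {d : nat} (p : R) (hp : 1 < p).
Local Notation leb := (@lebesgue_measure R).
Local Notation Tm := (Rd R d * Rd R d)%type.
Implicit Types (s : R -> Mp R d p) (t : R).

Let p0 : 0 < p. Proof. exact: lt_trans hp. Qed.

(** At a positive time the restriction to [0 <= t + h] holds for all small [h], so a two-sided limit
    identifies the [lim] of the definition. *)
Lemma cvg_metric_derivative s t (l : R) : 0 < t ->
  Wp (s (t + h)) (s t) / `|h| @[h --> 0^'] --> l -> metric_derivative s t = l.
Proof.
move=> t0 cl; have near0 : \forall h \near (0 : R)^', 0 <= t + h.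
  exists t => //= h; rewrite /ball_/= sub0r normrN => /ltW ht _.
  by move: ht; rewrite ler_norml => /andP[]; lra.
have PF : ProperFilter (within [set h | 0 <= t + h] (0 : R)^').
  apply: Build_ProperFilter_ex => P H.
  have : \forall h \near (0 : R)^', P h by apply: filterS2 near0 H => h h0; exact.
  exact: filter_ex.
by apply: cvg_lim => //; exact: cvg_within_filter.
Qed.

Lemma Lploc_integrable m T : Lploc p m -> 0 < T -> leb.-integrable `[0, T] (EFin \o m).
Proof.
move=> [mm mL] T0; have mI : measurable (`[0%R, T]%classic : set R) by exact: measurable_itv.
have mmT : measurable_fun `[0, T] m.
  by apply: measurable_funS mm => //; apply: subset_itvl; rewrite bnd_simp.
have I1 : leb.-integrable `[0, T] (fun t => (1 + `|m t| `^ p)%:E).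
  rewrite (_ : (fun t => _) = (fun t => (1 + (`|m t| `^ p)%:E)%E)); last by apply/funext => t;
    rewrite EFinD.
  apply: integrableD => //.
    apply/integrableP; split; first exact: measurable_cst.
    under eq_integral do rewrite /= normr1.
    by rewrite integral_cst//= lebesgue_measure_itv/= lte_fin T0 mul1e -EFinB ltey.
  apply/integrableP; split.
    by apply/measurable_EFinP; apply: (measurableT_comp (measurable_powR p));
      exact: measurableT_comp.
  under eq_integral do rewrite /= ger0_norm ?powR_ge0//.
  exact: mL.
apply: (le_integrable _ _ _ I1) => //; first exact/measurable_EFinP.
move=> t _ /=; rewrite lee_fin [leRHS]ger0_norm ?addr_ge0 ?powR_ge0//.
have [m1|m1] := leP `|m t| 1; first by rewrite (le_trans m1)// lerDl powR_ge0.
by rewrite (le_trans (le1r_powR (ltW m1) (ltW hp)))// lerDr.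
Qed.

Section clamped.
Variables (s : R -> Mp R d p) (m : R -> R) (mL : Lploc p m).
Hypothesis sm : forall r t, 0 <= r -> r <= t ->
  ((Wp (s r) (s t))%:E <= \int[leb]_(x in `[r, t]) (m x)%:E)%E.
Variables (T : R) (T0 : 0 < T).

(** The path is frozen outside [[0, T]]. It becomes a curve on the whole line with a speed bound
    [m0] that is integrable there, the setting of [metric_speed]. *)
Let cl t := Num.min (Num.max t 0) T.

Let cl0 t : 0 <= cl t. Proof. by rewrite /cl le_min le_max lexx orbT ltW. Qed.

Let clid t : 0 <= t -> t <= T -> cl t = t.
Proof. by move=> t0 tT; rewrite /cl max_l// min_l. Qed.

Let m0 t := if (0 <= t <= T) then `|m t| else 0.

Let m0_patch : EFin \o m0 = (fun t => `|(m t)%:E|%E) \_ (`[0, T]%classic : set R).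
Proof.
apply/funext => t; rewrite /patch /m0/=; case: ifPn => h.
  by rewrite mem_set//= in_itv/= h.
by rewrite memNset//= in_itv/=; exact/negP.
Qed.

Let Im0 : leb.-integrable setT (EFin \o m0).
Proof.
rewrite m0_patch; apply/integrable_restrict => //; rewrite setTI.
exact/integrable_abse/Lploc_integrable.
Qed.

Let m00 t : 0 <= m0 t. Proof. by rewrite /m0; case: ifP. Qed.

Let w r t := Wp (s (cl r)) (s (cl t)).

Let wm r t : r <= t -> w r t <= cumul m0 t - cumul m0 r.
Proof.
move=> rt; have clrt : cl r <= cl t.
  by rewrite /cl le_min ge_min ge_min lexx !orbT/= ge_max !le_max rt lexx !orbT.
have cum0 : 0 <= cumul m0 t - cumul m0 r.
  by rewrite -lee_fin -cumul_itv//; apply: integral_ge0 => x _; rewrite lee_fin.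
have [e|ne] := eqVneq (cl r) (cl t); first by rewrite /w e Wpxx.
have sub : `[cl r, cl t]%classic `<=` (`[r, t]%classic `&` `[0, T]%classic : set R).
  have r1 : r <= cl r.
    rewrite /cl le_min le_max lexx/= leNgt; apply/negP => Tr; move/eqP: ne; apply.
    by rewrite /cl !min_r// le_max ?(ltW Tr)// (le_trans (ltW Tr)).
  have t1 : cl t <= t.
    rewrite /cl ge_min; apply/orP; left; rewrite ge_max lexx/= leNgt; apply/negP => t0.
    by move/eqP: ne; apply; rewrite /cl !max_r// ltW// (le_lt_trans rt).
  have tT : cl t <= T by rewrite /cl ge_min lexx orbT.
  move=> x /=; rewrite !in_itv/= => /andP[x1 x2].
  rewrite (le_trans r1 x1) (le_trans x2 t1) (le_trans (cl0 r) x1).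
  by rewrite (le_trans x2 tT).
have Im : leb.-integrable `[cl r, cl t] (EFin \o m).
  apply: (integrableS _ _ _ (Lploc_integrable mL T0)) => //.
  by move=> x /sub[].
rewrite -lee_fin -cumul_itv//; apply: (le_trans (sm (cl0 r) clrt)).
apply: (@le_trans _ _ (\int[leb]_(x in `[cl r, cl t]) (m0 x)%:E)%E).
  apply: (le_trans (lee_abs _)); apply: (le_trans (le_abse_integral _ _ _)) => //.
    by case/integrableP : Im.
  rewrite le_eqVlt; apply/orP; left; apply/eqP; apply: eq_integral => x.
  rewrite inE => /sub[_ /=]; rewrite in_itv/= /m0 => -> //.
apply: ge0_subset_integral => //.
- by case/integrableP: (integrable_sub Im0 (measurable_itv `[r, t])).
- by move=> x _; rewrite lee_fin.
- by move=> x /sub[].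
Qed.

Lemma clamped_speed : exists v : R -> R, [/\ measurable_fun setT v,
  forall t, 0 <= v t <= `|m t|,
  (forall r t, 0 <= r -> r <= t -> t <= T ->
    ((Wp (s r) (s t))%:E <= \int[leb]_(x in `[r, t]) (v x)%:E)%E) &
  {ae leb, forall t, 0 < t < T -> metric_derivative s t = v t}].
Proof.
have [||v [mv vm Iv wv aev]] := @metric_speed R m0 w Im0 m00 _ _ wm.
- by move=> r t; rewrite /w WpC.
- by move=> r t u; exact: Wp_triangle.
have FF : Filter (nbhs (almost_everywhere leb)) by exact: ae_filter_ringOfSetsType.
exists v; split => //.
- move=> t; have /andP[-> h] := vm t; rewrite (le_trans h)// /m0; case: ifP => //.
- move=> r t r0 rt tT; rewrite cumul_itv// lee_fin.
  have := wv r t rt; rewrite /w !clid// ?(le_trans rt)// (le_trans r0)//.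
- apply: filterS aev => t vt /andP[t0 tT]; apply: cvg_metric_derivative => //.
  move: vt; apply: cvg_trans; apply: near_eq_cvg.
  have e0 : 0 < Num.min t (T - t) by rewrite lt_min t0 subr_gt0.
  exists (Num.min t (T - t)) => //= h; rewrite /ball_/= sub0r normrN lt_min => /andP[h1 h2] _.
  move: h1 h2; rewrite !ltr_norml => /andP[h1 h1'] /andP[h2 h2'].
  by rewrite /w !clid//; lra.
Qed.

End clamped.

Lemma ae_neq0 : {ae leb, forall t : R, t != 0}.
Proof.
exists [set 0]; split; [exact: measurable_set1|exact: lebesgue_measure_set1|].
by move=> t /= /negP; rewrite negbK => /eqP.
Qed.

Lemma path_speed s m : Lploc p m ->
  (forall r t, 0 <= r -> r <= t -> ((Wp (s r) (s t))%:E <= \int[leb]_(x in `[r,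
    t]) (m x)%:E)%E) ->
  exists v : R -> R, [/\ measurable_fun setT v, forall t, 0 <= v t <= `|m t|,
  (forall r t, 0 <= r -> r <= t -> ((Wp (s r) (s t))%:E <= \int[leb]_(x in `[r, t]) (v x)%:E)%E) &
  {ae leb, forall t, 0 < t -> metric_derivative s t = v t}].
Proof.
move=> mL sm.
have /choice[u Hu] : forall n : nat, exists v : R -> R, [/\ measurable_fun setT v,
    forall t, 0 <= v t <= `|m t|,
    (forall r t, 0 <= r -> r <= t -> t <= n.+1%:R ->
      ((Wp (s r) (s t))%:E <= \int[leb]_(x in `[r, t]) (v x)%:E)%E) &
    {ae leb, forall t, 0 < t < n.+1%:R -> metric_derivative s t = v t}].
  by move=> n; exact: (clamped_speed mL sm (ltr0Sn R n)).
have FF : Filter (nbhs (almost_everywhere leb)) by exact: ae_filter_ringOfSetsType.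
(* Each [u n] is the metric derivative almost everywhere on []0, n.+1[], so the speeds for different
   [n] agree there and can be pasted over unit intervals. *)
pose v t := u (Num.trunc t) t.
have aeu : {ae leb, forall t n, 0 < t < n.+1%:R -> metric_derivative s t = u n t}.
  by apply/ae_foralln => n; have [] := Hu n.
exists v; split.
- have mE n : measurable ([set t : R | Num.trunc t = n] : set R).
    case: n => [|n].
      rewrite (_ : mkset _ = `]-oo, 1[%classic); first exact: measurable_itv.
      apply/seteqP; split => t /=; rewrite in_itv/=.
        by move=> h; have := truncnS_gt t; rewrite h.
      move=> t1; apply/eqP; rewrite -leqn0 truncn_le_nat//.
    rewrite (_ : mkset _ = `[n.+1%:R, n.+2%:R[%classic); first exact: measurable_itv.
    apply/seteqP; split => t /=; rewrite in_itv/=.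
      move=> h; have t0 : 0 <= t.
        by rewrite leNgt; apply/negP => t0; move: h; rewrite truncn_floor leNgt t0.
      by have := truncn_itv t0; rewrite h.
    exact: truncn_def.
  rewrite (_ : setT = \bigcup_n [set t : R | Num.trunc t = n]); last first.
    by apply/seteqP; split => // t _; exists (Num.trunc t).
  apply/measurable_fun_bigcup => // n.
  apply: (eq_measurable_fun (u n)).
    by move=> t; rewrite inE /v => /= ->.
  by apply: measurable_funTS; have [] := Hu n.
- by move=> t; rewrite /v; have [_ + _ _] := Hu (Num.trunc t); exact.
- move=> r t r0 rt; have [_ _ + _] := Hu (Num.trunc t).
  move=> /(_ r t r0 rt) /(_ (ltW (truncnS_gt _)))/le_trans; apply.
  rewrite le_eqVlt; apply/orP; left; apply/eqP; apply: eq_integral_null.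
  apply: filterS2 aeu ae_neq0 => x xu x0; rewrite /= in_itv/= => /andP[rx xt].
  have {}x0 : 0 < x by rewrite lt_neqAle eq_sym x0 (le_trans r0).
  congr EFin; rewrite /v -xu; last by rewrite x0 (le_lt_trans xt)// truncnS_gt.
  by rewrite -xu// x0 truncnS_gt.
- by apply: filterS aeu => t tu t0; rewrite /v -tu// t0 truncnS_gt.
Qed.

End path_speed.

(** * Displacement along a vector field *)

Section integral_law.
Context d d' (T : measurableType d) (T' : measurableType d') (R : realType).

Lemma integral_of_law (P : probability T R) (Q : probability T' R) X : measurable_fun setT X ->
  (forall A, measurable A -> P (X @^-1` A) = Q A) ->
  forall f : T' -> R, measurable_fun setT f -> P.-integrable setT (fun x => (f (X x))%:E) ->
  (\int[P]_x (f (X x))%:E = \int[Q]_y (f y)%:E)%E.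
Proof.
move=> mX PQ f mf If.
have mf' : measurable_fun setT (EFin \o f) by exact/measurable_EFinP.
have := integral_pushforward mX mf' (mu := P) (D := setT) If measurableT.
rewrite preimage_setT => <-.
apply: (@eq_measure_integral _ _ _ _ Q (pushforward P X)) => A mA _; exact: PQ.
Qed.

End integral_law.

Section displacement.
Context {R : realType} {d : nat} (p : R) (hp : 1 < p).
Local Notation Tm := (Rd R d * Rd R d)%type.
Implicit Types (mu nu : Mp R d p) (pi : probability Tm R).

Let p0 : 0 < p. Proof. exact: lt_trans hp. Qed.
Let p1 : 1 <= p. Proof. exact: ltW. Qed.

Definition cost pi : R := fine (transport_cost p pi).

Lemma cost_ge0 pi : 0 <= cost pi. Proof. exact/fine_ge0/poweR_ge0. Qed.

Lemma costE mu nu pi : couplings mu nu pi -> (cost pi)%:E = transport_cost p pi.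
Proof. by move=> c; rewrite fineK// (transport_cost_fin hp c). Qed.

Lemma Wp_attained mu nu : exists2 pi, opt_couplings mu nu pi & cost pi = Wp mu nu.
Proof.
have [pi [c1 c2]] := opt_couplings_nonempty hp mu nu; exists pi => //.
by rewrite /cost c2 -(WpE hp).
Qed.

Section displace.
Context d' (T : measurableType d') (P : probability T R) (X Y : T -> Rd R d).
Hypotheses (mX : measurable_fun setT X) (mY : measurable_fun setT Y).
Hypotheses (Xp : (Lnorm P p%:E (fun t => (enorm (X t))%:E) < +oo)%E)
           (Yp : (Lnorm P p%:E (fun t => (enorm (Y t))%:E) < +oo)%E).

Definition displaced (t : R) (x : T) : Rd R d := (X x : 'rV[R]_d) + t *: (Y x : 'rV[R]_d).

Lemma measurable_displaced t : measurable_fun setT (displaced t).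
Proof. by apply: measurable_fun_RdD => //; exact: measurable_fun_RdZ. Qed.

Lemma Lnorm_scale (c : R) (f : T -> R) : measurable_fun setT f -> (forall x, 0 <= f x) ->
  0 <= c ->
  (Lnorm P p%:E (EFin \o (fun x => c * f x)%R) = c%:E * Lnorm P p%:E (EFin \o f))%E.
Proof.
move=> mf f0 c0; rewrite (Lnorm_EFin _ _ (fun x => mulr_ge0 c0 (f0 x))) (Lnorm_EFin _ _ f0).
under eq_integral do rewrite powRM// EFinM.
rewrite ge0_integralZl//; last 3 first.
- by apply/measurable_EFinP; exact: (measurableT_comp (measurable_powR p)).
- by move=> x _; rewrite lee_fin powR_ge0.
- by rewrite lee_fin powR_ge0.
rewrite poweRM; last 2 first.
- by rewrite lee_fin powR_ge0.
- by apply: integral_ge0 => x _; rewrite lee_fin powR_ge0.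
by rewrite poweR_EFin -powRrM mulfV ?gt_eqF// powRr1.
Qed.

Lemma displaced_moment t : (Lnorm P p%:E (fun x => (enorm (displaced t x))%:E) < +oo)%E.
Proof.
have mx := measurable_fun_enorm mX; have my := measurable_fun_enorm mY.
have mty : measurable_fun setT (fun x => `|t| * enorm (Y x)) by exact: measurable_funM.
have h : (Lnorm P p%:E (EFin \o (fun x : T => (`|t| * enorm (Y x))%R)) < +oo)%E.
  rewrite Lnorm_scale// ?lte_mul_pinfty//; last by move=> ?; exact: enorm_ge0.
apply: le_lt_trans (lte_add_pinfty Xp h).
apply: le_trans (minkowski_EFin P mx mty p1).
apply: le_Lnorm => //.
- exact/measurable_fun_enorm/measurable_displaced.
- exact: measurable_funD.
- by move=> ?; exact: enorm_ge0.
- by move=> x; rewrite /= -enormZ enormD.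
Qed.

Lemma Lnorm_displaced s t : Lnorm P p%:E
    (fun x => (enorm ((displaced s x : 'rV[R]_d) - displaced t x))%:E) =
  (`|t - s|%:E * Lnorm P p%:E (fun x => (enorm (Y x))%:E))%E.
Proof.
rewrite -(Lnorm_scale (measurable_fun_enorm mY))//; last by move=> ?; exact: enorm_ge0.
apply: eq_Lnorm => x /=; rewrite -enormZ -enormN; congr (enorm _)%:E.
by rewrite /displaced opprB opprD addrACA subrr add0r -scalerBl.
Qed.

(** A relation rather than a function of [t]: a given element of [Mp] can then be recognized as the
    displaced law at a given time. *)
Definition displaced_law t nu :=
  forall A : set (Rd R d), measurable A -> P (displaced t @^-1` A) = nu A.

Lemma displaced_law_exists t : exists nu : Mp R d p, displaced_law t nu.
Proof.
have mt := measurable_displaced t.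
have mom : (\int[law P mt]_x (enorm x `^ p)%:E < +oo)%E.
  rewrite ge0_integral_law; last 2 first.
  - by apply/measurable_EFinP; apply: (measurableT_comp (measurable_powR p));
    exact: measurable_enorm.
  - by move=> x; rewrite lee_fin powR_ge0.
  rewrite (Lnorm_lty P (f := fun x => enorm (displaced t x)))//; last by move=> ?;
    exact: enorm_ge0.
  exact: displaced_moment.
by exists (MkMp mom).
Qed.

Lemma Wp_displaced s t mu nu : displaced_law s mu -> displaced_law t nu ->
  Wp mu nu <= `|t - s| * fine (Lnorm P p%:E (fun x => (enorm (Y x))%:E)).
Proof.
move=> smu tnu.
have NE : (fine (Lnorm P p%:E (fun x => (enorm (Y x))%:E)))%:E = Lnorm P p%:E (fun x =>
  (enorm (Y x))%:E).
  by rewrite fineK// ge0_fin_numE// Lnorm_ge0.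
rewrite -lee_fin (EFinM `|t - s|) NE -Lnorm_displaced.
by apply: Wp_le_Lnorm => //; exact: measurable_displaced.
Qed.

Lemma displaced0 : displaced 0 = X.
Proof. by apply/funext => x; rewrite /displaced scale0r addr0. Qed.

(** Elements of [Mp] are records, so equal laws do not make equal elements. The prescribed [mu] and
    [nu] are put at times [0] and [h], where paths are joined by genuine equalities. *)
Lemma displaced_path mu nu (h : R) : h != 0 -> displaced_law 0 mu -> displaced_law h nu ->
  exists g : R -> Mp R d p, [/\ g 0 = mu, g h = nu, (forall t, displaced_law t (g t)) &
    forall s t, Wp (g s) (g t) <= `|t - s| * fine (Lnorm P p%:E (fun x => (enorm (Y x))%:E))].
Proof.
move=> h0 mu0 nuh.
have /choice[g0 Hg] := displaced_law_exists.
pose g t := if t == 0 then mu else if t == h then nu else g0 t.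
have gE t : displaced_law t (g t).
  by rewrite /g; case: eqVneq => [->//|_]; case: eqVneq => [->//|_].
exists g; split => //.
- by rewrite /g eqxx.
- by rewrite /g eqxx (negbTE h0).
- by move=> s t; apply: Wp_displaced.
Qed.

End displace.

(** Under an optimal coupling, mass is displaced along [(y - x) / h]; the speed is the optimal cost
    divided by [h]. *)
Lemma displacement_interpolation mu nu (h : R) : 0 < h -> exists g : R -> Mp R d p,
  [/\ g 0 = mu, g h = nu & forall s t, Wp (g s) (g t) <= `|t - s| * (Wp mu nu / h)].
Proof.
move=> h0; have [pi opt cW] := Wp_attained mu nu; have [cpi _] := opt.
have [_ pmu pnu] := cpi.
have mY : measurable_fun [set: Tm] (fun z => h^-1 *: ((z.2 : 'rV[R]_d) - z.1) : Rd R d).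
  by apply: measurable_fun_RdZ => //; exact: measurable_fun_RdB.
have mXp : (Lnorm pi p%:E (fun z => (enorm z.1)%:E) < +oo)%E.
  by rewrite (Lnorm_fst cpi p measurable_enorm) Mp_Lnorm.
have YE : Lnorm pi p%:E (fun z =>
  (enorm (h^-1 *: ((z.2 : 'rV[R]_d) - z.1)))%:E) = (Wp mu nu / h)%:E.
  rewrite mulrC EFinM -cW (costE cpi) (transport_costE p pi).
  rewrite -(Lnorm_scale pi measurable_fun_dist) ?invr_ge0 ?(ltW h0)//; last by move=> ?;
    exact: enorm_ge0.
  by apply: eq_Lnorm => z /=; rewrite enormZ enormBC gtr0_norm ?invr_gt0.
have Yp : (Lnorm pi p%:E (fun z => (enorm (h^-1 *: ((z.2 : 'rV[R]_d) - z.1)))%:E) < +oo)%E.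
  by rewrite YE ltey.
have [|||g [g0 gh _ gL]] := displaced_path measurable_fst mY mXp Yp (mu := mu) (nu := nu) (h :=
  h).
- by rewrite gt_eqF.
- by rewrite /displaced_law displaced0.
- move=> A mA; rewrite -pnu//; congr (pi (_ @^-1` A)); apply/funext => z.
  by rewrite /displaced scalerA mulfV ?gt_eqF// scale1r addrC subrK.
by exists g; split => // s t; rewrite -[X in _ * X]/(fine (Wp mu nu / h)%:E) -YE.
Qed.

End displacement.

(** * Pairings with cotangent vectors *)

Section test_functions.
Context {R : realType} {d : nat}.
Implicit Types (f psi : 'rV[R]_d -> R) (K : set 'rV[R]_d) (x y : 'rV[R]_d).

Lemma compact_support_bounded f K : compact K -> continuous f -> (forall x, ~ K x -> f x = 0) ->
  exists2 B, 0 <= B & forall x, `|f x| <= B.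
Proof.
move=> cK cf f0.
have /compact_bounded : compact (f @` K).
  by apply: continuous_compact => //; exact: continuous_subspaceT.
move=> [B [_ hB]]; exists (`|B| + 1) => [|x]; first by rewrite addr_ge0.
have [Kx|nK] := pselect (K x); last by rewrite f0// normr0 addr_ge0.
by apply: hB; [rewrite (le_lt_trans (ler_norm _))// ltrDl|exists x].
Qed.

Lemma compact_support_uniform f K (e : R) : compact K -> continuous f -> (forall x, ~ K x ->
  f x = 0) ->
  0 < e -> exists2 r : R, 0 < r & forall x y, ball x r y -> `|f x - f y| <= e.
Proof.
move=> cK cf f0 e0.
pose P (r : R) (x : 'rV[R]_d) := forall y, ball x r y -> `|f x - f y| <= e.
have : \forall r \near (0 : R)^'+, K `<=` P r.
  apply: (proj1 (compact_near_coveringP _) cK) => x Kx.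
  have e2 : 0 < e / 2 by rewrite divr_gt0.
  have [r /= r0 hr] := proj1 (nbhs_ballP _ _) (proj1 (cvgrPdist_lt _ _) (cf x) _ e2).
  have r2 : 0 < r / 2 by rewrite divr_gt0.
  exists (ball x (r / 2), [set s | 0 < s < r / 2]).
    split; first exact: nbhsx_ballx.
    by near=> s; apply/andP; split; near: s; [exact: nbhs_right_gt|exact: nbhs_right_lt].
  move=> [x' s] /= [xx' /andP[s0 sr]] y x'y.
  have h1 : `|f x - f x'| < e / 2 by apply: hr; apply: le_ball xx'; lra.
  have h2 : `|f x - f y| < e / 2.
    apply: hr; rewrite (splitr r); apply: ball_triangle xx' _.
    by apply: le_ball x'y; exact: ltW.
  rewrite (splitr e) (_ : f x' - f y = (f x - f y) - (f x - f x')); last by ring.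
  by rewrite (le_trans (ler_normB _ _))// lerD// ltW.
move=> H.
have [r [hr r0]] : exists r : R, K `<=` P r /\ 0 < r.
  near (0 : R)^'+ => r; exists r; split; near: r => //; exact: nbhs_right_gt.
exists r => // x y xy.
have [Kx|nKx] := pselect (K x); first exact: hr.
have [Ky|nKy] := pselect (K y); first by rewrite distrC; apply: hr => //; exact: ball_sym.
by rewrite !f0// subrr normr0 ltW.
Unshelve. all: by end_near. Qed.

Lemma partial_support psi i x : ~ closure [set x | psi x != 0] x -> 'D_(ebasis i) psi x = 0.
Proof.
move=> nx.
have : nbhs x (~` closure [set x | psi x != 0]).
  by apply: open_nbhs_nbhs; split => //; apply: closed_openC; exact: closed_closure.
move=> Hx; rewrite (@near_eq_derive _ _ _ psi (cst 0)) ?derive_cst//.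
apply: filterS Hx => y /= ny; apply/eqP/negPn/negP => h; apply: ny.
exact: subset_closure.
Qed.

Lemma partial_is_derive psi i x (s : R) : (forall y, derivable psi y (ebasis i)) ->
  is_derive s 1 (fun u => psi (x + u *: ebasis i)) ('D_(ebasis i) psi (x + s *: ebasis i)).
Proof.
move=> dpsi.
have E : (fun h : R => h^-1 *: (((fun u =>
  psi (x + u *: ebasis i)) \o shift s) (h *: (1 : R)) - psi (x + s *: ebasis i))) =
         (fun h : R => h^-1 *: ((psi \o shift (x + s *: ebasis i)) (h *: ebasis i) - psi (x + s
           *: ebasis i))).
  apply/funext => h /=; congr (_ *: (psi _ - _)).
  by rewrite /GRing.scale/= mulr1 -/(GRing.scale _ _) scalerDl addrCA.
by apply: DeriveDef; [rewrite /derivable E; exact: dpsi|rewrite /derive E].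
Qed.

Lemma partial_mvt psi i x (s : R) : (forall y, derivable psi y (ebasis i)) ->
  exists2 c, `|c| <= `|s| & psi (x + s *: ebasis i) - psi x = 'D_(ebasis i) psi (x + c *: ebasis
    i) * s.
Proof.
move=> dpsi; pose g u := psi (x + u *: ebasis i).
have dg (u : R) := partial_is_derive x u dpsi.
have cg (a b : R) : {within `[a, b], continuous g}.
  apply: continuous_subspaceT => u; apply: differentiable_continuous.
  by apply/derivable1_diffP; have [] := dg u.
have g0 : g 0 = psi x by rewrite /g scale0r addr0.
have [s0|s0|->] := ltgtP s 0.
- have [c + h] := MVT s0 (fun u _ => dg u) (cg s 0).
  rewrite in_itv/= => /andP[sc c0]; exists c; first by rewrite !ltr0_norm// lerN2 ltW.
  by rewrite -[LHS]opprB -g0 h sub0r mulrN opprK.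
- have [c + h] := MVT s0 (fun u _ => dg u) (cg 0 s).
  rewrite in_itv/= => /andP[sc c0]; exists c; first by rewrite !gtr0_norm// ltW.
  by rewrite -g0 h subr0.
- by exists 0 => //; rewrite scale0r addr0 subrr mulr0.
Qed.

(** Corners of a path from [x] to [y] parallel to the axes: the first [k] coordinates have already
    moved. *)
Definition mix (x y : 'rV[R]_d) (k : nat) : 'rV[R]_d := \row_j (if (j < k)%N then y 0 j else x 0
  j).

Lemma mixS x y (i : 'I_d) : mix x y i.+1 = mix x y i + (y 0 i - x 0 i) *: ebasis i.
Proof.
apply/rowP => j; rewrite !mxE eqxx/= ltnS leq_eqVlt -val_eqE/= [(j == i :> nat)%N]eq_sym.
have [E|_] /= := eqVneq (i : nat) j; last by rewrite mulr0 addr0.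
by have -> : i = j by [exact: val_inj]; rewrite ltnn mulr1 addrC subrK.
Qed.

(** [test_function] speaks of partial derivatives only, so the first-order expansion uses the mean
    value theorem on each edge of the path [mix x y]. The intermediate points are, in each
    coordinate, no farther from [x] than [y] is. *)
Lemma coordinate_expansion psi x y (w : R) :
  (forall i z, derivable psi z (ebasis i)) ->
  (forall i (z : 'rV[R]_d), (forall j, `|z 0 j - x 0 j| <= `|y 0 j - x 0 j|) ->
    `|'D_(ebasis i) psi z - 'D_(ebasis i) psi x| <= w) ->
  `|psi y - psi x - dot (grad psi x) (y - x)| <= d%:R * w * enorm (y - x).
Proof.
move=> dpsi hw.
have T : psi y - psi x = \sum_(i < d) (psi (mix x y i.+1) - psi (mix x y i)).
  rewrite -(big_mkord xpredT (fun i => psi (mix x y i.+1) - psi (mix x y i))) telescope_sumr//.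
  by congr (psi _ - psi _); apply/rowP => j; rewrite mxE ?ltn_ord.
rewrite T /dot -sumrB; rewrite (le_trans (ler_norm_sum _ _ _))//.
rewrite (@le_trans _ _ (\sum_(i < d) w * enorm (y - x)))//; last first.
  by rewrite sumr_const card_ord -[leLHS]mulr_natl mulrA.
apply: ler_sum => i _.
have [c cy E] := partial_mvt (mix x y i) (y 0 i - x 0 i) (dpsi i).
rewrite mixS E !mxE -mulrBl normrM ler_pM//; last first.
  by rewrite (le_trans _ (coord_le_enorm _ i))// !mxE.
apply: hw => j; rewrite !mxE eqxx/= [j == i]eq_sym.
have [<-|_] /= := eqVneq i j; first by rewrite ltnn mulr1 addrAC subrr add0r.
by rewrite mulr0 addr0; case: ifP => // _; rewrite subrr normr0.
Qed.

(** Two regimes. For close points, uniform continuity of the partial derivatives gives the term with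
    [e]. For [m >= r0], their bound is multiplied by [(m / r0)^(p - 1) >= 1], which produces the
    power [p] that transport costs control. *)
Lemma test_function_expansion psi (p e : R) : 1 < p -> test_function psi -> 0 < e ->
  exists2 C, 0 <= C & forall x y,
  `|psi y - psi x - dot (grad psi x) (y - x)| <= e * enorm (y - x) + C * enorm (y - x) `^ p.
Proof.
move=> p1 [smooth cK] e0.
have dpsi i z : derivable psi z (ebasis i) by have [_] := smooth [::]; apply.
have cD i : continuous ('D_(ebasis i) psi) by have [] := smooth [:: i].
have D0 i x : ~ closure [set x | psi x != 0] x ->
  'D_(ebasis i) psi x = 0 by exact: partial_support.
have /choice[B HB] i : exists B, 0 <= B /\ forall x, `|'D_(ebasis i) psi x| <= B.
  by have [B B0 hB] := compact_support_bounded cK (cD i) (D0 i); exists B.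
pose BB := \sum_i B i.
have BBB i x : `|'D_(ebasis i) psi x| <= BB.
  rewrite (le_trans (proj2 (HB i) x))// /BB (bigD1 i)//= lerDl.
  by apply: sumr_ge0 => j _; have [] := HB j.
have BB0 : 0 <= BB by apply: sumr_ge0 => j _; have [] := HB j.
have e' : 0 < e / d.+1%:R by rewrite divr_gt0.
have /choice[r Hr] i : exists r : R, 0 < r /\ forall x y, ball x r y ->
  `|'D_(ebasis i) psi x - 'D_(ebasis i) psi y| <= e / d.+1%:R.
  by have [r r0 hr] := compact_support_uniform cK (cD i) (D0 i) e'; exists r.
pose r0 := \big[Num.min/1]_i r i.
have r00 : 0 < r0 by apply/bigmin_gtP; split => // i _; have [] := Hr i.
have r0r i : r0 <= r i by exact: bigmin_le_cond.
exists (d%:R * (2 * BB * r0^-1 `^ (p - 1))); first by rewrite !mulr_ge0// powR_ge0.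
move=> x y; set m := enorm (y - x).
have m0 : 0 <= m by exact: enorm_ge0.
pose w := e / d.+1%:R + 2 * BB * (m / r0) `^ (p - 1).
apply: (@le_trans _ _ (d%:R * w * m)).
  apply: coordinate_expansion => // i z zy.
  have w1 : 0 <= 2 * BB * (m / r0) `^ (p - 1) by rewrite !mulr_ge0// powR_ge0.
  have [mr|rm] := ltP m r0.
    apply: (@le_trans _ _ (e / d.+1%:R)); last by rewrite lerDl.
    rewrite distrC; apply: (proj2 (Hr i)); split; first by case: (Hr i).
    move=> k j; rewrite ord1 /ball/= distrC (le_lt_trans (zy j))//.
    rewrite (lt_le_trans _ (r0r i))// (le_lt_trans _ mr)//.
    by rewrite /m (le_trans _ (coord_le_enorm _ j))// !mxE.
  apply: (@le_trans _ _ (2 * BB)).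
    by rewrite (le_trans (ler_normB _ _))// mulr_natl mulr2n lerD.
  rewrite /w; apply: (@le_trans _ _ (2 * BB * (m / r0) `^ (p - 1))); last by rewrite lerDr ltW.
  rewrite ler_peMr ?mulr_ge0//.
  have mr : 1 <= m / r0 by rewrite ler_pdivlMr ?mul1r.
  have p10 : 0 <= p - 1 by rewrite subr_ge0 ltW.
  have := ler_powR mr p10; rewrite powRr0; exact.
rewrite /w powRM ?invr_ge0 ?(ltW r00)// mulrDr mulrDl lerD//.
  rewrite -!mulrA mulrCA ler_wpM2l ?(ltW e0)// mulrA ler_piMl//.
  by rewrite ler_pdivrMr// mul1r ler_nat.
rewrite (powR_predM m0 p1).
by rewrite le_eqVlt; apply/orP; left; apply/eqP; ring.
Qed.

End test_functions.

Section pairing.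
Context {R : realType} {d : nat} (p q : R) (hp : 1 < p) (hpq : p^-1 + q^-1 = 1).
Local Notation Tm := (Rd R d * Rd R d)%type.
Implicit Types (mu nu : Mp R d p) (pi : probability Tm R) (xi : Rd R d -> Rd R d).

Let p0 : 0 < p. Proof. exact: lt_trans hp. Qed.

Lemma conjugate_gt1 : 1 < q.
Proof.
have qV : q^-1 = 1 - p^-1 by rewrite -hpq addrAC subrr add0r.
have p1 : p^-1 < 1 by rewrite invf_lt1.
have q0 : 0 < q by rewrite -invr_gt0 qV subr_gt0.
by rewrite -invf_lt1// qV ltrBlDr ltrDl invr_gt0.
Qed.

Let q0 : 0 < q. Proof. exact: lt_trans conjugate_gt1. Qed.

Section one_coupling.
Variables (mu nu : Mp R d p) (pi : probability Tm R) (cpi : couplings mu nu pi).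

Lemma integrable_cost : pi.-integrable setT (fun z => (enorm ((z.1 : 'rV[R]_d) - z.2))%:E) /\
  (\int[pi]_z (enorm ((z.1 : 'rV[R]_d) - z.2))%:E <= (cost p pi)%:E)%E.
Proof.
have H : (\int[pi]_z (enorm ((z.1 : 'rV[R]_d) - z.2))%:E <= (cost p pi)%:E)%E.
  have m1 : measurable_fun [set: Tm] (fun=> 1 : R) by exact: measurable_cst.
  have := hoelder pi measurable_fun_dist m1 p0 q0 hpq.
  rewrite (Lnorm_cst_prob pi q0 ler01) mule1 -(transport_costE p pi) -(costE hp cpi).
  apply: le_trans; rewrite Lnorm1.
  by under [leRHS]eq_integral do rewrite /= mulr1 ger0_norm ?enorm_ge0//.
split => //; apply/integrableP; split.
  by apply/measurable_EFinP; exact: measurable_fun_dist.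
under eq_integral do rewrite gee0_abs ?lee_fin ?enorm_ge0//.
by rewrite (le_lt_trans H)// ltry.
Qed.

Lemma integrable_costp : pi.-integrable setT (fun z =>
  (enorm ((z.1 : 'rV[R]_d) - z.2) `^ p)%:E) /\
  (\int[pi]_z (enorm ((z.1 : 'rV[R]_d) - z.2) `^ p)%:E = (cost p pi `^ p)%:E)%E.
Proof.
have I0 : (0 <= \int[pi]_z (enorm ((z.1 : 'rV[R]_d) - z.2) `^ p)%:E)%E.
  by apply: integral_ge0 => z _; rewrite lee_fin powR_ge0.
have H : (\int[pi]_z (enorm ((z.1 : 'rV[R]_d) - z.2) `^ p)%:E = (cost p pi `^ p)%:E)%E.
  by rewrite -poweR_EFin (costE hp cpi) /transport_cost -poweRrM mulVf ?gt_eqF// poweRe1.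
split => //; apply/integrableP; split.
  by apply/measurable_EFinP; apply: (measurableT_comp (measurable_powR p));
    exact: measurable_fun_dist.
under eq_integral do rewrite gee0_abs ?lee_fin ?powR_ge0//.
by rewrite H ltry.
Qed.

Lemma pairing_measurable xi : measurable_fun setT xi ->
  measurable_fun [set: Tm] (fun z => dot (xi z.1) ((z.2 : 'rV[R]_d) - z.1)).
Proof.
move=> mxi; apply: measurable_fun_dot; first exact: measurableT_comp.
exact: measurable_fun_RdB.
Qed.

Lemma pairing_bound xi : in_Lq mu q xi ->
  pi.-integrable setT (fun z => (dot (xi z.1) ((z.2 : 'rV[R]_d) - z.1))%:E) /\
  (`|pairing xi pi| <= Lnorm_vec mu q xi * (cost p pi)%:E)%E.
Proof.
move=> [mxi Lxi].
have mxi1 : measurable_fun [set: Tm] (fun z => enorm (xi z.1)).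
  by apply: measurable_fun_enorm; exact: measurableT_comp.
have mp := pairing_measurable mxi.
have H : (\int[pi]_z `|(dot (xi z.1) ((z.2 : 'rV[R]_d) - z.1))%:E| <= Lnorm_vec mu q xi * (cost
  p pi)%:E)%E.
  have hqp : q^-1 + p^-1 = 1 by rewrite addrC.
  have := hoelder pi mxi1 measurable_fun_dist q0 p0 hqp.
  rewrite (Lnorm_fst cpi q (measurable_fun_enorm mxi)) -(transport_costE p pi) -(costE hp cpi).
  apply: le_trans; rewrite Lnorm1; apply: ge0_le_integral => //.
  - by apply/measurable_EFinP; exact: measurableT_comp.
  - by apply/measurable_EFinP; apply: measurableT_comp => //; apply: measurable_funM => //;
    exact: measurable_fun_dist.
  - move=> z _ /=; rewrite lee_fin [leRHS]ger0_norm ?mulr_ge0 ?enorm_ge0// enormBC.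
    exact: normr_dot_le.
have I : pi.-integrable setT (fun z => (dot (xi z.1) ((z.2 : 'rV[R]_d) - z.1))%:E).
  apply/integrableP; split; first exact/measurable_EFinP.
  rewrite (le_lt_trans H)// lte_mul_pinfty ?Lnorm_ge0 ?ltry//.
  by rewrite ge0_fin_numE ?Lnorm_ge0.
split => //; apply: le_trans H; apply: le_abse_integral => //.
exact/measurable_EFinP.
Qed.

Lemma pairing_fin xi : in_Lq mu q xi -> pairing xi pi \is a fin_num.
Proof.
by move=> hxi; have [I _] := pairing_bound hxi; exact: integrable_fin_num.
Qed.

Lemma pairing_le xi : in_Lq mu q xi ->
  `|fine (pairing xi pi)| <= fine (Lnorm_vec mu q xi) * cost p pi.
Proof.
move=> hxi; have [_ B] := pairing_bound hxi; have [_ L] := hxi.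
rewrite -lee_fin EFinM fineK ?ge0_fin_numE ?Lnorm_ge0//.
by rewrite -abse_EFin fineK// pairing_fin.
Qed.

End one_coupling.

(** The factor 2 has two sources: the distance from [xi] to [grad psi], through Hoelder's
    inequality, and the linear error in the expansion of [psi]. The constant [C] is chosen before
    the measures and the coupling. *)
Lemma pairing_test_function psi (e : R) : test_function psi -> 0 < e ->
  exists2 C, 0 <= C & forall mu nu pi, couplings mu nu pi -> forall xi, in_Lq mu q xi ->
  (Lnorm_vec mu q (fun x => (xi x : 'rV[R]_d) - grad psi x)%R < e%:E)%E ->
  `|fine (pairing xi pi) - (fine (\int[nu]_x (psi x)%:E)%E - fine (\int[mu]_x (psi x)%:E)%E)| <=
    2 * e * cost p pi + C * cost p pi `^ p.
Proof.
move=> tpsi e0; have [C C0 HC] := test_function_expansion hp tpsi e0.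
have [smooth cK] := tpsi.
have cpsi : continuous psi by have [] := smooth [::].
have mpsi : measurable_fun [set: Rd R d] psi by exact: continuous_measurable_Rd.
have [B B0 HB] : exists2 B, 0 <= B & forall x, `|psi x| <= B.
  apply: (compact_support_bounded cK) => // x nx; apply/eqP/negPn/negP => h; apply: nx.
  exact: subset_closure.
have mgrad : measurable_fun [set: Rd R d] (grad psi : Rd R d -> Rd R d).
  apply: measurable_fun_Rd => i; under eq_fun do rewrite mxE.
  by apply: continuous_measurable_Rd; have [] := smooth [:: i].
have Ib d' (T : measurableType d') (P : probability T R) (f : T ->
  Rd R d) : measurable_fun setT f ->
    P.-integrable setT (fun x => (psi (f x))%:E).
  move=> mf; have mpf : measurable_fun setT (fun x =>
    psi (f x)) by exact: (measurableT_comp mpsi).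
  apply: (@le_integrable _ _ _ P setT measurableT _ (cst B%:E)).
  - exact/measurable_EFinP.
  - by move=> x _ /=; rewrite lee_fin (ger0_norm B0).
  - by apply: finite_measure_integrable_cst.
exists C => // mu nu pi cpi xi hxi xie.
have [_ pmu pnu] := cpi.
have Imu : (\int[mu]_x (psi x)%:E = \int[pi]_z (psi z.1)%:E)%E.
  by rewrite (integral_of_law measurable_fst pmu)//; exact: Ib.
have Inu : (\int[nu]_x (psi x)%:E = \int[pi]_z (psi z.2)%:E)%E.
  by rewrite (integral_of_law measurable_snd pnu)//; exact: Ib.
pose eta x : Rd R d := (xi x : 'rV[R]_d) - grad psi x.
have heta : in_Lq mu q eta.
  split; first by apply: measurable_fun_RdB => //; have [] := hxi.
  by apply: lt_trans xie _; exact: ltry.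
have [Ixi _] := pairing_bound cpi hxi.
have [Ieta Beta] := pairing_bound cpi heta.
have I1 : pi.-integrable setT (fun z => (psi z.1)%:E) by exact: Ib.
have I2 : pi.-integrable setT (fun z => (psi z.2)%:E) by exact: Ib.
pose rem z := psi z.2 - psi z.1 - dot (grad psi z.1) ((z.2 : 'rV[R]_d) - z.1).
have remE z : rem z = psi z.2 - psi z.1 - (dot (xi z.1) ((z.2 : 'rV[R]_d) - z.1) - dot (eta z.1)
  ((z.2 : 'rV[R]_d) - z.1)).
  by rewrite /rem /eta dotBl; ring.
have Irem : pi.-integrable setT (EFin \o rem).
  rewrite (_ : EFin \o rem = (fun z =>
    ((psi z.2)%:E - (psi z.1)%:E - ((dot (xi z.1) ((z.2 : 'rV[R]_d) - z.1))%:E - (dot (eta z.1)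
    ((z.2 : 'rV[R]_d) - z.1))%:E))%E)); last first.
    by apply/funext => z /=; rewrite remE.
  by do !apply: integrableB => //.
have IremE : (\int[pi]_z (rem z)%:E = \int[pi]_z (psi z.2)%:E - \int[pi]_z (psi z.1)%:E -
  (pairing xi pi - pairing eta pi))%E.
  rewrite /pairing -!integralB//; last 2 first.
  - by apply: integrableB.
  - by apply: integrableB.
  by apply: eq_integral => z _; rewrite remE.
have [Ic Bc] := integrable_cost cpi; have [Ip Ep] := integrable_costp cpi.
have Brem : (`|\int[pi]_z (rem z)%:E| <= (e * cost p pi + C * cost p pi `^ p)%:E)%E.
  have mrem : measurable_fun [set: Tm] (EFin \o rem) by have /integrableP[] := Irem.
  apply: le_trans (le_abse_integral _ _ _) _ => //.
  apply: (@le_trans _ _ (\int[pi]_z (e%:E * (enorm ((z.1 : 'rV[R]_d) - z.2))%:E + C%:E * (enorm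
    ((z.1 : 'rV[R]_d) - z.2) `^ p)%:E)))%E.
    apply: ge0_le_integral => //.
    - exact: measurableT_comp.
    - apply: emeasurable_funD; apply: measurable_funeM.
        by have /integrableP[] := Ic.
      by have /integrableP[] := Ip.
    - by move=> z _ /=; rewrite lee_fin [enorm (z.1 - _)]enormBC; exact: HC.
  rewrite integralD//; last 2 first.
  - exact: integrableZl.
  - exact: integrableZl.
  rewrite !integralZl// Ep EFinD !EFinM leeD2r// lee_wpmul2l// lee_fin ltW//.
have fe : pairing eta pi \is a fin_num by exact: integrable_fin_num.
have fx : pairing xi pi \is a fin_num by exact: integrable_fin_num.
have f1 : (\int[pi]_z (psi z.1)%:E)%E \is a fin_num by exact: integrable_fin_num.
have f2 : (\int[pi]_z (psi z.2)%:E)%E \is a fin_num by exact: integrable_fin_num.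
have Peta : `|fine (pairing eta pi)| <= e * cost p pi.
  rewrite -lee_fin -abse_EFin fineK// (le_trans Beta)// EFinM lee_wpmul2r ?lee_fin ?cost_ge0//.
  exact: ltW.
rewrite Imu Inu.
move: Brem; rewrite IremE -(fineK fe) -(fineK fx) -(fineK f1) -(fineK f2) -!EFinB abse_EFin
  lee_fin.
move: Peta; set x1 := fine _; set x2 := fine _; set x3 := fine _; set x4 := fine _.
move: x1 x2 x3 x4 => x1 x2 x3 x4 /=; rewrite !ler_norml; clear; lra.
Qed.

Lemma pairing_insensitive mu xi (e : R) : CoTan mu q xi -> 0 < e ->
  exists2 eta, 0 < eta & forall nu pi pi', couplings mu nu pi -> couplings mu nu pi' ->
  cost p pi <= eta -> cost p pi' <= eta ->
  `|fine (pairing xi pi) - fine (pairing xi pi')| <= e * (cost p pi + cost p pi').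
Proof.
move=> [hxi app] e0; have e4 : 0 < e / 4 by rewrite divr_gt0.
have [psi tpsi xie] := app _ e4.
have [C C0 HC] := pairing_test_function tpsi e4.
have C1 : 0 < C + 1 by rewrite ltr_wpDl.
(* The solution of [(C + 1) * eta^(p - 1) = e / 2]: for costs up to [eta] the superlinear error is
   at most [e / 2] times the cost. The linear error, twice [e / 4], is the other half. *)
pose eta := (e / 2 / (C + 1)) `^ (p - 1)^-1.
have p10 : 0 < p - 1 by rewrite subr_gt0.
have eta0 : 0 < eta by rewrite powR_gt0// !divr_gt0.
have small c : 0 <= c -> c <= eta -> C * c `^ p <= e / 2 * c.
  move=> c0 ce.
  rewrite (powR_predM c0 hp).
  rewrite mulrCA mulrC ler_wpM2r//.
  apply: (@le_trans _ _ ((C + 1) * eta `^ (p - 1))).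
    by rewrite ler_pM ?powR_ge0 ?lerDl// ge0_ler_powR ?nnegrE// ltW.
  have b0 : 0 <= e / 2 / (C + 1) by rewrite !divr_ge0// ltW.
  by rewrite /eta -powRrM mulVf ?gt_eqF// powRr1// mulrC divfK// gt_eqF.
exists eta => // nu pi pi' cpi cpi' ce ce'.
have := HC _ _ _ cpi _ hxi xie; have := HC _ _ _ cpi' _ hxi xie.
have := small _ (cost_ge0 p pi) ce; have := small _ (cost_ge0 p pi') ce'.
set u := fine _; set u' := fine _; set w := _ - fine (\int[mu]_x _)%E.
move: u u' w => u u' w; rewrite !ler_norml; clear; lra.
Qed.

End pairing.

(** * Action of a path *)

Section signed_integrals.
Context d (T : measurableType d) (R : realType) (mu : {measure set T -> \bar R}).
Local Open Scope ereal_scope.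

Lemma le_integral_of_le (D : set T) (f g : T -> \bar R) :
  (forall x, D x -> f x <= g x) ->
  \int[mu]_(x in D) f x <= \int[mu]_(x in D) g x.
Proof.
move=> fg; rewrite [leLHS]integralE [leRHS]integralE.
apply: leeB; apply: ge0_le_integral_of_le => // x Dx.
- by apply: (@funepos_le _ _ D) => [y|]; rewrite inE//; exact: fg.
- by apply: (@funeneg_le _ _ D) => [y|]; rewrite inE//; exact: fg.
Qed.

(** The negative part of [g] is dominated by that of [f], so its integral is finite; a finite upper
    bound for the difference then forces the positive part to be finite too. *)
Lemma integrable_of_le (D : set T) (f g : T -> \bar R) : measurable D ->
  mu.-integrable D f -> measurable_fun D g -> (forall x, D x -> f x <= g x) ->
  \int[mu]_(x in D) g x < +oo -> mu.-integrable D g.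
Proof.
move=> mD If mg fg; have mf := measurable_int mu If.
have mp : measurable_fun D g^\+ by exact: measurable_funepos.
have mn : measurable_fun D g^\- by exact: measurable_funeneg.
have n0 : \int[mu]_(x in D) g^\- x < +oo.
  apply: (@le_lt_trans _ _ (\int[mu]_(x in D) f^\- x)).
    apply: ge0_le_integral => //; first exact: measurable_funeneg.
    by move=> x Dx; apply: (@funeneg_le _ _ D) => [y|]; rewrite inE//; exact: fg.
  by have := integrable_neg_fin_num mD If; rewrite fin_numElt => /andP[].
have nf : \int[mu]_(x in D) g^\- x \is a fin_num by rewrite ge0_fin_numE// integral_ge0.
rewrite integralE => h.
have h1 : \int[mu]_(x in D) g^\+ x < +oo.
  rewrite ltNge leye_eq; apply/negP => /eqP E; move: h; rewrite E.
  by rewrite -(fineK nf).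
apply/integrableP; split => //.
rewrite (_ : (fun x => `|g x|) = (fun x => g^\+ x + g^\- x)); last exact: fune_abse.
by rewrite ge0_integralD// lte_add_pinfty.
Qed.

End signed_integrals.

(** * Exponential discount and time shifts *)

Section half_line.
Context {R : realType}.
Local Notation leb := (@lebesgue_measure R).

Lemma derive_expRM (c x : R) : is_derive x 1 (fun y : R =>
  c^-1 * expR (c * y)) (c^-1 * (c * expR (c * x))).
Proof.
apply: is_deriveZ.
have d1 : is_derive x 1 ( *%R c : R -> R) c.
  have := @is_deriveZ R R R id c x 1 1 _.
  by rewrite /GRing.scale/= mulr1; apply.
have := @is_derive1_comp R expR ( *%R c) x (expR (c * x)) c _ d1.
by rewrite [c * expR _]mulrC; apply; exact: is_derive_expR.
Qed.

Lemma integral_expR_itv (c a b : R) : c != 0 -> a <= b ->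
  (\int[leb]_(x in `[a, b]) (expR (c * x))%:E = ((expR (c * b) - expR (c * a)) / c)%:E)%E.
Proof.
move=> c0; rewrite le_eqVlt => /orP[/eqP <-|ab].
  by rewrite set_itv1 integral_set1 subrr mul0r.
have cF : continuous (fun y : R => c^-1 * expR (c * y)).
  move=> x; apply: differentiable_continuous; apply/derivable1_diffP.
  by have [] := derive_expRM c x.
rewrite (@continuous_FTC2 _ _ (fun y : R => c^-1 * expR (c * y)))//.
- by rewrite -EFinB -mulrBr mulrC.
- apply: continuous_subspaceT => x.
  rewrite (_ : (fun y => expR (c * y)) = (fun y => c * (c^-1 * expR (c * y)))); last first.
    by apply/funext => y; rewrite mulrA mulfV// mul1r.
  by apply: cvgMr; exact: cF.
- split.
  + by move=> x _; have [] := derive_expRM c x.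
  + by apply/cvg_at_right_filter; exact: cF.
  + by apply/cvg_at_left_filter; exact: cF.
- move=> x _; rewrite derive1E; have [_ ->] := derive_expRM c x.
  by rewrite mulrA mulVf// mul1r.
Qed.

Lemma integral_expR_itvy (c a : R) : 0 < c ->
  (\int[leb]_(x in `[a, +oo[) (expR (- (c * x)))%:E = (expR (- (c * a)) / c)%:E)%E.
Proof.
move=> c0; have cn0 : - c != 0 by rewrite oppr_eq0 gt_eqF.
have cF : continuous (fun y : R => (- c)^-1 * expR (- c * y)).
  move=> x; apply: differentiable_continuous; apply/derivable1_diffP.
  by have [] := derive_expRM (- c) x.
under eq_integral do rewrite -mulNr.
rewrite (@ge0_continuous_FTC2y _ _ (fun y => (- c)^-1 * expR (- c * y)) a 0)//.
- by rewrite sub0e -EFinN mulNr invrN mulNr opprK mulrC.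
- apply: continuous_subspaceT => x.
  rewrite (_ : (fun y => expR (- c * y)) = (fun y => (- c) * ((- c)^-1 * expR (- c * y))));
    last first.
    by apply/funext => y; rewrite mulrA mulfV// mul1r.
  by apply: cvgMr; exact: cF.
- rewrite -(mulr0 (- c)^-1); apply: cvgMr.
  rewrite (_ : (fun x => expR (- c * x)) = (fun z => expR (- z)) \o (fun z => c * z)); last first.
    by apply: eq_fun => x; rewrite mulNr.
  apply: (@cvg_comp _ _ _ _ _ _ (pinfty_nbhs R)); last exact: cvgr_expR.
  exact: gt0_cvgMry.
- by apply/cvg_at_right_filter; exact: cF.
- move=> x _; rewrite derive1E; have [_ ->] := derive_expRM (- c) x.
  by rewrite mulrA mulVf// mul1r.
Qed.

Section shift.
Variable h : R.

Local Notation RT := (measurableTypeR R).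

Let shift_measurable : measurable_fun [set: RT] (fun x : RT => (x : R) + h : RT).
Proof. by apply: measurable_funD. Qed.

Let phi : {mfun RT >-> RT} := mfun_Sub (mem_set shift_measurable : (fun x : RT =>
  (x : R) + h : RT) \in mfun).

Lemma lebesgue_measure_shift (A : set R) : measurable A ->
  leb ((fun x => x + h) @^-1` A) = leb A.
Proof.
move=> mA; apply/esym.
apply: (@lebesgue_measure_unique R (pushforward leb phi)) => // _ [[a b] _ <-].
rewrite /= /pushforward (_ : phi @^-1` _ = `]a - h, b - h]%classic); last first.
  by apply/seteqP; split => x; rewrite /= !in_itv/= ltrBlDr lerBrDr.
by rewrite !lebesgue_measure_itv/= !lte_fin ltrD2r -!EFinB opprB addrA subrK.
Qed.

Lemma integral_shift (D : set R) (f : R -> \bar R) : measurable D -> measurable_fun D f ->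
  (\int[leb]_(x in D) f x = \int[leb]_(x in (fun x => (x + h)%R) @^-1` D) f (x + h)%R)%E.
Proof.
move=> mD mf.
have P (g : R -> \bar R) : measurable_fun D g -> (forall x, 0 <= g x)%E ->
    (\int[leb]_(x in D) g x = \int[leb]_(x in (fun x => (x + h)%R) @^-1` D) g (x + h)%R)%E.
  move=> mg g0.
  have := @ge0_integral_pushforward _ _ _ _ _ phi shift_measurable leb D g.
  move=> <-//.
  apply: eq_measure_integral => A mA _; apply/esym.
  exact: lebesgue_measure_shift.
rewrite integralE [RHS]integralE; congr (_ - _)%E.
- rewrite (P _ (measurable_funepos mf) (fun x => funepos_ge0 f x)).
  by apply: eq_integral => x _; rewrite !funeposE.
- rewrite (P _ (measurable_funeneg mf) (fun x => funeneg_ge0 f x)).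
  by apply: eq_integral => x _; rewrite !funenegE.
Qed.

Lemma integral_shift_itvcc (a b : R) (f : R ->
  \bar R) : measurable_fun `[(a + h)%R, (b + h)%R] f ->
  (\int[leb]_(x in `[(a + h)%R, (b + h)%R]) f x = \int[leb]_(x in `[a, b]) f (x + h)%R)%E.
Proof.
move=> mf; rewrite integral_shift// (_ : _ @^-1` _ = `[a, b]%classic)//.
by apply/seteqP; split => x; rewrite /= !in_itv/= !lerD2r.
Qed.

Lemma integral_shift_itvcy (f : R -> \bar R) : measurable_fun `[h, +oo[ f ->
  (\int[leb]_(x in `[h, +oo[) f x = \int[leb]_(x in `[0%R, +oo[) f (x + h)%R)%E.
Proof.
move=> mf; rewrite integral_shift// (_ : _ @^-1` _ = `[0, +oo[%classic)//.
by apply/seteqP; split => x; rewrite /= !in_itv/= !andbT lerDr.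
Qed.

Let h0_disjoint : [disjoint (`[0, h[%classic : set R) & `[h, +oo[%classic].
Proof.
apply/disj_setPS => x [/=]; rewrite !in_itv/= andbT => /andP[_ xh] hx.
by move: (lt_le_trans xh hx); rewrite ltxx.
Qed.

Let h0_setU : 0 <= h -> (`[0, h[%classic : set R) `|` `[h, +oo[%classic = `[0, +oo[%classic.
Proof.
move=> h0; apply/seteqP; split => x; rewrite /= !in_itv/= !andbT.
  by move=> [/andP[]//|hx]; exact: le_trans hx.
by move=> x0; case: (ltP x h) => hx; [left; rewrite x0|right].
Qed.

Lemma integral_split_shift (f : R -> \bar R) : 0 <= h ->
  measurable_fun (`[0%R, +oo[%classic : set R) f ->
  (\int[leb]_(x in `[0%R, +oo[) f x =
   \int[leb]_(x in `[0%R, h[) f x + \int[leb]_(x in `[0%R, +oo[) f (x + h)%R)%E.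
Proof.
move=> h0 mf; transitivity (\int[leb]_(x in `[0%R, h[ `|` `[h, +oo[) f x)%E.
  by rewrite h0_setU.
rewrite integral_setU//; last by rewrite h0_setU.
congr (_ + _)%E; apply: integral_shift_itvcy; apply: measurable_funS mf => //.
by apply: subset_itvr; rewrite bnd_simp.
Qed.

Lemma integrable_shift (f : R -> \bar R) : 0 <= h -> leb.-integrable `[0%R, +oo[ f ->
  leb.-integrable `[0%R, +oo[ (fun x => f (x + h)%R).
Proof.
move=> h0 If.
have Ih : leb.-integrable `[h, +oo[ f.
  by apply: integrableS If => //; apply: subset_itvr; rewrite bnd_simp.
have [mf Ifh] := integrableP _ _ _ Ih.
apply/integrableP; split.
  have := @measurable_comp _ _ _ RT RT (\bar R) (`[h, +oo[%classic) f (`[0, +oo[%classic) phi.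
  move=> H; apply: H => //; last exact: measurable_funTS.
  move=> _ [x + <-]; rewrite /= !in_itv/= !andbT => x0.
  by change (h <= x + h); rewrite lerDr.
rewrite -(@integral_shift_itvcy (fun x => `|f x|%E))//.
exact: measurableT_comp.
Qed.

End shift.

End half_line.

Lemma powRV (R : realType) (x r : R) : 0 < x -> x^-1 `^ r = (x `^ r)^-1.
Proof. by move=> x0; rewrite -powR_inv1 ?ltW// -powRrM mulN1r powRN. Qed.

Lemma powR_addr_le (R : realType) (x y r : R) : 0 <= x -> 0 <= y -> 0 <= r ->
  (x + y) `^ r <= 2 `^ r * (x `^ r + y `^ r).
Proof.
move=> x0 y0 r0; pose z := Num.max x y.
have z0 : 0 <= z by rewrite le_max x0.
apply: (@le_trans _ _ ((2 * z) `^ r)).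
  apply: ge0_ler_powR; rewrite ?nnegrE ?addr_ge0 ?mulr_ge0//.
  by rewrite mulr_natl mulr2n lerD// le_max lexx ?orbT.
rewrite powRM// ler_wpM2l ?powR_ge0// /z maxEle.
by case: ifP => _; [rewrite lerDr|rewrite lerDl]; rewrite powR_ge0.
Qed.

Section young.
Context {R : realType} (p q : R) (hp : 1 < p) (hpq : p^-1 + q^-1 = 1).

Let p0 : 0 < p. Proof. exact: lt_trans hp. Qed.
Let q0 : 0 < q. Proof. exact: lt_trans (conjugate_gt1 hp hpq). Qed.

Lemma conjugateM : q * (p - 1) = p.
Proof.
have E : p * q * (p^-1 + q^-1) = q + p.
  by rewrite mulrDr -(mulrA p) mulrCA mulfV ?gt_eqF// -mulrA mulfV ?gt_eqF// !mulr1.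
by move: E; rewrite hpq; lra.
Qed.

(* Optimizing Young's inequality over the weight recovers Hoelder's. *)
Lemma hoelder_of_young (w A B : R) : 0 <= w -> 0 <= A -> 0 < B ->
  (forall l, 0 < l -> w <= l `^ p / p * A + l^-1 `^ q / q * B) ->
  w `^ p <= B `^ (p - 1) * A.
Proof.
rewrite le_eqVlt => /orP[/eqP <- A0 B0 _|w0 A0 B0 H].
  by rewrite powR0 ?gt_eqF// mulr_ge0 ?powR_ge0.
have Bw : 0 < B / w by rewrite divr_gt0.
(* The weight for which the [B] term is exactly [w / q], leaving [w / p] to be bounded by the [A]
   term. *)
have := H ((B / w) `^ q^-1) (powR_gt0 _ Bw).
have -> : ((B / w) `^ q^-1)^-1 `^ q = w / B.
  by rewrite powRV ?powR_gt0// -powRrM mulVf ?gt_eqF// powRr1 ?ltW// invf_div.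
have -> : (B / w) `^ q^-1 `^ p = (B / w) `^ (p - 1).
  by rewrite -powRrM -{1}conjugateM mulrA mulVf ?gt_eqF// mul1r.
have -> : w / B / q * B = w / q by field; rewrite !gt_eqF.
rewrite -lerBlDr (_ : w - w / q = w / p); last first.
  by rewrite -{1}(mulr1 w) -hpq mulrDr addrK.
rewrite mulrAC ler_pM2r ?invr_gt0// powRM ?invr_ge0 ?(ltW B0) ?(ltW w0)// powRV// mulrAC.
by rewrite ler_pdivlMr ?powR_gt0// (powR_predM (ltW w0) hp).
Qed.

End young.

Lemma measurable_discount (R : realType) (c : R) (D : set R) : measurable_fun D (fun t : R =>
  expR (c * t)).
Proof.
apply: measurable_funTS; apply: measurableT_comp => //; exact: measurable_funM.
Qed.

Lemma measurable_discountN (R : realType) (c : R) (D : set R) : measurable_fun D (fun t : R =>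
  expR (- (c * t))).
Proof. by under eq_fun do rewrite -mulNr; exact: measurable_discount. Qed.

(** Tonelli's theorem on the region [0 <= x <= t]; the discount integrated over [[x, +oo[] is the
    discount at [x] divided by [c]. *)
Lemma tonelli_discount (R : realType) (c : R) (f : R -> R) : 0 < c -> measurable_fun setT f ->
  (forall x, 0 <= f x) ->
  (\int[lebesgue_measure]_(t in `[0%R, +oo[)
     ((expR (- (c * t)))%:E * \int[lebesgue_measure]_(x in `[0%R, t]) (f x)%:E) =
   (c^-1)%:E * \int[lebesgue_measure]_(x in `[0%R, +oo[) (expR (- (c * x)) * f x)%:E)%E.
Proof.
move=> c0 mf f0; set leb := (@lebesgue_measure R).
pose g (z : R * R) : R := if (0 <= z.2) && (z.2 <= z.1) then expR (- (c * z.1)) * f z.2 else 0.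
have g0 z : 0 <= g z by rewrite /g; case: ifP => // _; rewrite mulr_ge0 ?expR_ge0.
have mg : measurable_fun [set: measurableTypeR R * measurableTypeR R] (EFin \o g).
  apply/measurable_EFinP; apply: measurable_fun_ifT => //.
  - by apply: measurable_and; apply: measurable_fun_ler.
  - apply: measurable_funM; last exact: measurableT_comp.
    apply: measurableT_comp => //; under eq_fun do rewrite -mulNr.
    exact: measurable_funM.
have := @fubini_tonelli _ _ _ _ R leb leb (EFin \o g) mg (fun z => g0 z).
have -> : (\int[leb]_x \int[leb]_y (EFin \o g) (x, y) =
  \int[leb]_(t in `[0%R, +oo[) ((expR (- (c * t)))%:E * \int[leb]_(x in `[0%R, t]) (f x)%:E))%E.
  rewrite [RHS]integral_mkcond; apply: eq_integral => t _; rewrite patchE mem_setE in_itv/= andbT.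
  case: ifPn => [t0|]; last first.
    rewrite -ltNge => t0; apply: integral0_eq => x _ /=; rewrite /g/=.
    by case: ifPn => // /andP[x0 xt]; move: (le_lt_trans (le_trans x0 xt) t0); rewrite ltxx.
  rewrite -ge0_integralZl//; last 2 first.
  - by apply/measurable_EFinP; exact: measurable_funTS.
  - by move=> x _; rewrite lee_fin.
  rewrite [RHS]integral_mkcond; apply: eq_integral => x _; rewrite patchE mem_setE in_itv/= /g/=.
  by case: ifP.
move=> ->.
rewrite -ge0_integralZl//; last 3 first.
- by apply/measurable_EFinP; apply: measurable_funM;
  [exact: measurable_discountN|exact: measurable_funTS].
- by move=> x _; rewrite lee_fin mulr_ge0 ?expR_ge0.
- by rewrite lee_fin invr_ge0 ltW.
rewrite [RHS]integral_mkcond; apply: eq_integral => x _; rewrite patchE mem_setE in_itv/= andbT.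
case: ifPn => [x0|x0]; last by apply: integral0_eq => t _; rewrite /= /g/= (negbTE x0).
transitivity ((f x)%:E * \int[leb]_(t in `[x, +oo[) (expR (- (c * t)))%:E)%E.
  rewrite -ge0_integralZl//; last 2 first.
  - by apply/measurable_EFinP; exact: measurable_discountN.
  - by rewrite lee_fin.
  rewrite [RHS]integral_mkcond; apply: eq_integral => t _;
    rewrite patchE mem_setE in_itv/= /g/= x0/= andbT.
  by case: ifP => // _; rewrite -EFinM mulrC.
by rewrite integral_expR_itvy// -!EFinM; congr EFin; rewrite mulrC -mulrA mulrCA.
Qed.

(** * Paths with a bound on their speed *)

Section weighted_paths.
Context {R : realType} {d : nat} (p q delta : R).
Hypotheses (hp : 1 < p) (hpq : p^-1 + q^-1 = 1) (delta0 : 0 < delta).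
Local Notation leb := (@lebesgue_measure R).
Local Notation itv0y := (`[0%R, +oo[%classic : set R).
Implicit Types (s : R -> Mp R d p) (m : R -> R) (V : Mp R d p -> R).

Let p0 : 0 < p. Proof. exact: lt_trans hp. Qed.
Let q0 : 0 < q. Proof. exact: lt_trans (conjugate_gt1 hp hpq). Qed.

Definition kinetic m : \bar R := (\int[leb]_(t in itv0y) (expR (- (delta * t)) * m t `^ p)%:E)%E.

(** Wrapped in an inductive type so that the quantified inequality stays an atom until it is
    destructed. *)
Inductive moves_within s m : Prop :=
  MovesWithin of forall r t, 0 <= r -> r <= t ->
    ((Wp (s r) (s t))%:E <= \int[leb]_(x in `[r, t]) (m x)%:E)%E.

(** [m] need not be the metric derivative, only an upper bound in integrated form. This is what
    survives a shift or a concatenation without computing any limit. *)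
Definition speed_bound s m : Prop :=
  [/\ measurable_fun setT m, forall t, 0 <= m t, moves_within s m &
      (kinetic m < +oo)%E].

Definition energy V s m : \bar R :=
  (\int[leb]_(t in itv0y) (expR (- (delta * t)) * (p^-1 * m t `^ p - V (s t)))%:E)%E.

Lemma measurable_powp m (D : set R) : measurable_fun setT m ->
  measurable_fun D (fun t => m t `^ p).
Proof. by move=> mm; apply: measurable_funTS; exact: (measurableT_comp (measurable_powR p)). Qed.

Lemma kinetic_ge0 m : (0 <= kinetic m)%E.
Proof. by apply: integral_ge0 => t _; rewrite lee_fin mulr_ge0 ?expR_ge0 ?powR_ge0. Qed.

(** On [[0, T]] the weight is at most [1], and [1 <= expR (delta * T) * expR (- (delta * x))]. *)
Lemma weighted_powp_itv m (c T : R) : measurable_fun setT m -> 0 <= c -> 0 <= T ->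
  (\int[leb]_(x in `[0%R, T]) (expR (- (c * x)) * m x `^ p)%:E <= (expR (delta * T))%:E *
    kinetic m)%E.
Proof.
move=> mm c0 T0; rewrite /kinetic -ge0_integralZl//; last 2 first.
- apply/measurable_EFinP; apply: measurable_funM; first exact: measurable_discountN.
  exact: measurable_powp.
- by move=> x _; rewrite lee_fin mulr_ge0 ?expR_ge0 ?powR_ge0.
apply: (@le_trans _ _ (\int[leb]_(x in `[0%R,
  T]) ((expR (delta * T))%:E * (expR (- (delta * x)) * m x `^ p)%:E))%E); last first.
  apply: ge0_subset_integral => //.
  - apply/measurable_EFinP; apply: measurable_funM => //; apply: measurable_funM.
      exact: measurable_discountN.
    exact: measurable_powp.
  - by move=> x _; rewrite -EFinM lee_fin !mulr_ge0 ?expR_ge0 ?powR_ge0.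
  - by apply: subset_itvl; rewrite bnd_simp.
apply: ge0_le_integral => //.
- by move=> x _; rewrite lee_fin mulr_ge0 ?expR_ge0 ?powR_ge0.
- apply/measurable_EFinP; apply: measurable_funM; first exact: measurable_discountN.
  exact: measurable_powp.
- apply/measurable_EFinP; apply: measurable_funM => //; apply: measurable_funM.
    exact: measurable_discountN.
  exact: measurable_powp.
move=> x /=; rewrite in_itv/= => /andP[x0 xT]; rewrite -EFinM lee_fin mulrA ler_wpM2r ?powR_ge0//.
rewrite -expRD ler_expR.
have : 0 <= c * x by rewrite mulr_ge0.
have : delta * x <= delta * T by rewrite ler_pM2l.
lra.
Qed.

Lemma speed_bound_Lploc s m : speed_bound s m -> Lploc p m.
Proof.
move=> [mm m0 _ Em]; split; first exact: measurable_funTS.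
move=> T T0; have := weighted_powp_itv mm (lexx 0) (ltW T0).
under eq_integral do rewrite mul0r oppr0 expR0 mul1r -(ger0_norm (m0 _)).
by move/le_lt_trans; apply; rewrite lte_mul_pinfty// lee_fin expR_ge0.
Qed.

(* Young's inequality for the product [(l e^(-ax) m) * (l^-1 e^(ax)) = m], integrated over [r,
  t]. *)
Lemma speed_bound_young s m (l a r t : R) : speed_bound s m -> 0 < l -> 0 <= r -> r <= t ->
  ((Wp (s r) (s t))%:E <=
    (l `^ p / p)%:E * \int[leb]_(x in `[r, t]) (expR (- (a * p * x)) * m x `^ p)%:E +
    (l^-1 `^ q / q)%:E * \int[leb]_(x in `[r, t]) (expR (a * q * x))%:E)%E.
Proof.
move=> [mm m0 [sm] _] l0 r0 rt; apply: le_trans (sm _ _ r0 rt) _ => {sm}.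
have m1 : measurable_fun (`[r, t] : set R) (fun x => expR (- (a * p * x)) * m x `^ p).
  by apply: measurable_funM; [exact: measurable_discountN|exact: measurable_powp].
have m2 : measurable_fun (`[r, t] : set R) (fun x =>
  expR (a * q * x)) by exact: measurable_discount.
rewrite -!ge0_integralZl//; last 5 first.
- exact/measurable_EFinP.
- by rewrite lee_fin divr_ge0 ?powR_ge0 ?ltW.
- exact/measurable_EFinP.
- by move=> x _; rewrite lee_fin mulr_ge0 ?expR_ge0 ?powR_ge0.
- by rewrite lee_fin divr_ge0 ?powR_ge0 ?ltW.
rewrite -ge0_integralD//; last 4 first.
- by move=> x _; rewrite -EFinM lee_fin !mulr_ge0 ?expR_ge0 ?invr_ge0 ?powR_ge0 ?ltW.
- by apply/measurable_EFinP; exact: measurable_funM.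
- by move=> x _; rewrite -EFinM lee_fin !mulr_ge0 ?expR_ge0 ?invr_ge0 ?powR_ge0 ?ltW.
- by apply/measurable_EFinP; exact: measurable_funM.
apply: ge0_le_integral => //.
- by move=> x _; rewrite lee_fin.
- by apply/measurable_EFinP; exact: measurable_funTS.
- by apply/measurable_EFinP; apply: measurable_funD; exact: measurable_funM.
move=> x _; rewrite -!EFinM -EFinD lee_fin.
have h1 : 0 <= l * expR (- (a * x)) * m x by rewrite !mulr_ge0 ?expR_ge0 ?(ltW l0).
have h2 : 0 <= l^-1 * expR (a * x) by rewrite mulr_ge0 ?invr_ge0 ?expR_ge0 ?(ltW l0).
have := conjugate_powR h1 h2 p0 q0 hpq.
rewrite (_ : l * _ * _ * _ = m x); last first.
  rewrite mulrACA mulrAC [l * _ * _ * _](_ : _ = (l / l) * (expR (- (a * x)) * expR (a * x)) * m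
    x); last by ring.
  by rewrite divff ?gt_eqF// -expRD addNr expR0 !mul1r.
move/le_trans; apply.
rewrite !powRM ?mulr_ge0 ?expR_ge0 ?invr_ge0 ?(ltW l0)//.
have -> : expR (- (a * p * x)) = expR (- (a * x)) `^ p by rewrite -expRM; congr expR; ring.
have -> : expR (a * q * x) = expR (a * x) `^ q by rewrite -expRM; congr expR; ring.
have -> // (a1 a2 a3 a4 a5 : R) : a1 * a2 * a3 / p + a4 * a5 / q = a1 / p * (a2 * a3) + a4 / q *
  a5 by clear; ring.
Qed.

Lemma kinetic_fin s m : speed_bound s m -> kinetic m \is a fin_num.
Proof. by move=> [_ _ _ h]; rewrite ge0_fin_numE// kinetic_ge0. Qed.

(** The modulus is common to all paths of kinetic energy at most [E]. For supersolutions the time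
    step is fixed before the almost minimizing path is chosen, since it prescribes how nearly
    minimal the path must be. *)
Lemma speed_bound_modulus (E T e : R) : 0 <= E -> 0 <= T -> 0 < e ->
  exists2 eta, 0 < eta & forall s m, speed_bound s m -> fine (kinetic m) <= E ->
  forall r t, 0 <= r -> r <= t -> t <= T -> t - r <= eta -> Wp (s r) (s t) <= e.
Proof.
move=> E0 T0 e0.
pose K := expR (delta * T) * E / p + 1.
have K0 : 0 < K by rewrite ltr_wpDl// !mulr_ge0 ?expR_ge0 ?invr_ge0 ?(ltW p0).
(* This weight makes the kinetic term of Young's inequality at most [e / 2]; the other term is
   [C * (t - r)], which dictates [eta]. *)
pose l := (e / 2 / K) `^ p^-1.
have l0 : 0 < l by rewrite powR_gt0// !divr_gt0.
have lp : l `^ p = e / 2 / K by rewrite -powRrM mulVf ?gt_eqF// powRr1// !divr_ge0// ltW.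
pose C := l^-1 `^ q / q.
have C0 : 0 < C by rewrite divr_gt0 ?powR_gt0 ?invr_gt0.
exists (e / 2 / C); first by rewrite divr_gt0// divr_gt0.
move=> s m sm Em r t r0 rt tT tr.
have t0 := le_trans r0 rt.
have [mm m0 _ _] := sm.
have := speed_bound_young 0 sm l0 r0 rt.
rewrite (_ : (\int[leb]_(x in `[r, t]) (expR (0 * q * x))%:E)%E = (t - r)%:E); last first.
  under eq_integral do rewrite !mul0r expR0.
  rewrite integral_cst//= mul1e lebesgue_measure_itv/= lte_fin.
  case: ltP => [_|tr']; first by rewrite EFinB.
  by rewrite (@le_anti _ _ r t) ?subrr// rt.
set I := (\int[leb]_(x in _) _)%E.
have IE : (I <= (expR (delta * T) * E)%:E)%E.
  apply: (@le_trans _ _ ((expR (delta * T))%:E * kinetic m)%E); last first.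
    by rewrite -(fineK (kinetic_fin sm)) -EFinM lee_fin ler_pM2l ?expR_gt0.
  apply: (le_trans _ (weighted_powp_itv mm (lexx 0) T0)); rewrite /I.
  under eq_integral do rewrite !mul0r.
  under [leRHS]eq_integral do rewrite !mul0r.
  apply: ge0_subset_integral => //.
  - apply/measurable_EFinP; apply: measurable_funM => //; exact: measurable_powp.
  - by move=> x _; rewrite lee_fin mulr_ge0 ?expR_ge0 ?powR_ge0.
  - by move=> x /=; rewrite !in_itv/= => /andP[rx xt]; rewrite (le_trans r0 rx) (le_trans xt tT).
rewrite -/C -EFinM => H; rewrite -lee_fin (le_trans H)//.
rewrite (splitr e) EFinD; apply: leeD; last first.
  by rewrite lee_fin mulrC -ler_pdivlMr.
apply: (@le_trans _ _ ((l `^ p / p)%:E * (expR (delta * T) * E)%:E)%E).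
  by apply: lee_wpmul2l => //; rewrite lee_fin divr_ge0 ?powR_ge0 ?ltW.
rewrite -EFinM lee_fin lp -[X in X <= _]mulrA [p^-1 * _]mulrC.
rewrite mulrAC ler_pdivrMr// ler_pM2l ?divr_gt0//.
by rewrite /K lerDl.
Qed.

Lemma measurable_along s m V (D : set R) : speed_bound s m -> Mp_continuous V ->
  measurable D -> D `<=` itv0y -> measurable_fun D (fun t => V (s t)).
Proof.
move=> sm cV mD D0.
(* The path is controlled at nonnegative times only, so time is clamped at [0] to speak of
   continuity on the whole line. *)
have c : continuous (fun t : R => V (s (Num.max t 0))).
  move=> t; apply/(@cvgrPdist_lt _ _ _ (nbhs t) (nbhs_filter t)) => e e0.
  have [r r0 Hr] := cV (s (Num.max t 0)) e e0.
  have T0 : 0 <= Num.max t 0 + 1 by rewrite addr_ge0// le_max lexx orbT.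
  have r2 : 0 < r / 2 by rewrite divr_gt0.
  have [eta eta0 Heta] := speed_bound_modulus (fine_ge0 (kinetic_ge0 m)) T0 r2.
  have e1 : 0 < Num.min eta 1 by rewrite lt_min eta0 ltr01.
  apply: filterS (nbhsx_ballx t _ e1) => u; rewrite /ball/= lt_min => /andP[tu tu1].
  rewrite distrC; apply: Hr; apply: (@le_lt_trans _ _ (r / 2));
    last by rewrite ltr_pdivrMr// ltr_pMr// ltr1n.
  have d1 : `|Num.max t 0 - Num.max u 0| <= `|t - u|.
    have := ler_norm (t - u); have := ler_norm (u - t); rewrite (distrC u t) ler_norml !maxEle.
    by case: (leP t 0); case: (leP u 0); lra.
  have d2 : Num.max u 0 - Num.max t 0 <= `|t - u| by rewrite (le_trans _ d1)// distrC ler_norm.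
  have d3 : Num.max t 0 - Num.max u 0 <= `|t - u| by rewrite (le_trans _ d1)// ler_norm.
  have [tu'|ut'] := leP (Num.max t 0) (Num.max u 0).
    apply: (Heta _ _ sm) => //.
    - by rewrite le_max lexx orbT.
    - by rewrite -lerBlDl (le_trans d2)// ltW.
    - by rewrite (le_trans d2)// ltW.
  rewrite (WpC hp); apply: (Heta _ _ sm) => //.
  - by rewrite le_max lexx orbT.
  - exact: ltW.
  - by rewrite lerDl.
  - by rewrite (le_trans d3)// ltW.
apply: (eq_measurable_fun (fun t : R => V (s (Num.max t 0)) : R)).
  by move=> t; rewrite inE => /D0 /=; rewrite in_itv/= andbT => t0; rewrite max_l.
by apply: measurable_funTS; exact: continuous_measurable_fun.
Qed.

Lemma Wp_continuous (mu : Mp R d p) : Mp_continuous (Wp mu).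
Proof.
move=> nu e e0; exists e => // nu' W.
have := Wp_triangle hp mu nu nu'; have := Wp_triangle hp mu nu' nu; rewrite (WpC hp nu' nu).
rewrite ltr_norml; move: W; lra.
Qed.

(** Weighted Hoelder with [a = delta / 2 / p], so that the kinetic weight has rate
    [a * p = delta / 2]. The dual integral is at most [expR (a * q * t) / (a * q)], and
    [q * (p - 1) = p] turns its power [p - 1] into growth of rate [delta / 2] again. *)
Lemma speed_bound_growth s m t : speed_bound s m -> 0 <= t ->
  ((Wp (s 0) (s t) `^ p)%:E <=
   ((delta / 2 / p * q)^-1 `^ (p - 1))%:E * ((expR (delta / 2 * t))%:E *
     \int[leb]_(x in `[0%R, t]) (expR (- (delta / 2 * x)) * m x `^ p)%:E))%E.
Proof.
move=> sm t0; have [mm m0 _ _] := sm.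
set I := (\int[leb]_(x in _) _)%E; pose a := delta / 2 / p.
have a0 : 0 < a by rewrite !divr_gt0.
have ap : a * p = delta / 2 by rewrite /a divfK ?gt_eqF.
have aq0 : 0 < a * q by rewrite mulr_gt0.
have d20 : 0 <= delta / 2 by rewrite divr_ge0// ltW.
have I0 : (0 <= I)%E by apply: integral_ge0 => x _; rewrite lee_fin mulr_ge0 ?expR_ge0 ?powR_ge0.
have If : I \is a fin_num.
  rewrite ge0_fin_numE//; apply: (le_lt_trans (weighted_powp_itv mm d20 t0)).
  by rewrite lte_mul_pinfty ?lee_fin ?expR_ge0//; have [] := sm.
pose B := expR (a * q * t) / (a * q).
have B0 : 0 < B by rewrite divr_gt0 ?expR_gt0.
have H : Wp (s 0) (s t) `^ p <= B `^ (p - 1) * fine I.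
  apply: (hoelder_of_young hp hpq) => //; [exact: Wp_ge0|exact: fine_ge0|move=> l l0].
  have := speed_bound_young a sm l0 (lexx 0) t0.
  rewrite ap integral_expR_itv ?gt_eqF// mulr0 expR0 -/I -(fineK If) -!EFinM -EFinD lee_fin.
  move/le_trans; apply; rewrite lerD2l ler_pM2l; last by rewrite divr_gt0 ?powR_gt0 ?invr_gt0.
  by rewrite ler_pM2r ?invr_gt0// lerBlDr lerDl.
rewrite -(fineK If) -!EFinM lee_fin (le_trans H)// mulrA ler_wpM2r ?fine_ge0//.
rewrite /B powRM ?expR_ge0 ?invr_ge0 ?(ltW aq0)// mulrC -expRM.
rewrite (_ : a * q * t * (p - 1) = delta / 2 * t)//.
by rewrite -ap -{2}(conjugateM hp hpq); ring.
Qed.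

(** The first factor is the constant of [speed_bound_growth]; the second is the time integral of the
    discount of rate [delta / 2] that remains. *)
Definition growth_constant : R := (delta / 2 / p * q)^-1 `^ (p - 1) * (delta / 2)^-1.

Lemma growth_constant_ge0 : 0 <= growth_constant.
Proof. by rewrite mulr_ge0 ?powR_ge0 ?invr_ge0 ?divr_ge0 ?(ltW delta0). Qed.

Lemma integral_Wp_growth s m : speed_bound s m ->
  (\int[leb]_(t in itv0y) (expR (- (delta * t)) * Wp (s 0%R) (s t) `^ p)%:E <=
   growth_constant%:E * kinetic m)%E.
Proof.
move=> sm; have [mm m0 _ _] := sm; pose K := (delta / 2 / p * q)^-1 `^ (p - 1).
have K0 : 0 <= K by exact: powR_ge0.
have d2 : 0 < delta / 2 by rewrite divr_gt0.
pose f x := expR (- (delta / 2 * x)) * m x `^ p.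
have f0 x : 0 <= f x by rewrite mulr_ge0 ?expR_ge0 ?powR_ge0.
have mf : measurable_fun setT f by apply: measurable_funM;
  [exact: measurable_discountN|exact: measurable_powp].
have mef (D : set R) : measurable D -> measurable_fun D (EFin \o f).
  by move=> mD; apply/measurable_EFinP; exact: measurable_funTS.
have T := @tonelli_discount R (delta / 2) (fun x =>
  K * f x) d2 (measurable_funM (measurable_cst K) mf) (fun x => mulr_ge0 K0 (f0 x)).
have -> : (growth_constant%:E * kinetic m = ((delta / 2)^-1)%:E * \int[leb]_(x in itv0y) (expR
  (- (delta / 2 * x)) * (K * f x))%:E)%E.
  rewrite /growth_constant -/K mulrC EFinM -muleA; congr (_ * _)%E.
  rewrite /kinetic -ge0_integralZl//; last 2 first.
  - apply/measurable_EFinP; apply: measurable_funM;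
    [exact: measurable_discountN|exact: measurable_powp].
  - by move=> x _; rewrite lee_fin mulr_ge0 ?expR_ge0 ?powR_ge0.
  apply: eq_integral => x _; rewrite -EFinM; congr EFin.
  by rewrite [RHS]mulrCA /f; congr (_ * _); rewrite [RHS]mulrA -expRD -opprD -mulrDl -splitr.
rewrite -T; apply: ge0_le_integral_of_le => [t _|t].
  by rewrite lee_fin mulr_ge0 ?expR_ge0 ?powR_ge0.
rewrite /= in_itv/= andbT => t0.
rewrite (_ : (\int[leb]_(x in `[0%R, t]) (K * f x)%:E)%E = (K%:E * \int[leb]_(x in `[0%R,
  t]) (f x)%:E)%E); last first.
  rewrite -ge0_integralZl//; first exact: mef.
  by move=> x _; rewrite lee_fin.
rewrite EFinM; apply: le_trans (lee_wpmul2l _ (speed_bound_growth sm t0)) _;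
  first by rewrite lee_fin expR_ge0.
rewrite -/K muleCA [X in (_ <= X)%E]muleCA lee_wpmul2l// muleA -EFinM -expRD.
by rewrite (_ : - (delta * t) + delta / 2 * t = - (delta / 2 * t)) ?lexx//; lra.
Qed.

Lemma integrable_discount : leb.-integrable itv0y (fun t => (expR (- (delta * t)))%:E).
Proof.
apply/integrableP; split; first by apply/measurable_EFinP; exact: measurable_discountN.
under eq_integral do rewrite gee0_abs ?lee_fin ?expR_ge0//.
by rewrite integral_expR_itvy// ltry.
Qed.

Lemma integrable_kinetic s m : speed_bound s m ->
  leb.-integrable itv0y (fun t => (expR (- (delta * t)) * m t `^ p)%:E).
Proof.
move=> [mm _ _ Em]; apply/integrableP; split.
  apply/measurable_EFinP; apply: measurable_funM;
    [exact: measurable_discountN|exact: measurable_powp].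
by under eq_integral do rewrite gee0_abs ?lee_fin ?mulr_ge0 ?expR_ge0 ?powR_ge0//.
Qed.

Lemma measurable_energy_density V s m (D : set R) : Mp_continuous V -> speed_bound s m ->
  measurable D -> D `<=` itv0y ->
  measurable_fun D (fun t => (expR (- (delta * t)) * (p^-1 * m t `^ p - V (s t)))%:E).
Proof.
move=> cV sm mD D0; have [mm _ _ _] := sm.
apply/measurable_EFinP; apply: measurable_funM; first exact: measurable_discountN.
apply: measurable_funB; last exact: (measurable_along sm).
by apply: measurable_funM => //; exact: measurable_powp.
Qed.

Section coercivity.
Variables (V : Mp R d p -> R) (rho : Mp R d p) (alpha beta : R).
Hypothesis cV : Mp_continuous V.
Hypothesis V_growth : forall mu, V mu <= alpha * Wp mu rho `^ p + beta.
Hypothesis delta_large : 2 `^ p * Num.max alpha 0 * growth_constant <= (2 * p)^-1.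

(** The growth bound recentred from [rho] to the starting point of a path: [2 ^ p] comes from the
    power of a sum, and the maximum with [0] allows for a negative [alpha]. *)
Definition potential_offset (mu : Mp R d p) : R :=
  2 `^ p * Num.max alpha 0 * Wp mu rho `^ p + `|beta|.

Lemma potential_bound mu nu : V nu <= 2 `^ p * Num.max alpha 0 * Wp mu nu `^ p +
  potential_offset mu.
Proof.
have a0 : 0 <= Num.max alpha 0 by rewrite le_max lexx orbT.
have a1 : alpha <= Num.max alpha 0 by rewrite le_max lexx.
have Vn := V_growth nu.
have T := Wp_triangle hp nu mu rho; rewrite (WpC hp nu mu) in T.
move: Vn T (Wp_ge0 mu nu) (Wp_ge0 mu rho) (Wp_ge0 nu rho); rewrite /potential_offset.
move: (V nu) (Wp mu nu) (Wp mu rho) (Wp nu rho) => v x y z vz zxy x0 y0 z0.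
have b0 := ler_norm beta.
have h1 : alpha * z `^ p <= Num.max alpha 0 * z `^ p by rewrite ler_wpM2r ?powR_ge0.
have h2 : z `^ p <= 2 `^ p * (x `^ p + y `^ p).
  apply: le_trans (powR_addr_le x0 y0 (ltW p0)).
  by apply: ge0_ler_powR; rewrite ?nnegrE ?addr_ge0 ?(ltW p0).
have h3 := ler_wpM2l a0 h2.
rewrite (le_trans vz)// addrA lerD// (le_trans h1)// (le_trans h3)//.
by rewrite mulrDr mulrDr !mulrA [Num.max alpha 0 * _]mulrC.
Qed.

(** [delta_large] lets the growth of [V] consume at most half of the kinetic term. The lower bound
    used is an integrable function of time, so a finite energy also forces the density to be
    integrable; splitting off initial time intervals relies on this. *)
Lemma energy_coercive s m : speed_bound s m ->
  ((fine (kinetic m) / (2 * p) - potential_offset (s 0) / delta)%:E <= energy V s m)%E /\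
  ((energy V s m < +oo)%E ->
   leb.-integrable itv0y (fun t => (expR (- (delta * t)) * (p^-1 * m t `^ p - V (s t)))%:E)).
Proof.
move=> sm; have [mm m0 _ Em] := sm.
pose c1 := 2 `^ p * Num.max alpha 0; pose c2 := potential_offset (s 0).
have c10 : 0 <= c1 by rewrite mulr_ge0 ?powR_ge0// le_max lexx orbT.
have mW : measurable_fun itv0y (fun t => Wp (s 0) (s t)).
  by apply: (measurable_along sm) => //; exact: Wp_continuous.
have IW : leb.-integrable itv0y (fun t => (expR (- (delta * t)) * Wp (s 0) (s t) `^ p)%:E).
  apply/integrableP; split.
    apply/measurable_EFinP; apply: measurable_funM; first exact: measurable_discountN.
    exact: (measurableT_comp (measurable_powR p)).
  under eq_integral do rewrite gee0_abs ?lee_fin ?mulr_ge0 ?expR_ge0 ?powR_ge0//.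
  apply: (le_lt_trans (integral_Wp_growth sm)).
  by rewrite lte_mul_pinfty// lee_fin growth_constant_ge0.
have IK := integrable_kinetic sm.
pose f t : \bar R := ((p^-1)%:E * (expR (- (delta * t)) * m t `^ p)%:E -
  (c1%:E * (expR (- (delta * t)) * Wp (s 0%R) (s t) `^ p)%:E + c2%:E * (expR (- (delta *
    t)))%:E))%E.
have I1 : leb.-integrable itv0y (fun t =>
  ((p^-1)%:E * (expR (- (delta * t)) * m t `^ p)%:E)%E) by exact: integrableZl.
have I2 : leb.-integrable itv0y (fun t =>
  (c1%:E * (expR (- (delta * t)) * Wp (s 0%R) (s t) `^ p)%:E)%E) by exact: integrableZl.
have I3 : leb.-integrable itv0y (fun t => (c2%:E * (expR (- (delta * t)))%:E)%E).
  by apply: integrableZl => //; exact: integrable_discount.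
have If : leb.-integrable itv0y f by apply: integrableB => //; exact: integrableD.
have fle t : itv0y t -> (f t <= (expR (- (delta * t)) * (p^-1 * m t `^ p - V (s t)))%:E)%E.
  move=> _; have -> : f t = (p^-1 * (expR (- (delta * t)) * m t `^ p) -
    (c1 * (expR (- (delta * t)) * Wp (s 0) (s t) `^ p) + c2 * expR (- (delta * t))))%:E by [].
  rewrite lee_fin.
  rewrite mulrBr [p^-1 * (_ * _)]mulrCA lerB// [c1 * _]mulrCA [c2 * _]mulrC -mulrDr.
  by apply: ler_wpM2l; [exact: expR_ge0|exact: potential_bound].
split; last first.
  move=> Elt; apply: (integrable_of_le _ If _ fle) => //.
  exact: (measurable_energy_density cV sm).
apply: le_trans (le_integral_of_le leb fle).
rewrite integralB//; last exact: integrableD.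
rewrite integralD// !integralZl//; last exact: integrable_discount.
rewrite integral_expR_itvy// mulr0 oppr0 expR0 mul1r.
have fk := kinetic_fin sm; rewrite -/(kinetic m).
have [w wE] : exists w, (\int[leb]_(t in itv0y) (expR (- (delta * t)) * Wp (s 0%R) (s t) `^
  p)%:E)%E = w%:E.
  by apply/EFin_fin_numP; exact: integrable_fin_num.
have k0 : 0 <= fine (kinetic m) by exact/fine_ge0/kinetic_ge0.
have := integral_Wp_growth sm; rewrite wE.
rewrite -{1 3}(fineK fk); move: (fine (kinetic m)) k0 => k k0.
rewrite -!EFinM lee_fin => wk.
change (k / (2 * p) - potential_offset (s 0) / delta <= p^-1 * k - (c1 * w + c2 * delta^-1)).
have H : c1 * w <= (2 * p)^-1 * k.
  apply: (@le_trans _ _ (c1 * (growth_constant * k))); first by rewrite ler_wpM2l.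
  by rewrite mulrA ler_wpM2r.
have -> : p^-1 * k = (2 * p)^-1 * k + (2 * p)^-1 * k.
  by rewrite -mulrDl; congr (_ * _); field; rewrite gt_eqF.
by rewrite [k / _]mulrC -/c2 opprD addrA lerD2r -addrA lerDl subr_ge0.
Qed.

End coercivity.

End weighted_paths.

(** * Dynamic programming *)

Section dynamic_programming.
Context {R : realType} {d : nat} (p q delta : R).
Hypotheses (hp : 1 < p) (hpq : p^-1 + q^-1 = 1) (delta0 : 0 < delta).
Local Notation leb := (@lebesgue_measure R).
Local Notation itv0y := (`[0%R, +oo[%classic : set R).
Variables (V : Mp R d p -> R) (rho : Mp R d p) (alpha beta : R).

Definition tame_potential : Prop :=
  [/\ Mp_continuous V, forall mu, V mu <= alpha * Wp mu rho `^ p + beta &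
      2 `^ p * Num.max alpha 0 * growth_constant p q delta <= (2 * p)^-1].

Hypothesis hV : tame_potential.
Implicit Types (s : R -> Mp R d p) (m : R -> R) (mu nu : Mp R d p).
Local Notation speed_bound := (speed_bound delta).
Local Notation kinetic := (kinetic p delta).
Local Notation energy := (energy delta V).

Let cV : Mp_continuous V. Proof. by case: hV. Qed.

Lemma tame_coercive s m : speed_bound s m ->
  ((fine (kinetic m) / (2 * p) - potential_offset rho alpha beta (s 0%R) / delta)%:E <= energy s
    m)%E /\
  ((energy s m < +oo)%E ->
   leb.-integrable itv0y (fun t => (expR (- (delta * t)) * (p^-1 * m t `^ p - V (s t)))%:E)).
Proof. by case: hV => c g l; exact: (energy_coercive hp hpq delta0 c g l). Qed.

Let p0 : 0 < p. Proof. exact: lt_trans hp. Qed.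
Let q0 : 0 < q. Proof. exact: lt_trans (conjugate_gt1 hp hpq). Qed.

(** One measurable [v] stands in for the metric derivative in both integrals of the definitions;
    time [0] is a null set. *)
Lemma ae_metric_derivative s m : Lploc p m -> moves_within s m ->
  exists v : R -> R, [/\ measurable_fun setT v, forall t, 0 <= v t <= `|m t|, moves_within s v,
  (\int[leb]_(t in itv0y) (expR (- (delta * t)) * metric_derivative s t `^ p)%:E = kinetic v)%E &
  action delta V s = energy s v].
Proof.
move=> mL [/(path_speed hp mL)[v [mv v0 /MovesWithin sv vE]]].
have FF : Filter (nbhs (almost_everywhere leb)) by exact: ae_filter_ringOfSetsType.
have vE' : {ae leb, forall t, itv0y t -> metric_derivative s t = v t}.
  apply: filterS2 vE ae_neq0 => t tv tn0; rewrite /= in_itv/= andbT => t0.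
  by apply: tv; rewrite lt_neqAle eq_sym tn0.
exists v; split; [exact: mv|exact: v0|exact: sv| |];
  apply: eq_integral_null; apply: filterS vE' => t tv t0; by rewrite tv.
Qed.

Lemma action_le_energy s m : speed_bound s m ->
  ACpdelta delta s /\ (action delta V s <= energy s m)%E.
Proof.
move=> sm; have mL := speed_bound_Lploc delta0 sm.
have [mm m0 smW Em] := sm.
have [v [mv v0 sv vE aE]] := ae_metric_derivative mL smW.
have vm t : v t `^ p <= m t `^ p.
  have /andP[v00 vm] := v0 t; rewrite (ger0_norm (m0 t)) in vm.
  by apply: ge0_ler_powR; rewrite ?nnegrE ?(ltW p0).
split.
  split; first by case: smW => smW; exists m; [exact: mL|exact: smW].
  rewrite vE; apply: le_lt_trans Em; apply: ge0_le_integral_of_le => t _.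
    by rewrite lee_fin mulr_ge0 ?expR_ge0 ?powR_ge0.
  by rewrite lee_fin ler_wpM2l ?expR_ge0.
rewrite aE; apply: le_integral_of_le => t _; rewrite lee_fin; apply: ler_wpM2l;
  first exact: expR_ge0.
by apply: lerB (lexx _); apply: (ler_wpM2l _ (vm t)); rewrite invr_ge0 ltW.
Qed.

Lemma AC_speed_bound s : ACpdelta delta s ->
  exists2 v, speed_bound s v & action delta V s = energy s v.
Proof.
move=> [[m mL /MovesWithin sm] md]; have [v [mv v0 sv vE aE]] := ae_metric_derivative mL sm.
exists v; last exact: aE.
by split; [exact: mv|move=> t; have /andP[] := v0 t|exact: sv|rewrite -vE].
Qed.

Lemma value_le_energy s m : speed_bound s m -> (value_function delta V (s 0%R) <= energy s m)%E.
Proof.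
move=> /action_le_energy[AC]; apply: le_trans.
by apply: ereal_inf_lbound; exists s.
Qed.

Lemma constant_speed_bound mu : speed_bound (fun=> mu) (fun=> 0).
Proof.
split => //; first by split=> r t _ _; rewrite (Wpxx hp) integral_cst//= mul0e.
rewrite /kinetic; under eq_integral do rewrite powR0 ?gt_eqF// mulr0.
by rewrite integral0.
Qed.

(** Bounded below by coercivity, as the kinetic term is nonnegative, and above by the energy of the
    constant path. *)
Lemma value_fin mu : value_function delta V mu \is a fin_num.
Proof.
rewrite fin_numElt; apply/andP; split.
  apply: (@lt_le_trans _ _ (- (potential_offset rho alpha beta mu / delta))%:E);
    first exact: ltNyr.
  apply: le_ereal_inf_tmp => _ [s [AC s0] <-].
  have [v sv ->] := AC_speed_bound AC.
  have [+ _] := tame_coercive sv.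
  apply: le_trans; rewrite s0 lee_fin lerBrDr addNr divr_ge0 ?mulr_ge0 ?(ltW p0)//.
  exact/fine_ge0/kinetic_ge0.
apply: (le_lt_trans (value_le_energy (constant_speed_bound mu))).
rewrite /energy; under eq_integral do rewrite powR0 ?gt_eqF// mulr0 sub0r mulrC EFinM.
rewrite integralZl//; last exact: integrable_discount.
by rewrite integral_expR_itvy// -EFinM ltry.
Qed.

Definition value mu : R := fine (value_function delta V mu).

Lemma valueE mu : value_function delta V mu = (value mu)%:E.
Proof. by rewrite fineK// value_fin. Qed.

Lemma value_approx mu (e : R) : 0 < e ->
  exists s m, [/\ speed_bound s m, s 0 = mu & (energy s m < (value mu + e)%:E)%E].
Proof.
move=> e0; have [_ [s [AC s0] <-]] := lb_ereal_inf_adherent e0 (value_fin mu).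
rewrite -/(value_function _ _ _) valueE => h.
by have [v sv E] := AC_speed_bound AC; exists s, v; split; [exact: sv|exact: s0|rewrite -E;
  exact: h].
Qed.

Lemma kinetic_le_value s m (e : R) : speed_bound s m -> (energy s m < (value (s 0) + e)%:E)%E ->
  fine (kinetic m) <= 2 * p * (value (s 0) + e + potential_offset rho alpha beta (s 0) / delta).
Proof.
move=> sm h; have [H _] := tame_coercive sm.
move: (le_lt_trans H h); rewrite lte_fin ltrBlDr => /ltW.
by rewrite ler_pdivrMr ?mulr_gt0// mulrC.
Qed.

(** The integral of the discount over [[0, h]], equal to [h] up to second order. *)
Definition discount_mass (h : R) : R := (1 - expR (- (delta * h))) / delta.

Lemma integral_discount (h : R) : 0 <= h ->
  (\int[leb]_(t in `[0%R, h[) (expR (- (delta * t)))%:E = (discount_mass h)%:E)%E.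
Proof.
move=> h0; rewrite integral_itv_bndo_bndc; last first.
  by apply/measurable_EFinP; exact: measurable_discountN.
under eq_integral do rewrite -mulNr.
rewrite integral_expR_itv ?oppr_eq0 ?gt_eqF// mulr0 expR0 mulNr; congr EFin.
by rewrite /discount_mass invrN mulrN -mulNr opprB.
Qed.

Lemma integrable_discount_itv (h : R) : 0 <= h ->
  leb.-integrable `[0%R, h[ (fun t : R => (expR (- (delta * t)))%:E).
Proof.
move=> h0; apply/integrableP; split; first by apply/measurable_EFinP; exact: measurable_discountN.
under eq_integral do rewrite gee0_abs ?lee_fin ?expR_ge0//.
by rewrite integral_discount// ltry.
Qed.

Section shifted.
Variables (s : R -> Mp R d p) (m : R -> R) (sm : speed_bound s m) (h : R) (h0 : 0 <= h).

Lemma shifted_speed_bound : speed_bound (fun t => s (t + h)) (fun t => m (t + h)).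
Proof.
have [mm m0 [smW] Em] := sm.
have msh : measurable_fun setT (fun t : R => t + h) by exact: measurable_funD.
split.
- exact: (measurableT_comp mm msh).
- by [].
- split=> r t r0 rt; apply: le_trans (smW _ _ _ _) _; rewrite ?addr_ge0 ?lerD2r//.
  by rewrite integral_shift_itvcc//; apply/measurable_EFinP; exact: measurable_funTS.
- have mk : measurable_fun itv0y (fun t : R => (expR (- (delta * t)) * m t `^ p)%:E).
    by apply/measurable_EFinP; apply: measurable_funM;
      [exact: measurable_discountN|exact: measurable_powp].
  have Ik := integrable_shift h0 (integrable_kinetic sm).
  rewrite /kinetic (_ : integral _ _ _ = \int[leb]_(t in itv0y) ((expR (delta * h))%:E * (expR
    (- (delta * (t + h))) * m (t + h) `^ p)%:E))%E; last first.
    apply: eq_integral => t _; rewrite -EFinM; congr EFin.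
    by rewrite mulrA -expRD; congr (expR _ * _); ring.
  clear smW Em; rewrite integralZl//.
  by apply: lte_mul_pinfty; [rewrite lee_fin expR_ge0| |exact: integrable_lty Ik].
Qed.

Lemma energy_split : (energy s m < +oo)%E ->
  (energy s m = \int[leb]_(t in `[0%R,
    h[) (expR (- (delta * t)) * (p^-1 * m t `^ p - V (s t)))%:E +
    (expR (- (delta * h)))%:E * energy (fun t => s (t + h)%R) (fun t => m (t + h)%R))%E.
Proof.
move=> Elt; have [_ /(_ Elt) IF] := tame_coercive sm.
rewrite {1}/energy (integral_split_shift h0); last exact: measurable_int IF.
congr (_ + _)%E; have Ish := integrable_shift h0 IF.
have e0 t : expR (- (delta * t)) = expR (delta * h) * expR (- (delta * (t + h))).
  by rewrite -expRD; congr expR; ring.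
have -> : energy (fun t => s (t + h)) (fun t => m (t + h)) =
    ((expR (delta * h))%:E * \int[leb]_(t in itv0y)
       (expR (- (delta * (t + h))) * (p^-1 * m (t + h)%R `^ p - V (s (t + h)%R)))%:E)%E.
  by rewrite -integralZl//; apply: eq_integral => t _; rewrite -EFinM; congr EFin;
    rewrite mulrA -e0.
by rewrite muleA -EFinM -expRD addNr expR0 mul1e.
Qed.

(** One half of dynamic programming: what remains of the path after time [h] competes for the value
    at [s h]. *)
Lemma energy_ge_value : (energy s m < +oo)%E ->
  (\int[leb]_(t in `[0%R, h[) (expR (- (delta * t)) * (p^-1 * m t `^ p - V (s t)))%:E +
    (expR (- (delta * h)) * value (s h))%:E <= energy s m)%E.
Proof.
move=> Elt; rewrite (energy_split Elt); apply: leeD2l.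
rewrite EFinM; apply: lee_wpmul2l; first by rewrite lee_fin expR_ge0.
have := value_le_energy shifted_speed_bound; rewrite add0r valueE; exact.
Qed.

End shifted.

Section concatenation.
Variables (g s : R -> Mp R d p) (m : R -> R) (L h c : R).
Hypotheses (sm : speed_bound s m) (h0 : 0 < h) (L0 : 0 <= L) (gs : g h = s 0).
Hypothesis g_lip : forall r t, 0 <= r -> r <= t -> t <= h -> Wp (g r) (g t) <= L * (t - r).
Hypothesis V_low : forall t, 0 <= t -> t <= h -> c <= V (g t).

(** At [t = h] the second branch applies; its value [s 0] is [g h] by [gs]. *)
Definition concat_path t := if t < h then g t else s (t - h).
Definition concat_speed t := if t < h then L else m (t - h).

Let mcs : measurable_fun [set: R] concat_speed.
Proof.
have [mm _ _ _] := sm; apply: measurable_fun_ifT => //.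
- exact: measurable_fun_ltr.
- by apply: (measurableT_comp mm); exact: measurable_funB.
Qed.

Let integral_low r t : r <= t -> t <= h ->
  (\int[leb]_(x in `[r, t]) (concat_speed x)%:E = (L * (t - r))%:E)%E.
Proof.
move=> rt th.
rewrite -integral_itv_bndo_bndc; last by apply/measurable_EFinP; exact: measurable_funTS.
rewrite (@eq_integral _ _ _ _ _ (cst L%:E)) => [|x]; last first.
  rewrite inE/= in_itv/= => /andP[_ xt].
  by rewrite /concat_speed (lt_le_trans xt th).
rewrite integral_cst//= lebesgue_measure_itv/= lte_fin.
move: rt; rewrite le_eqVlt => /orP[/eqP ->|->]; last by rewrite -EFinB -EFinM.
by rewrite ltxx subrr mule0 mulr0.
Qed.

Let integral_high r t : h <= r -> r <= t ->
  (\int[leb]_(x in `[r, t]) (concat_speed x)%:E = \int[leb]_(x in `[(r - h)%R,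
    (t - h)%R]) (m x)%:E)%E.
Proof.
move=> hr rt; have := @integral_shift_itvcc R h (r - h) (t - h) (EFin \o concat_speed).
rewrite !subrK /= => ->; last by apply/measurable_EFinP; exact: measurable_funTS.
apply: eq_integral => x; rewrite inE/= in_itv/= => /andP[rx _].
by rewrite /concat_speed ltNge -lerBlDr (le_trans _ rx) ?lerD2r//= addrK.
Qed.

Let move_low r t : 0 <= r -> r <= t -> t <= h ->
  ((Wp (concat_path r) (concat_path t))%:E <= \int[leb]_(x in `[r, t]) (concat_speed x)%:E)%E.
Proof.
move=> r0 rt th; rewrite (integral_low rt th) lee_fin.
have E x : x <= h -> concat_path x = g x.
  by rewrite /concat_path le_eqVlt => /orP[/eqP ->|->//]; rewrite ltxx subrr gs.
by rewrite !E ?(le_trans rt)//; exact: g_lip.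
Qed.

Let move_high r t : h <= r -> r <= t ->
  ((Wp (concat_path r) (concat_path t))%:E <= \int[leb]_(x in `[r, t]) (concat_speed x)%:E)%E.
Proof.
move=> hr rt; rewrite (integral_high hr rt) /concat_path !ltNge hr (le_trans hr rt)/=.
by have [_ _ [smW] _] := sm; apply: smW; rewrite ?subr_ge0// lerD2r.
Qed.

Let move_all r t : 0 <= r -> r <= t ->
  ((Wp (concat_path r) (concat_path t))%:E <= \int[leb]_(x in `[r, t]) (concat_speed x)%:E)%E.
Proof.
move=> r0 rt; have [th|ht] := leP t h; first exact: move_low.
have [hr|rh] := leP h r; first exact: move_high.
have -> : (\int[leb]_(x in `[r, t]) (concat_speed x)%:E =
    \int[leb]_(x in `[r, h]) (concat_speed x)%:E + \int[leb]_(x in `[h,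
      t]) (concat_speed x)%:E)%E.
  rewrite -(@integral_itv_obnd_cbnd _ h (BRight t)); last by apply/measurable_EFinP;
    exact: measurable_funTS.
  rewrite -integral_setU//=; last 2 first.
  - by apply/measurable_EFinP; exact: measurable_funTS.
  - apply/disj_setPS => x [/=]; rewrite !in_itv/= => /andP[_ xh] /andP[hx _].
    by move: (le_lt_trans xh hx); rewrite ltxx.
  congr (integral _ _ _); apply/seteqP; split => x; rewrite /= !in_itv/=.
    by move=> /andP[rx xt]; case: (leP x h) => hx; [left; rewrite rx|right; rewrite xt].
  by move=> [/andP[rx xh]|/andP[hx xt]];
    [rewrite rx (le_trans xh (ltW ht))|rewrite (ltW (lt_trans rh hx))].
apply: (@le_trans _ _ (Wp (concat_path r) (concat_path h) + Wp (concat_path h) (concat_path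
  t))%:E).
  by rewrite lee_fin; exact: Wp_triangle.
by rewrite EFinD; apply: leeD; [exact: move_low (ltW rh) (lexx h)|exact: move_high (ltW ht)].
Qed.

Lemma concat_speed_bound : speed_bound concat_path concat_speed.
Proof.
have [mm m0 _ Em] := sm.
split; [exact: mcs|by move=> t; rewrite /concat_speed; case: ifP|by split; exact: move_all|].
rewrite /kinetic (integral_split_shift (ltW h0)); last first.
  by apply/measurable_EFinP; apply: measurable_funM;
    [exact: measurable_discountN|exact: measurable_powp].
apply: lte_add_pinfty.
  rewrite (_ : integral _ _ _ = \int[leb]_(t in `[0%R,
    h[) ((L `^ p)%:E * (expR (- (delta * t)))%:E))%E.
    rewrite integralZl//; last exact: integrable_discount_itv (ltW h0).
    by rewrite integral_discount ?(ltW h0)// -EFinM ltry.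
  by apply: eq_integral => t; rewrite inE/= in_itv/= => /andP[_ th];
    rewrite /concat_speed th -EFinM mulrC.
rewrite (_ : integral _ _ _ = \int[leb]_(t in itv0y) ((expR (- (delta * h)))%:E * (expR (-
  (delta * t)) * m t `^ p)%:E))%E.
  rewrite integralZl//; last exact: integrable_kinetic sm.
  by apply: lte_mul_pinfty; rewrite ?lee_fin ?expR_ge0.
apply: eq_integral => t; rewrite inE/= in_itv/= andbT => t0.
rewrite /concat_speed ltNge lerDr t0/= addrK -EFinM mulrA -expRD.
by congr (expR _ * _)%:E; ring.
Qed.

Lemma energy_concat_le : (energy s m < +oo)%E ->
  (energy concat_path concat_speed <=
   ((L `^ p / p - c) * discount_mass h)%:E + (expR (- (delta * h)))%:E * energy s m)%E.
Proof.
move=> Elt; have [_ /(_ Elt) IF] := tame_coercive sm.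
rewrite {1}/energy (integral_split_shift (ltW h0)); last first.
  exact: (measurable_energy_density hp hpq delta0 cV concat_speed_bound).
apply: leeD.
  rewrite EFinM -(integral_discount (ltW h0)) -integralZl//;
    last exact: integrable_discount_itv (ltW h0).
  apply: le_integral_of_le => t; rewrite /= in_itv/= => /andP[t0 th].
  rewrite lee_fin mulrC /concat_speed /concat_path th; apply: ler_wpM2r; first exact: expR_ge0.
  by rewrite [p^-1 * _]mulrC; apply: lerB => //; apply: V_low => //; exact: ltW.
rewrite -integralZl//; apply: le_integral_of_le => t; rewrite /= in_itv/= andbT => t0.
rewrite /concat_speed /concat_path ltNge lerDr t0/= addrK -EFinM lee_fin mulrA -expRD.
by rewrite (_ : - (delta * (t + h)) = - (delta * h) + - (delta * t)) ?lexx//; ring.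
Qed.

End concatenation.

(** The other half of dynamic programming: a Lipschitz piece followed by an almost minimizing path
    from its end. With [L] and [c] constant, the running cost of the piece reduces to a number times
    [discount_mass h]. *)
Lemma value_le_concat (g : R -> Mp R d p) (L h c : R) : 0 < h -> 0 <= L ->
  (forall r t, 0 <= r -> r <= t -> t <= h -> Wp (g r) (g t) <= L * (t - r)) ->
  (forall t, 0 <= t -> t <= h -> c <= V (g t)) ->
  value (g 0) <= (L `^ p / p - c) * discount_mass h + expR (- (delta * h)) * value (g h).
Proof.
move=> h0 L0 gL gV; apply/ler_addgt0Pr => e e0.
have [s [m [sm s0 E]]] := value_approx (g h) e0.
have Elt : (energy s m < +oo)%E by apply: lt_trans E _; exact: ltry.
have B := energy_concat_le sm h0 L0 (esym s0) gL gV Elt.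
have := value_le_energy (concat_speed_bound sm h0 L0 (esym s0) gL).
rewrite {1}/concat_path h0 valueE => H.
rewrite -lee_fin; apply: (le_trans H); apply: (le_trans B).
rewrite -addrA EFinD; apply: leeD2l.
apply: (@le_trans _ _ ((expR (- (delta * h)))%:E * (value (g h) + e)%:E)%E).
  by apply: lee_wpmul2l; [rewrite lee_fin expR_ge0|exact: ltW].
rewrite -EFinM lee_fin mulrDr lerD2l ler_piMl ?(ltW e0)//.
by rewrite -expR0 ler_expR oppr_le0 mulr_ge0// ltW.
Qed.

End dynamic_programming.

(** * Viscosity solution *)

Section first_order.
Context {R : realType} (delta : R) (delta0 : 0 < delta).
Local Notation discount_mass := (discount_mass delta).

Lemma discount_massE (h : R) : expR (- (delta * h)) = 1 - delta * discount_mass h.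
Proof. by rewrite [delta * discount_mass _]mulrC divfK ?gt_eqF// opprB addrC subrK. Qed.

Lemma discount_mass_le (h : R) : discount_mass h <= h.
Proof.
rewrite ler_pdivrMr//; have := expR_ge1Dx (- (delta * h)).
by rewrite mulrC; move: (delta * h) (expR _) => x y; lra.
Qed.

Lemma discount_mass_ge (h : R) : 0 <= h -> h - delta * h ^+ 2 <= discount_mass h.
Proof.
move=> h0; rewrite ler_pdivlMr//.
have x0 : 0 <= delta * h by rewrite mulr_ge0// ltW.
have := expR_ge1Dx (delta * h).
rewrite expRN (_ : (h - delta * h ^+ 2) * delta = delta * h - (delta * h) ^+ 2); last by ring.
move: (delta * h) x0 => x x0 ex.
have e1 : 0 < expR x by exact: expR_gt0.
have : (expR x)^-1 <= (1 + x)^-1 by rewrite lef_pV2 ?posrE// ltr_wpDr.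
have : (1 + x)^-1 <= 1 - x + x ^+ 2.
  rewrite -div1r ler_pdivrMr ?ltr_wpDr//.
  have : 0 <= x ^+ 3 by rewrite exprn_ge0.
  by rewrite (_ : (1 - x + x ^+ 2) * (1 + x) = 1 + x ^+ 3) ?lerDl//; ring.
by move: (expR x)^-1 (1 + x)^-1 => u v; lra.
Qed.

(** Division by [h] as [h] tends to [0]: both [discount_mass h / h] and [expR (- (delta * h))] tend
    to [1]. The slack [h ^+ 2] absorbs the defect of an almost minimizing path. *)
Lemma first_order_limit (X Y : R) :
  (forall h0, 0 < h0 -> exists h, [/\ 0 < h, h <= h0 &
     0 <= discount_mass h * X + expR (- (delta * h)) * (h * Y) + h ^+ 2]) ->
  0 <= X + Y.
Proof.
move=> H; rewrite leNgt; apply/negP => XY.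
(* The coefficient of all the quadratic errors; a step [h] at most [- (X + Y) / (2 * C)] keeps them
   below half of the negative linear term. *)
pose C := delta * (`|X| + `|Y|) + 1.
have C0 : 0 < C by rewrite ltr_wpDl// mulr_ge0 ?addr_ge0// ltW.
have [|h [h0 hC]] := H (- (X + Y) / (2 * C)).
  by rewrite divr_gt0 ?oppr_gt0 ?mulr_gt0.
have k1 := discount_mass_le h; have k2 := discount_mass_ge (ltW h0).
have h2 : 0 <= delta * h ^+ 2 by rewrite mulr_ge0 ?sqr_ge0// ltW.
have b1 : discount_mass h * X <= h * X + delta * h ^+ 2 * `|X|.
  rewrite -lerBlDl -mulrBl (le_trans (ler_norm _))// normrM ler_wpM2r//.
  by rewrite ler_norml; apply/andP; split; lra.
have b2 : expR (- (delta * h)) * (h * Y) <= h * Y + delta * h ^+ 2 * `|Y|.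
  rewrite -lerBlDl -{2}(mul1r (h * Y)) -mulrBl (le_trans (ler_norm _))// !normrM.
  rewrite (gtr0_norm h0) mulrA ler_wpM2r// expr2 mulrA ler_wpM2r ?(ltW h0)//.
  rewrite discount_massE addrAC subrr add0r normrN normrM (gtr0_norm delta0) ler_pM2l//.
  rewrite ger0_norm//; apply: divr_ge0; last exact: ltW.
  by rewrite subr_ge0 -expR0 ler_expR oppr_le0 mulr_ge0// ltW.
have b3 : h * C <= - (X + Y) / 2.
  rewrite (le_trans (ler_wpM2r (ltW C0) hC))// invfM mulrA divfK ?gt_eqF//.
have b4 : h * (h * C) <= h * (- (X + Y) / 2) by rewrite ler_pM2l.
have b5 : h * (X + Y) < 0 by rewrite pmulr_rlt0.
have e : h * (h * C) = delta * h ^+ 2 * `|X| + delta * h ^+ 2 * `|Y| + h ^+ 2.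
  by rewrite /C; ring.
by move: b1 b2 b4 b5; rewrite e mulrDr; lra.
Qed.

(** Right continuity of the [q]-th power at [N], made quantitative by convexity on [[N, N + 1]]. *)
Lemma powR_limit (A N q : R) : 0 <= N -> 1 < q ->
  (forall e, 0 < e -> 0 <= A + e + (N + e) `^ q / q) -> 0 <= A + N `^ q / q.
Proof.
move=> N0 q1 H; have q0 : 0 < q by exact: lt_trans q1.
pose K := (N + 1) `^ q / q + 1.
have K0 : 0 < K by rewrite ltr_wpDl// divr_ge0 ?powR_ge0// ltW.
rewrite leNgt; apply/negP => AN; pose B := - (A + N `^ q / q).
have B0 : 0 < B by rewrite oppr_gt0.
pose e := Num.min 1 (B / 2 / K).
have e0 : 0 < e by rewrite lt_min ltr01/= !divr_gt0.
have e1 : e <= 1 by rewrite ge_min lexx.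
have eK : e * K <= B / 2 by rewrite -ler_pdivlMr// ge_min lexx orbT.
have cvx : (N + e) `^ q <= N `^ q + e * (N + 1) `^ q.
  have := @convex_powR R q (ltW q1) (Itv01 (ltW e0) e1) (N + 1) N.
  rewrite !inE/= !in_itv/= !andbT [X in _ -> _ -> X `^ _ <= _]convRE convRE/= /unstable.onem.
  rewrite (_ : e * (N + 1) + (1 - e) * N = N + e); last by ring.
  move=> /(_ (addr_ge0 N0 ler01) N0)/le_trans; apply.
  by rewrite addrC lerD2r ler_piMl ?powR_ge0// lerBlDr lerDl ltW.
have := H e e0.
have : (N + e) `^ q / q <= N `^ q / q + e * ((N + 1) `^ q / q).
  by rewrite mulrA -mulrDl ler_pM2r ?invr_gt0.
move: eK B0; rewrite /K /B mulrDr mulr1.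
by move: ((N + e) `^ q / q) (N `^ q / q) (e * _) => a b c; lra.
Qed.

End first_order.

Section viscosity.
Context {R : realType} {d : nat} (p q delta : R).
Hypotheses (hp : 1 < p) (hpq : p^-1 + q^-1 = 1) (delta0 : 0 < delta).
Local Notation leb := (@lebesgue_measure R).
Local Notation Tm := (Rd R d * Rd R d)%type.
Variables (V : Mp R d p -> R) (rho : Mp R d p) (alpha beta : R).
Hypothesis hV : tame_potential q delta V rho alpha beta.
Implicit Types (mu nu : Mp R d p) (xi : Rd R d -> Rd R d).
Local Notation value := (value delta V).
Local Notation discount_mass := (discount_mass delta).

Let p0 : 0 < p. Proof. exact: lt_trans hp. Qed.
Let q1 : 1 < q. Proof. exact: conjugate_gt1 hpq. Qed.
Let q0 : 0 < q. Proof. exact: lt_trans q1. Qed.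
Let cV : Mp_continuous V. Proof. by case: hV. Qed.

(** Points at distance below [h] are joined in time [h] at speed at most [1]. Dynamic programming
    along this path and along its reversal bounds the difference of the values from both sides. *)
Lemma value_continuous : Mp_continuous value.
Proof.
move=> mu0 eps eps0.
have [eta eta0 Veta] := cV mu0 ltr01.
pose c := V mu0 - 1; pose X := 1 / p - c - delta * value mu0.
(* The first bound keeps the path where [V] is at least [c]; the second gives [delta * h <= 1 / 2],
   so that the discount leaves at least half of the difference of values in the lower estimate; the
   third makes [2 * h] times the norm of [X] smaller than [eps]. *)
pose h := Num.min (eta / 2) (Num.min (delta^-1 / 2) (eps / (4 * (`|X| + 1)))).
have X1 : 0 < `|X| + 1 by rewrite ltr_wpDl.
have h0 : 0 < h by rewrite !lt_min !divr_gt0 ?invr_gt0 ?mulr_gt0.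
have heta : h < eta.
  by rewrite (@le_lt_trans _ _ (eta / 2))//;
    [rewrite ge_min lexx|rewrite ltr_pdivrMr// ltr_pMr// ltr1n].
have hdelta : delta * h <= 1 / 2.
  rewrite -ler_pdivlMl// mulrC div1r mulrC; apply: le_trans (_ : h <= delta^-1 / 2) _.
    by rewrite ge_min; apply/orP; right; rewrite ge_min lexx.
  by rewrite mulrC.
have hX : 2 * h * `|X| < eps.
  have : h <= eps / (4 * (`|X| + 1)) by rewrite ge_min; apply/orP; right;
    rewrite ge_min lexx orbT.
  rewrite ler_pdivlMr ?mulr_gt0// => hh.
  have : 0 <= h * `|X| by rewrite mulr_ge0// ltW.
  by move: hh h0; rewrite (_ : h * (4 * (`|X| + 1)) = 4 * (h * `|X|) + 4 * h); [lra|ring].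
exists h => // nu Wh.
have [g [g0 gh gL]] := displacement_interpolation hp mu0 nu h0.
have Wh1 : Wp mu0 nu / h <= 1 by rewrite ler_pdivrMr// mul1r ltW.
have lip s t : s <= t -> Wp (g s) (g t) <= 1 * (t - s).
  move=> st; rewrite (le_trans (gL s t))// ger0_norm ?subr_ge0// mul1r ler_piMr// subr_ge0//.
have low t : 0 <= t -> t <= h -> c <= V (g t).
  move=> t0 th; have : Wp mu0 (g t) < eta.
    by rewrite -g0 (le_lt_trans (lip 0 t t0))// mul1r subr0 (le_lt_trans th).
  by move/Veta; rewrite ltr_norml /c => /andP[+ _]; move: (V _) (V _) => x y; lra.
have A := value_le_concat hp hpq delta0 hV h0 ler01 (fun r t _ rt _ => lip r t rt) low.
(* The same estimate for the reversed path [g (h - t)]. *)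
have B : value (g h) <= (1 `^ p / p - c) * discount_mass h + expR (- (delta * h)) * value (g 0).
  have := @value_le_concat _ _ _ _ _ hp hpq delta0 _ _ _ _ hV (fun t => g (h - t)) 1 h c h0 ler01.
  rewrite subrr subr0; apply.
    move=> r t r0 rt th; rewrite (WpC hp) (le_trans (lip _ _ _))//; first by rewrite lerD2l lerN2.
    by rewrite !mul1r (_ : h - r - (h - t) = t - r)//; ring.
  by move=> t t0 th; apply: low; rewrite ?subr_ge0// lerBlDr lerDl.
move: A B; rewrite g0 gh powR1 => A B.
have kh := discount_mass_le delta0 h.
have k0 : 0 <= discount_mass h.
  apply: divr_ge0; last exact: ltW.
  by rewrite subr_ge0 -expR0 ler_expR oppr_le0 mulr_ge0// ltW.
have E := discount_massE delta0 h.
have dk : delta * discount_mass h <= 1 / 2 by rewrite (le_trans _ hdelta)// ler_pM2l.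
rewrite E in A B.
have kX : discount_mass h * `|X| <= h * `|X| by rewrite ler_wpM2r.
have X2 := ler_norm X; have X3 := ler_norm (- X); rewrite normrN in X3.
have kX2 := ler_wpM2l k0 X2; have kX3 := ler_wpM2l k0 X3.
have up : value nu - value mu0 <= h * `|X|.
  apply: le_trans kX; apply: le_trans kX2.
  rewrite (_ : discount_mass h * X = (1 / p - c) * discount_mass h +
    (1 - delta * discount_mass h) * value mu0 - value mu0); last by rewrite /X; ring.
  by rewrite lerD2r.
have lo : (1 - delta * discount_mass h) * (value nu - value mu0) >= - (h * `|X|).
  rewrite lerNl; apply: le_trans kX; apply: le_trans kX2.
  rewrite -subr_ge0 (_ : _ - _ = (1 / p - c) * discount_mass h +
    (1 - delta * discount_mass h) * value nu - value mu0) ?subr_ge0//.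
  by rewrite /X; ring.
have hX0 : 0 <= h * `|X| by rewrite mulr_ge0// ltW.
rewrite ltr_norml; apply/andP; split; last by rewrite (le_lt_trans up)//; move: hX;
  rewrite -mulrA; lra.
have [y0|y0] := leP 0 (value nu - value mu0); first by rewrite (lt_le_trans _ y0)// oppr_lt0.
have : (1 - delta * discount_mass h) * (value nu - value mu0) <= 1 / 2 * (value nu - value mu0).
  by rewrite ler_wnM2r ?(ltW y0)//; move: dk; lra.
move=> /(le_trans lo); move: hX; rewrite -mulrA.
by move: (value nu - value mu0) (h * `|X|) => a b; lra.
Qed.

Lemma superdifferential_le mu0 xi (e : R) : superdifferential q value mu0 xi -> 0 < e ->
  exists2 eta, 0 < eta & forall mu pi, Wp mu0 mu < eta -> opt_couplings mu0 mu pi ->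
    value mu <= value mu0 + fine (pairing xi pi) + e * Wp mu0 mu.
Proof.
move=> [[hxi _] sup] e0; have [eta eta0 Heta] := sup e e0; exists eta => // mu pi Wmu opt.
have fpi := pairing_fin hp hpq (proj1 opt) hxi.
rewrite -lee_fin !EFinD (fineK fpi); apply: le_trans (Heta mu Wmu) _.
by apply: leeD2r; apply: leeD2l; apply: ereal_inf_lbound; exists pi.
Qed.

(** Existence of an optimal coupling matters here: over an empty set the supremum in the definition
    would be [-oo] and the hypothesis void. *)
Lemma subdifferential_ge mu0 xi (e : R) : subdifferential q value mu0 xi -> 0 < e ->
  exists2 eta, 0 < eta & forall mu, Wp mu0 mu < eta ->
    value mu0 - (fine (Lnorm_vec mu0 q xi) + e) * Wp mu0 mu <= value mu.
Proof.
move=> [[hxi _] sub] e0; have [eta eta0 Heta] := sub e e0; exists eta => // mu Wmu.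
have [pi opt cW] := Wp_attained hp mu0 mu.
have fpi := pairing_fin hp hpq (proj1 opt) hxi.
have := pairing_le hp hpq (proj1 opt) hxi; rewrite cW ler_norml => /andP[Hpi _].
rewrite -lee_fin; apply: le_trans (Heta mu Wmu).
apply: (@le_trans _ _ ((value mu0)%:E + pairing xi pi - (e * Wp mu0 mu)%:E)%E).
  have -> : ((value mu0)%:E + pairing xi pi - (e * Wp mu0 mu)%:E = (value mu0 + fine (pairing xi
    pi) - e * Wp mu0 mu)%:E)%E.
    by rewrite EFinB EFinD (fineK fpi).
  by rewrite lee_fin mulrDl opprD addrA lerD2r lerD2l.
apply: leeD2r; apply: leeD2l; apply: ereal_sup_ubound; exists pi => //.
Qed.

(** The equality case of Young's inequality: the [p]-th power of its length is [|xi|^q], and its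
    pairing with [xi] is [- |xi|^q]. *)
Definition steepest_direction xi : Rd R d -> Rd R d :=
  fun x => - (enorm (xi x) `^ (q - 2)) *: (xi x : 'rV[R]_d).

Section steepest.
Variables (mu0 : Mp R d p) (xi : Rd R d -> Rd R d) (hxi : in_Lq mu0 q xi).
Local Notation Y := (steepest_direction xi).
Local Notation N := (fine (Lnorm_vec mu0 q xi)).

Lemma powR_qB2 (a : R) : 0 <= a -> a `^ (q - 2) * a = a `^ (q - 1).
Proof.
move=> a0; have [->|an] := eqVneq a 0; first by rewrite mulr0 powR0// subr_eq0 gt_eqF.
by rewrite -{2}(powRr1 a0) -powRD ?an ?implybT//; congr (_ `^ _); ring.
Qed.

Lemma enorm_steepest x : enorm (Y x) `^ p = enorm (xi x) `^ q.
Proof.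
rewrite enormZ normrN (ger0_norm (powR_ge0 _ _)) powR_qB2 ?enorm_ge0// -powRrM mulrC.
by rewrite (conjugateM q1)// addrC.
Qed.

Lemma dot_steepest x : dot (xi x) (Y x) = - (enorm (xi x) `^ q).
Proof.
rewrite dotZr -sqr_enorm mulNr expr2 mulrA powR_qB2 ?enorm_ge0// mulrC.
by rewrite -powR_predM ?enorm_ge0.
Qed.

Lemma integral_enormq : (\int[mu0]_x (enorm (xi x) `^ q)%:E = (N `^ q)%:E)%E.
Proof.
have [mxi L] := hxi.
have NE : (N%:E = (\int[mu0]_x (enorm (xi x) `^ q)%:E) `^ q^-1)%E.
  by rewrite -(Lnorm_EFin mu0 q (fun x => enorm_ge0 (xi x))) fineK// ge0_fin_numE// Lnorm_ge0.
rewrite -poweR_EFin NE -poweRrM mulVf ?gt_eqF// poweRe1//.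
by apply: integral_ge0 => x _; rewrite lee_fin powR_ge0.
Qed.

Lemma measurable_steepest : measurable_fun setT Y.
Proof.
have [mxi _] := hxi; apply: measurable_fun_RdZ => //.
apply: measurableT_comp => //; apply: (measurableT_comp (measurable_powR (q - 2))).
exact: measurable_fun_enorm.
Qed.

Lemma Lnorm_steepest : Lnorm mu0 p%:E (fun x => (enorm (Y x))%:E) = (N `^ q `^ p^-1)%:E.
Proof.
rewrite (Lnorm_EFin mu0 p (fun x => enorm_ge0 (Y x))).
under eq_integral do rewrite enorm_steepest.
by rewrite integral_enormq poweR_EFin.
Qed.

Lemma steepest_descent : exists (g : R -> Mp R d p) (L : R),
  [/\ 0 <= L, L `^ p = N `^ q, g 0 = mu0,
      forall s t, Wp (g s) (g t) <= L * `|t - s| &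
      forall h, 0 <= h -> exists2 pi, couplings mu0 (g h) pi &
        cost p pi = h * L /\ fine (pairing xi pi) = - (h * N `^ q)].
Proof.
have [mxi _] := hxi.
have Xp : (Lnorm mu0 p%:E (fun x : Rd R d => (enorm x)%:E) < +oo)%E by exact: Mp_Lnorm.
have Yp : (Lnorm mu0 p%:E (fun x => (enorm (Y x))%:E) < +oo)%E by rewrite Lnorm_steepest ltry.
have mY := measurable_steepest; have mX := @measurable_id _ (Rd R d) setT.
have l0 : displaced_law mu0 id Y 0 mu0 by rewrite /displaced_law displaced0.
have [nu l1] := displaced_law_exists hp mX mY Xp Yp 1.
have [g [g0 _ gl gL]] := displaced_path hp mX mY Xp Yp (oner_neq0 R) l0 l1.
rewrite Lnorm_steepest /= in gL.
exists g, (N `^ q `^ p^-1); split => //.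
- exact: powR_ge0.
- by rewrite -powRrM mulVf ?gt_eqF// powRr1// powR_ge0.
- by move=> s t; rewrite mulrC.
move=> h h0.
have mh := @measurable_displaced _ _ _ _ _ _ mX mY h.
have [pi cpi piE] := joint_law_coupling hp mX mh (fun _ _ =>
  erefl : mu0 (id @^-1` _) = mu0 _) (gl h).
exists pi => //; split.
  have E : transport_cost p pi = (h * N `^ q `^ p^-1)%:E.
    rewrite EFinM -Lnorm_steepest -{1}(ger0_norm h0) -{1}(subr0 h) -(Lnorm_displaced hp mu0 id
      mY).
    rewrite (Lnorm_EFin mu0 p (fun x => enorm_ge0 _)) /transport_cost piE.
    - by rewrite displaced0.
    - by apply/measurable_EFinP; apply: (measurableT_comp (measurable_powR p));
      exact: measurable_fun_dist.
    - by move=> z; rewrite lee_fin powR_ge0.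
  by rewrite /cost E.
pose f (z : Tm) := dot (xi z.1) ((z.2 : 'rV[R]_d) - z.1).
have mf : measurable_fun setT f by exact: pairing_measurable.
have fE x : f (x, displaced id Y h x) = - (h * enorm (xi x) `^ q).
  by rewrite /f/= /displaced addrAC subrr add0r dotZr dot_steepest mulrN.
have mfE : measurable_fun setT (EFin \o f) by exact/measurable_EFinP.
have -> : pairing xi pi = (- (h * N `^ q))%:E; last by [].
(* The joint law transports nonnegative integrals, so the pairing is split by sign; along the
   displacement the integrand is [- (h * |xi|^q)], and its positive part vanishes. *)
rewrite /pairing integralE piE; last 2 first.
- exact: measurable_funepos.
- by move=> z; exact: funepos_ge0.
rewrite piE; last 2 first.
- exact: measurable_funeneg.
- by move=> z; exact: funeneg_ge0.
have -> : (\int[mu0]_t (EFin \o f)^\+ (id t, displaced id Y h t) = 0)%E.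
  apply: integral0_eq => x _; rewrite funeposE /= fE; apply/max_idPr.
  by rewrite lee_fin oppr_le0 mulr_ge0// powR_ge0.
have -> : (\int[mu0]_t (EFin \o f)^\- (id t,
  displaced id Y h t) = \int[mu0]_x (h%:E * (enorm (xi x) `^ q)%:E))%E.
  apply: eq_integral => x _; rewrite funenegE /= fE -EFinM opprK; apply/max_idPl.
  by rewrite lee_fin mulr_ge0// powR_ge0.
rewrite ge0_integralZl//; last 2 first.
- by apply/measurable_EFinP; apply: (measurableT_comp (measurable_powR q));
  exact: measurable_fun_enorm.
- by move=> x _; rewrite lee_fin powR_ge0.
by rewrite integral_enormq sub0e -EFinM.
Qed.

End steepest.

Lemma value_subsolution : viscosity_subsolution q delta V value.
Proof.
split.
  move=> mu0 e e0; have [eta eta0 H] := value_continuous mu0 e0; exists eta => // mu /H.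
  by rewrite ltr_norml ltrBlDl => /andP[].
move=> mu0 xi dxi; have [cxi _] := dxi; have [hxi _] := cxi.
rewrite /HJ; set N := fine _.
have [g [L [L0 LN g0 gL gpi]]] := steepest_descent hxi; rewrite -/N in LN gpi.
apply/ler_addgt0Pl => e' e'0; rewrite addr0.
(* The total error is [e + 3 * e * L]: one [e] from the continuity of [V], one [e * L] from the
   superdifferential, and two from exchanging the optimal coupling for the displacement, since both
   have cost at most [L * h]. *)
pose e := e' / (1 + 3 * L).
have L1 : 0 < 1 + 3 * L by rewrite ltr_pwDl// mulr_ge0.
have e0 : 0 < e by rewrite divr_gt0.
have [eta1 eta10 H1] := superdifferential_le dxi e0.
have [eta2 eta20 H2] := pairing_insensitive hp hpq cxi e0.
have [eta3 eta30 H3] := cV mu0 e0.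
have Wg t : 0 <= t -> Wp mu0 (g t) <= L * t.
  by move=> t0; rewrite -g0 (le_trans (gL 0 t))// subr0 ger0_norm.
(* As [p^-1 + q^-1 = 1], the kinetic cost [N^q / p] of the descent and its gain [- N^q] add up to
   [- N^q / q]. *)
suff : 0 <= (N `^ q / p - (V mu0 - e) - delta * value mu0) + (- N `^ q + 3 * e * L).
  have -> : e' = e + 3 * e * L by rewrite /e; field; rewrite gt_eqF.
  have -> : N `^ q / p = N `^ q - q^-1 * N `^ q.
    by rewrite -{2}(mulr1 (N `^ q)) -hpq mulrDr [q^-1 * _]mulrC addrK.
  by move: (N `^ q) (q^-1 * _) (3 * e * L) (delta * _) => a b c x; lra.
apply: (first_order_limit delta0) => h0 h00.
pose h := Num.min h0 (Num.min eta1 (Num.min eta2 eta3) / (2 * (L + 1))).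
have m0 : 0 < Num.min eta1 (Num.min eta2 eta3) by rewrite !lt_min eta10 eta20 eta30.
have LL : 0 < L + 1 by rewrite ltr_wpDl.
have hh0 : 0 < h by rewrite lt_min h00 divr_gt0// mulr_gt0.
have Lh : L * h < Num.min eta1 (Num.min eta2 eta3).
  have : h <= Num.min eta1 (Num.min eta2 eta3) / (2 * (L + 1)) by rewrite ge_min lexx orbT.
  rewrite ler_pdivlMr ?mulr_gt0// => hm; apply: lt_le_trans hm.
  rewrite (_ : h * (2 * (L + 1)) = L * h + (L * h + 2 * h)); last by ring.
  by rewrite ltrDl ltr_wpDl ?mulr_ge0 ?mulr_gt0// ltW.
have [Lh1 Lh2 Lh3] : [/\ L * h < eta1, L * h < eta2 & L * h < eta3].
  by move: Lh; rewrite !lt_min => /and3P[].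
exists h; split; [exact: hh0|by rewrite ge_min lexx|].
have low t : 0 <= t -> t <= h -> V mu0 - e <= V (g t).
  move=> t0 th; have /H3 : Wp mu0 (g t) < eta3.
    by apply: le_lt_trans (Wg t t0) _; apply: le_lt_trans Lh3; rewrite ler_wpM2l.
  by rewrite ltr_norml => /andP[+ _]; move: (V _) (V _) => x y; lra.
have lip r t : 0 <= r -> r <= t -> t <= h -> Wp (g r) (g t) <= L * (t - r).
  by move=> _ rt _; rewrite (le_trans (gL r t))// ger0_norm ?subr_ge0.
have A := value_le_concat hp hpq delta0 hV hh0 L0 lip low.
rewrite g0 LN in A.
have Wh := Wg h (ltW hh0).
have [pi opt cW] := Wp_attained hp mu0 (g h).
have B := H1 (g h) pi (le_lt_trans Wh Lh1) opt.
have [pi' cpi' [cost' pair']] := gpi h (ltW hh0).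
have C := H2 (g h) pi pi' (proj1 opt) cpi'.
rewrite cW cost' pair' in C.
have {}C := C (le_trans Wh (ltW Lh2)).
rewrite (mulrC h L) in C; have {}C := C (ltW Lh2).
have D : value (g h) <= value mu0 + h * (- N `^ q + 3 * e * L).
  apply: (le_trans B); rewrite -addrA lerD2l.
  have eW := ler_wpM2l (ltW e0) Wh.
  move: C; rewrite ler_norml => /andP[_]; rewrite opprK mulrDr -lerBrDr => C.
  rewrite mulrDr mulrN (_ : h * (3 * e * L) = 3 * (e * (L * h))); last by ring.
  move: C eW; move: (e * Wp _ _) (e * (L * h)) (h * _) (fine _) => x y z w; lra.
have E0 : 0 <= expR (- (delta * h)) by exact: expR_ge0.
have {}D := ler_wpM2l E0 D.
have {}A : value mu0 <= (N `^ q / p - (V mu0 - e)) * discount_mass h +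
  expR (- (delta * h)) * (value mu0 + h * (- N `^ q + 3 * e * L)).
  by apply: (le_trans A); rewrite lerD2l.
have {}A : 0 <= discount_mass h * (N `^ q / p - (V mu0 - e) - delta * value mu0) +
     expR (- (delta * h)) * (h * (- N `^ q + 3 * e * L)).
  rewrite -subr_ge0 in A; apply: (le_trans A); rewrite le_eqVlt; apply/orP; left; apply/eqP.
  by rewrite (discount_massE delta0); ring.
by rewrite addr_ge0// sqr_ge0.
Qed.

Lemma value_supersolution : viscosity_supersolution q delta V value.
Proof.
split.
  move=> mu0 e e0; have [eta eta0 H] := value_continuous mu0 e0; exists eta => // mu /H.
  by rewrite ltr_norml ltrBrDl => /andP[+ _]; rewrite addrC.
move=> mu0 xi dxi; have [[hxi _] _] := dxi.
rewrite /HJ; set N := fine _; have N0 : 0 <= N by apply: fine_ge0; exact: Lnorm_ge0.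
(* The remainder of the subdifferential is absorbed by enlarging the norm [N] to [a = N + e]; the
   limit in [e] is taken at the end. *)
rewrite [q^-1 * _]mulrC addrAC; apply: (powR_limit N0 q1) => e e0.
pose a := N + e; have a0 : 0 <= a by rewrite addr_ge0// ltW.
rewrite -/a; apply: (first_order_limit delta0) => h0 h00.
have [eta1 eta10 H1] := subdifferential_ge dxi e0.
have [eta2 eta20 H2] := cV mu0 e0.
pose w := Num.min eta1 eta2 / 2.
have w0 : 0 < w by rewrite divr_gt0// lt_min eta10.
have wm : w < Num.min eta1 eta2 by rewrite ltr_pdivrMr// ltr_pMr ?ltr1n// lt_min eta10.
have [w1 w2] : w < eta1 /\ w < eta2 by move: wm; rewrite lt_min => /andP.
(* A bound on the kinetic energy of every path whose energy exceeds the value by at most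
   [h ^+ 2 <= 1], available before [h] is known. *)
pose E := Num.max 0 (2 * p * (value mu0 + 1 + potential_offset rho alpha beta mu0 / delta)).
have E0 : 0 <= E by rewrite le_max lexx.
have [eta3 eta30 H3] := speed_bound_modulus (d := d) hp hpq delta0 E0 ler01 w0.
pose h := Num.min h0 (Num.min eta3 1).
have hh0 : 0 < h by rewrite !lt_min h00 eta30 ltr01.
have [hh hh3 hh1] : [/\ h <= h0, h <= eta3 & h <= 1].
  by split; rewrite /h !ge_min ?lexx ?orbT.
exists h; split; [exact: hh0|exact: hh|].
have h20 : 0 < h ^+ 2 by rewrite exprn_gt0.
have [s [m [sm s0 Elt]]] := value_approx hp hpq delta0 hV mu0 h20.
have kE : fine (kinetic p delta m) <= E.
  have := @kinetic_le_value _ _ _ _ _ hp hpq delta0 _ _ _ _ hV s m (h ^+ 2) sm.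
  rewrite s0 => /(_ Elt) H; apply: (le_trans H); rewrite /E le_max; apply/orP; right.
  apply: ler_wpM2l; first by rewrite mulr_ge0// ltW.
  by rewrite lerD2r lerD2l expr_le1// ltW.
have Ws t : 0 <= t -> t <= h -> Wp mu0 (s t) <= w.
  move=> t0 th; rewrite -s0; apply: (H3 s m sm kE) => //; first exact: le_trans hh1.
  by rewrite subr0 (le_trans th).
have low t : 0 <= t -> t <= h -> V (s t) <= V mu0 + e.
  move=> t0 th; have /H2 := le_lt_trans (Ws t t0 th) w2.
  by rewrite ltr_norml => /andP[_]; move: (V _) (V _) => x y; lra.
have Ey : (energy delta V s m < +oo)%E by apply: lt_trans Elt _; exact: ltry.
have G := energy_ge_value hp hpq delta0 hV sm (ltW hh0) Ey.
have Wh := Ws h (ltW hh0) (lexx h).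
have B := H1 (s h) (le_lt_trans Wh w1); rewrite -/N -/a in B.
have [mm m0 [smW] _] := sm.
have Im : leb.-integrable `[0%R, h[ (EFin \o m).
  have := Lploc_integrable hp (speed_bound_Lploc delta0 sm) hh0.
  by apply: integrableS => //; apply: subset_itvl; rewrite bnd_simp.
have IW : ((Wp mu0 (s h))%:E <= \int[leb]_(t in `[0%R, h[) (m t)%:E)%E.
  rewrite integral_itv_bndo_bndc; last by apply/measurable_EFinP; exact: measurable_funTS.
  by rewrite -s0; apply: smW => //; exact: ltW.
clear smW.
pose D := expR (- (delta * h)).
have D0 : 0 <= D by exact: expR_ge0.
(* The kinetic part is discounted by [D], the smallest discount on [[0, h]], while the potential
   keeps the exact one. The linear term then carries the same factor as [value (s h)], and the two
   [a * Wp] terms cancel at the end. *)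
have key : ((D * (a * Wp mu0 (s h) - h * (a `^ q / q)) - (V mu0 + e) * discount_mass h)%:E <=
   \int[leb]_(t in `[0%R, h[) (expR (- (delta * t)) * (p^-1 * m t `^ p - V (s t)))%:E)%E.
  pose C := D * (a `^ q / q); pose W := V mu0 + e.
  pose f (t : R) : \bar R := ((D * a)%:E * (m t)%:E - (C%:E + W%:E * (expR (- (delta *
    t)))%:E))%E.
  have I1 : leb.-integrable `[0%R, h[ (fun t => ((D * a)%:E * (m t)%:E)%E) by exact: integrableZl.
  have I2 : leb.-integrable `[0%R, h[ (fun t => (W%:E * (expR (- (delta * t)))%:E)%E).
    by apply: integrableZl => //; exact: integrable_discount_itv (ltW hh0).
  have hE : leb `[0%R, h[ = h%:E by rewrite lebesgue_measure_itv/= lte_fin hh0 -EFinB subr0.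
  have I3 : leb.-integrable `[0%R, h[ (cst C%:E).
    apply/integrableP; split; first exact: measurable_cst.
    change (\int[leb]_(t in `[0%R, h[) (cst `|C|%:E) t < +oo)%E.
    by rewrite integral_cst// [X in (_ * X)%E]hE -EFinM ltry.
  apply: (@le_trans _ _ (\int[leb]_(t in `[0%R, h[) f t)%E).
    rewrite integralB//; last exact: integrableD.
    rewrite integralD// !integralZl//; last exact: integrable_discount_itv (ltW hh0).
    have -> : (\int[leb]_(t in `[0%R, h[) C%:E = (C * h)%:E)%E.
      by rewrite integral_cst// [X in (_ * X)%E]hE -EFinM.
    rewrite integral_discount ?(ltW hh0)//.
    have Ifin : (\int[leb]_(t in `[0%R,
      h[) (m t)%:E)%E \is a fin_num by exact: integrable_fin_num.
    move: IW; rewrite -(fineK Ifin); move: (fine _) => i; rewrite lee_fin => Wi.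
    change (D * (a * Wp mu0 (s h) - h * (a `^ q / q)) - W * discount_mass h <=
            D * a * i - (C * h + W * discount_mass h)).
    rewrite opprD addrA lerD2r mulrBr (_ : D * (h * (a `^ q / q)) = C * h); last by rewrite /C;
      ring.
    by rewrite lerD2r mulrA ler_wpM2l// mulr_ge0.
  apply: le_integral_of_le => t; rewrite /= in_itv/= => /andP[t0 th].
  have -> : f t = (D * a * m t - (C + W * expR (- (delta * t))))%:E by [].
  rewrite lee_fin mulrBr opprD addrA; apply: lerB; last first.
    by rewrite [W * _]mulrC; apply: ler_wpM2l; [exact: expR_ge0|exact: low (ltW th)].
  have Y := conjugate_powR (m0 t) a0 p0 q0 hpq.
  apply: (@le_trans _ _ (D * (m t `^ p / p))).
    by rewrite /C -mulrA -mulrBr; apply: ler_wpM2l => //; rewrite lerBlDr mulrC.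
  rewrite [p^-1 * _]mulrC; apply: ler_wpM2r; first by rewrite divr_ge0 ?powR_ge0// ltW.
  by rewrite ler_expR lerN2 ler_pM2l// ltW.
have F : D * (a * Wp mu0 (s h) - h * (a `^ q / q)) - (V mu0 + e) * discount_mass h +
   D * value (s h) <= value mu0 + h ^+ 2.
  rewrite -lee_fin EFinD; apply: (le_trans _ (ltW Elt)); apply: (le_trans _ G).
  exact: leeD2r.
have {}B := ler_wpM2l D0 B.
have {}F : D * (a * Wp mu0 (s h) - h * (a `^ q / q)) - (V mu0 + e) * discount_mass h +
   D * (value mu0 - a * Wp mu0 (s h)) <= value mu0 + h ^+ 2.
  by apply: le_trans F; rewrite lerD2l.
rewrite -subr_ge0 in F; apply: (le_trans F); rewrite le_eqVlt; apply/orP; left; apply/eqP.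
by rewrite /D (discount_massE delta0); ring.
Qed.

End viscosity.

Lemma growth_constant_small (R : realType) (p q delta c : R) : 1 < p -> p^-1 + q^-1 = 1 ->
  0 <= c -> 2 * (p - 1) < delta -> 4 * p * c <= delta ->
  c * growth_constant p q delta <= (2 * p)^-1.
Proof.
move=> p1 hpq c0 d1 d2; have p0 : 0 < p by exact: lt_trans p1.
have pp : 0 < p - 1 by rewrite subr_gt0.
have d0 : 0 < delta by apply: lt_trans d1; rewrite mulr_gt0.
have q0 : 0 < q by apply: lt_trans (conjugate_gt1 p1 hpq).
have K1 : (delta / 2 / p * q)^-1 `^ (p - 1) <= 1.
  have K : 1 <= delta / 2 / p * q.
    rewrite mulrAC ler_pdivlMr// mul1r -{1}(conjugateM p1 hpq) mulrC ler_pM2r//.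
    by rewrite ler_pdivlMr// mulrC ltW.
  have K0 := lt_le_trans ltr01 K.
  rewrite powRV// invf_le1 ?powR_gt0//.
  by have := ler_powR K (ltW pp); rewrite powRr0.
rewrite /growth_constant; apply: (@le_trans _ _ (c * (delta / 2)^-1)).
  by rewrite ler_wpM2l// ler_piMl// invr_ge0 divr_ge0// ltW.
rewrite invf_div mulrA ler_pdivrMr// mulrC ler_pdivlMl ?mulr_gt0//.
by rewrite (_ : 2 * p * (2 * c) = 4 * p * c)//; ring.
Qed.

Theorem theorem1p2 (R : realType) (p alpha : R) (hp : 1 < p) :
  exists2 delta0 : R, 0 < delta0 &
    forall (d : nat) (q : R) (V : Mp R d p -> R) (rho : Mp R d p)
           (beta delta : R),
      (0 < d)%N ->
      p^-1 + q^-1 = 1 ->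
      Mp_continuous V ->
      (forall mu : Mp R d p, V mu <= alpha * Wp mu rho `^ p + beta) ->
      delta0 < delta ->
      exists2 U : Mp R d p -> R,
        (forall mu, value_function delta V mu = (U mu)%:E) &
        viscosity_solution q delta V U.
Proof.
pose c := 2 `^ p * Num.max alpha 0.
have c0 : 0 <= c by rewrite mulr_ge0 ?powR_ge0// le_max lexx orbT.
have pp : 0 < 2 * (p - 1) by rewrite mulr_gt0// subr_gt0.
(* The two thresholds of [growth_constant_small], with [c] the coefficient of the recentred growth
   bound. *)
exists (Num.max (2 * (p - 1)) (4 * p * c)); first by rewrite lt_max pp.
move=> d q V rho beta delta _ hpq cV V_growth; rewrite gt_max => /andP[d1 d2].
have delta0 : 0 < delta by exact: lt_trans d1.
have hV : tame_potential q delta V rho alpha beta.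
  by split; [exact: cV|exact: V_growth|exact: growth_constant_small (ltW d2)].
exists (value delta V); first exact: (valueE hp hpq delta0 hV).
split.
- exact: (value_continuous hp hpq delta0 hV).
- exact: (value_subsolution hp hpq delta0 hV).
- exact: (value_supersolution hp hpq delta0 hV).
Qed.
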